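(* Let $R_n$ (resp. $S_n$) denote the set of reciprocal (resp. skew-reciprocal) Littlewood polynomials of degree $n$ with square discriminant. Then each of $|R_{8n}|$, $|S_{8n}|$, $|R_{8n-2}|$, $|S_{8n-2}|$ is $\asymp 16^n\log n/\sqrt{n}$ as $n\to\infty$. More precisely: (a) $\displaystyle\lim_{n\to\infty}\frac{|R_{8n}|}{16^n\log n/\sqrt n}=\frac{\Gamma(1/4)^2}{4\sqrt2\,\pi^3}$ and $\displaystyle\lim_{n\to\infty}\frac{|S_{8n}|}{16^n\log n/\sqrt n}=\frac{1}{2\pi^{3/2}}$; (b) $|R_{8n-2}|\sim\frac12|R_{8n}|$ and $|S_{8n-2}|\sim\frac12|S_{8n}|$ as $n\to\infty$.
   Context: A Littlewood polynomial of degree $n$ is a monic polynomial $X^n+a_{n-1}X^{n-1}+\dots+a_0\in\mathbf Z[X]$ with all $a_i\in\{1,-1\}$. A polynomial $f$ of degree $n$ is reciprocal if $f(X)=X^nf(X^{-1})$, and skew-reciprocal if $f(X)=(-1)^{n(n-1)/2}X^nf(-X^{-1})$. ''Square discriminant'' means the discriminant of $f$ is the square of an integer. $f\asymp g$ means $g\ll f\ll g$; $f\sim g$ means $f(n)/g(n)\to1$. *)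

(* Defs.v *)
From Stdlib Require Import Reals.
From Coquelicot Require Import Coquelicot.
From HB Require Import structures.
From mathcomp Require Import all_boot all_order all_algebra all_field.
From mathcomp Require Import boolp.

Set Implicit Arguments.
Unset Strict Implicit.
Unset Printing Implicit Defensive.

Import GRing.Theory Num.Theory.
Local Open Scope ring_scope.

Definition sgnb (b : bool) : int := if b then 1 else -1.

(* The Littlewood polynomial X^n + sum_{i<n} a_i X^i, a_i in {1,-1},
   parametrised by a sign vector.  This parametrisation is a bijection
   onto the Littlewood polynomials of degree n. *)
Definition littlewood (n : nat) (a : {ffun 'I_n -> bool}) : {poly int} :=
  'X^n + \sum_(i < n) (sgnb (a i)) *: 'X^i.

Definition reciprocal (n : nat) (f : {poly int}) : Prop :=
  forall i : nat, (i <= n)%N -> f`_i = f`_(n - i)%N.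

(* f(X) = (-1)^{n(n-1)/2} X^n f(-1/X), written on coefficients:
   the coefficient of X^i in X^n f(-1/X) is (-1)^(n-i) f_(n-i). *)
Definition skew_reciprocal (n : nat) (f : {poly int}) : Prop :=
  forall i : nat, (i <= n)%N ->
    f`_i = (-1) ^+ ((n * (n - 1)) %/ 2)%N * ((-1) ^+ (n - i)%N * f`_(n - i)%N).

Definition croots (f : {poly int}) : seq algC :=
  sval (closed_field_poly_normal (map_poly intr f)).

Definition discriminant (f : {poly int}) : algC :=
  let rs := croots f in
  ((lead_coef f)%:~R : algC) ^+ (2 * (size rs) - 2) *
  \prod_(i < size rs) \prod_(j < size rs | (i < j)%N) (rs`_i - rs`_j) ^+ 2.

Definition square_disc (f : {poly int}) : Prop :=
  exists k : int, discriminant f = (k ^+ 2)%:~R.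

Definition Rset (n : nat) : {set {ffun 'I_n -> bool}} :=
  [set a | `[< reciprocal n (littlewood a) /\ square_disc (littlewood a) >] ].
Definition Sset (n : nat) : {set {ffun 'I_n -> bool}} :=
  [set a | `[< skew_reciprocal n (littlewood a) /\ square_disc (littlewood a) >] ].

Definition cardR (n : nat) : nat := #|Rset n|.
Definition cardS (n : nat) : nat := #|Sset n|.

Local Close Scope ring_scope.
Local Open Scope R_scope.

Definition Gamma (s : R) : R :=
  RInt_gen (fun t => Rpower t (s - 1) * exp (- t)) (at_right 0) (Rbar_locally p_infty).

Definition scale (n : nat) : R := 16 ^ n * ln (INR n) / sqrt (INR n).

Definition asymp (f g : nat -> R) : Prop :=
  exists c1 c2 : R, exists N : nat, 0 < c1 /\ 0 < c2 /\
    forall n : nat, (N <= n)%nat -> c1 * g n <= f n <= c2 * g n.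

(* Main.v *)
(** Write n = 2m and e = 1 in the reciprocal case, e = -1 in the skew-reciprocal
    case.  Then f(X) = X^m g(X + e/X) with g monic and integral, and
    disc f = disc(g)^2 * prod_y (y^2 - 4e) over the roots y of g.  Since f is
    congruent to 1 + X + ... + X^n modulo 2 and n is even, disc f is odd, so disc f
    is a square iff the product is; evaluating g at 2 z and - 2 z with z^2 = e shows
    that the product equals x^2 - e y^2, where y and the difference of x and the
    central coefficient are twice sums of signs, with x odd and 4 | y.  Counting the f with
    x^2 - e y^2 a square thus amounts to summing products of two binomial
    coefficients over Pythagorean triples.  These are parametrised by
    2y = d (u^2 - v^2) and x = d (u^2 + v^2) / 2 (resp. x = d u v) with d odd and
    squarefree and u, v odd.  After normalisation the binomial weights become
    Gaussian, and the sum over (u, v) is asymptotic to a constant times sqrt k / d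
    (for n = 8k or 8k - 2) when d is small compared with sqrt k, the other d being
    negligible; the sum of 1/d over the odd squarefree
    d <= sqrt k then produces the logarithm, with density 4/pi^2. *)

From HB Require Import structures.
From mathcomp Require all_boot all_order all_algebra all_field.
From mathcomp Require boolp ring zify.
From Stdlib Require Lra Psatz.
Require Import Defs.
From Stdlib Require Import Reals.
From Coquelicot Require Import Coquelicot.

(** * The discriminant of a (skew-)reciprocal polynomial *)

Module Discriminant.

Import all_boot all_order all_algebra all_field boolp ring zify.
Import GRing.Theory Num.Theory.
Local Open Scope ring_scope.
Set Implicit Arguments.
Unset Strict Implicit.
Unset Printing Implicit Defensive.

(** The degrees [8n] and [8n - 2] are the even degrees in which [y / 2] is a sum of an even number
    of signs. In the others [y] is 2 modulo 4, so [x^2 - e y^2] is 5 modulo 8 and never a square.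
    The constants have three sources: the squared central binomial coefficient is about
    [16^k / (pi k)]; the sum over [(u, v)] is about [c sqrt k / d], where [c] is a quarter of an
    integral over a quadrant; the sum of [1 / d] is about [(4 / pi^2) ln (sqrt k)]. Together they
    give [2 c / pi^3]. The ratio 1/2 in (b) is that of ['C(2k - 1, k + n)] to ['C(2k, k + n)] when
    [n] is small compared with [k]. The obstacle is uniformity in [d]. After scaling, the pairs
    [(u, v)] form a lattice of mesh [h] with [h^2 = d / sqrt k], which is fine only while [d] is
    small against [sqrt k]. For [d] comparable to [sqrt k] each slice is bounded, and for larger [d]
    it is [O(k / d^2)]; both ranges total [O(sqrt k)], one logarithm below the main term. *)

Lemma prod_const_seq (R : pzSemiRingType) (I : Type) (s : seq I) (x : R) :
  \prod_(i <- s) x = x ^+ size s.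
Proof. by rewrite big_const_seq count_predT iter_mulr_1. Qed.

(** Each pair [i < j] contributes both [r_i - r_j] and [r_j - r_i], whence one sign per pair. The
    induction never divides, so repeated roots are covered. *)
Lemma horner_deriv_prod (R : idomainType) (rs : seq R) :
  \prod_(r <- rs) (\prod_(s <- rs) ('X - s%:P))^`().[r] =
  (-1) ^+ 'C(size rs, 2) *
  \prod_(i < size rs) \prod_(j < size rs | (i < j)%N) (rs`_i - rs`_j) ^+ 2.
Proof.
elim: rs => [|x s IH]; first by rewrite big_nil big_ord0 mulr1.
rewrite big_cons [size _]/= big_ord_recl binS bin1 exprD.
have -> : \prod_(i < size s) \prod_(j < (size s).+1 | (lift ord0 i < j)%N)
     ((x :: s)`_(lift ord0 i) - (x :: s)`_j) ^+ 2 =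
   \prod_(i < size s) \prod_(j < size s | (i < j)%N) (s`_i - s`_j) ^+ 2.
  apply: eq_bigr => i _; rewrite big_mkcond big_ord_recl /= mul1r.
  by rewrite [RHS]big_mkcond.
rewrite [X in _ = _ * (X * _)]big_mkcond big_ord_recl /= mul1r.
under [X in _ = _ * (X * _)]eq_bigr => j _ do rewrite /=.
rewrite big_cons derivM derivXsubC mul1r.
rewrite hornerD hornerM hornerXsubC subrr mul0r addr0.
have -> : \prod_(r <- s) (\prod_(s0 <- s) ('X - s0%:P) +
     ('X - x%:P) * (\prod_(s0 <- s) ('X - s0%:P))^`()).[r] =
   \prod_(r <- s) (r - x) * \prod_(r <- s) (\prod_(s0 <- s) ('X - s0%:P))^`().[r].
  rewrite -big_split /= [LHS]big_seq [RHS]big_seq.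
  apply: eq_bigr => r rs.
  rewrite hornerD hornerM hornerXsubC; suff /rootP-> : root (\prod_(s0 <- s) ('X - s0%:P)) r by rewrite add0r.
  by rewrite root_prod_XsubC.
rewrite IH horner_prod.
under eq_bigr => r _ do rewrite hornerXsubC.
have -> : \prod_(r <- s) (r - x) = (-1) ^+ size s * \prod_(r <- s) (x - r).
  under eq_bigr => r _ do rewrite -opprB -mulN1r.
  by rewrite big_split /= prod_const_seq.
have -> : \prod_(i < size s) (x - s`_i) ^+ 2 = (\prod_(r <- s) (x - r)) ^+ 2.
  rewrite (big_nth 0) big_mkord -prodrXl //.
by ring.
Qed.

Lemma size_croots (f : {poly int}) n :
  f \is monic -> size f = n.+1 -> size (croots f) = n.
Proof.
move=> fm sf; rewrite /croots; case: closed_field_poly_normal => rs /= /(congr1 (size \o polyseq)) /=.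
rewrite (monicP (monic_map _ fm)) scale1r size_prod_XsubC.
by rewrite size_map_poly_id0 ?(monicP fm) ?oner_eq0 // sf => -[].
Qed.

Lemma crootsE (f : {poly int}) : f \is monic ->
  map_poly intr f = \prod_(r <- croots f) ('X - r%:P) :> {poly algC}.
Proof.
move=> fm; rewrite /croots; case: closed_field_poly_normal => rs /= {1}->.
by rewrite (monicP (monic_map _ fm)) scale1r.
Qed.

Lemma discriminantE (f : {poly int}) n : f \is monic -> size f = n.+1 ->
  discriminant f =
  (-1) ^+ 'C(n, 2) * \prod_(r <- croots f) (map_poly intr f^`()).[r].
Proof.
move=> fm sf; rewrite /discriminant (monicP fm) expr1n mul1r -deriv_map.
rewrite (crootsE fm) horner_deriv_prod (size_croots fm sf) mulrA -exprD.
by rewrite addnn -signr_odd odd_double mul1r.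
Qed.

(* [N p] is the determinant of [p] evaluated at the companion matrix of [q]; this keeps
   the norm an integer and makes it compatible with reduction modulo 2. *)
Lemma poly_norm (q : {poly int}) n : q \is monic -> size q = n.+2 ->
  exists N : {poly int} -> int,
    [/\ forall p (rs : seq algC), map_poly intr q = \prod_(r <- rs) ('X - r%:P) ->
          \prod_(r <- rs) (map_poly intr p).[r] = (N p)%:~R,
        {morph N : p1 p2 / p1 * p2},
        forall p1 p2, map_poly intr p1 = map_poly intr p2 :> {poly 'F_2} ->
          (N p1)%:~R = (N p2)%:~R :> 'F_2,
        N 'X = (-1) ^+ n.+1 * q`_0 &
        forall c : int, N c%:P = c ^+ n.+1].
Proof.
move=> qm sq.
have [C CP] : exists C : 'M[int]_n.+1, char_poly C = q.
  have := companionmxK qm; have e : (size q).-1 = n.+1 by rewrite sq.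
  by move: (companionmx q); rewrite e => C; exists C.
exists (fun p => \det (horner_mx C p)); split=> [p rs qE|p1 p2|p1 p2 e||c].
- pose CA := map_mx (intr : int -> algC) C.
  rewrite -det_map_mx map_horner_mx -/CA.
  have CE : char_poly CA = \prod_(r <- rs) ('X - r%:P) by rewrite -map_char_poly CP.
  have src : size rs = n.+1.
    have := size_char_poly CA; rewrite CE size_prod_XsubC; by case.
  set P := map_poly _ p.
  (* Splitting [p] leaves a product of determinants [det (z - C)] over the roots [z] of [p], that
     is, of values of the characteristic polynomial; [C] need not be triangularised. *)
  have [zs ->] := closed_field_poly_normal P.
  rewrite linearZ /= detZ.
  under eq_bigr do rewrite hornerZ.
  rewrite big_split /= prod_const_seq src; congr (_ * _).
  under eq_bigr do rewrite horner_prod.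
  rewrite exchange_big /= rmorph_prod /= (big_morph (fun A : 'M__ => \det A) (@det_mulmx _ _) (det1 _ _)).
  apply: eq_bigr => z _.
  have detB : \det (z%:M - CA) = \prod_(r <- rs) (z - r).
    transitivity (char_poly CA).[z]; last first.
      by rewrite CE horner_prod; apply: eq_bigr => r _; rewrite hornerXsubC.
    rewrite /char_poly -horner_evalE -det_map_mx; congr (\det _).
    apply/matrixP => i j; rewrite !mxE /= horner_evalE hornerD hornerN hornerC.
    by rewrite hornerMn hornerX.
  rewrite rmorphB /= horner_mx_X horner_mx_C.
  have -> : CA - z%:M = (-1) *: (z%:M - CA) by rewrite scaleN1r opprB.
  rewrite detZ detB -src -prod_const_seq.
  rewrite -big_split; apply: eq_bigr => r _ /=.
  by rewrite hornerXsubC mulN1r opprB.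
- by rewrite rmorphM det_mulmx.
- by rewrite -!det_map_mx !map_horner_mx e.
- rewrite horner_mx_X; have := char_poly_det C; rewrite CP => ->.
  by rewrite signrMK.
- by rewrite horner_mx_C det_scalar.
Qed.

(* The Dickson polynomials, characterised by [(dickson e j).[z + e / z] = z ^+ j + (e / z) ^+ j]. *)
Fixpoint dickson2 (e : int) (j : nat) : {poly int} * {poly int} :=
  if j is i.+1 then
    let: (p, q) := dickson2 e i in (q, 'X * q - e *: p)
  else (2%:P, 'X).
Definition dickson e j := (dickson2 e j).1.

Lemma dicksonSS e j : dickson e j.+2 = 'X * dickson e j.+1 - e *: dickson e j.
Proof. by rewrite /dickson /=; case: (dickson2 e j). Qed.

Lemma dickson0 e : dickson e 0 = 2%:P. Proof. by []. Qed.
Lemma dickson1 e : dickson e 1 = 'X. Proof. by []. Qed.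

Lemma size_dickson e j : size (dickson e j.+1) = j.+2 /\ dickson e j.+1 \is monic.
Proof.
suff [] : (size (dickson e j.+1) = j.+2 /\ dickson e j.+1 \is monic) /\
          (size (dickson e j.+2) = j.+3 /\ dickson e j.+2 \is monic) by [].
have step (p q : {poly int}) n : size p = n.+2 -> p \is monic -> (size q <= n.+2)%N ->
    size ('X * p - e *: q) = n.+3 /\ 'X * p - e *: q \is monic.
  move=> sp pm sq; have pn0 : p != 0 by rewrite -size_poly_eq0 sp.
  have sX : size ('X * p) = n.+3 by rewrite mulrC size_mulX // sp.
  have lt : (size (- (e *: q))%R < size ('X * p)%R)%N.
    by rewrite size_polyN sX ltnS (leq_trans (size_scale_leq _ _)).
  by rewrite size_polyDl // monicE lead_coefDl // mulrC lead_coefMX (monicP pm) size_mulX // sp.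
elim: j => [|j [IH1 IH2]].
  rewrite dicksonSS dickson1 size_polyX monicX; split=> //.
  by apply: step; rewrite ?size_polyX ?monicX // dickson0 (leq_trans (size_polyC_leq1 _)).
split=> //; rewrite [dickson e j.+3]dicksonSS; case: IH1 IH2 => s1 m1 [s2 m2].
by apply: step => //; rewrite s1.
Qed.

Lemma horner_dickson (F : fieldType) e (z : F) j : z != 0 ->
  (map_poly intr (dickson e j)).[z + e%:~R / z] = z ^+ j + (e%:~R / z) ^+ j.
Proof.
move=> z0; suff [] : (map_poly intr (dickson e j)).[z + e%:~R / z] = z ^+ j + (e%:~R / z) ^+ j /\
  (map_poly intr (dickson e j.+1)).[z + e%:~R / z] = z ^+ j.+1 + (e%:~R / z) ^+ j.+1 by [].
elim: j => [|j [IH1 IH2]].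
  by rewrite dickson0 dickson1 map_polyC map_polyX hornerC hornerX !expr0 !expr1.
split=> //; rewrite dicksonSS rmorphB rmorphM /= map_polyX map_polyZ.
rewrite hornerD hornerN hornerM hornerX hornerZ IH1 IH2 !exprS.
by field.
Qed.

Section TwistedReciprocal.
Variables (e : int) (f : {poly int}) (m : nat).
Hypotheses (e2 : e ^+ 2 = 1) (fm : f \is monic) (sf : size f = (2 * m.+1).+1).
Hypothesis fsym : forall j, (j <= m.+1)%N -> f`_(m.+1 + j) = e ^+ j * f`_(m.+1 - j).

Definition quotient_poly : {poly int} :=
  (f`_m.+1)%:P + \sum_(j < m.+1) f`_(m.+1 + j.+1) *: dickson e j.+1.
Local Notation g := quotient_poly.

Lemma quotient_poly_monic : size g = m.+2 /\ g \is monic.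
Proof.
rewrite /g big_ord_recr /= addrA.
have fl : f`_(m.+1 + m.+1) = 1.
  by move/monicP: fm; rewrite /lead_coef sf /= mul2n addnn.
rewrite fl scale1r addrC; have [sd md] := size_dickson e m.
set r := (X in _ + X).
have sr : (size r < size (dickson e m.+1))%N.
  rewrite sd ltnS; apply: (leq_trans (size_polyD _ _)); rewrite geq_max.
  rewrite (leq_trans (size_polyC_leq1 _)) //=.
  apply: (leq_trans (size_sum _ _ _)); apply/bigmax_leqP => i _.
  rewrite (leq_trans (size_scale_leq _ _)) //; have [-> _] := size_dickson e i.
  by rewrite ltnS ltn_ord.
by rewrite size_polyDl // monicE lead_coefDl // (monicP md).
Qed.

Lemma horner_quotient_poly (F : fieldType) (z : F) : z != 0 ->
  (map_poly intr f).[z] = z ^+ m.+1 * (map_poly intr g).[z + e%:~R / z].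
Proof.
move=> z0.
have eF : e%:~R ^+ 2 = 1 :> F by rewrite -rmorphXn /= e2.
rewrite (@horner_coef_wide _ (2 * m.+1).+1); last first.
  by rewrite (leq_trans (size_poly _ _)) ?sf.
have -> : \sum_(i < (2 * m.+1).+1) (map_poly intr f)`_i * z ^+ i =
  (map_poly intr f)`_m.+1 * z ^+ m.+1 +
  \sum_(j < m.+1) ((map_poly intr f)`_(m - j) * z ^+ (m - j) +
     (map_poly intr f)`_(m.+1 + j.+1) * z ^+ (m.+1 + j.+1)).
  rewrite -(big_mkord xpredT (fun i => (map_poly intr f)`_i * z ^+ i)).
  rewrite (big_cat_nat (n := m.+2)) //=; last by rewrite ltnS mul2n -addnn leq_addr.
  rewrite big_nat_recr //= -addrA addrCA big_split /=; congr (_ + (_ + _)).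
    rewrite big_mkord (reindex_inj rev_ord_inj) /=.
    by apply: eq_bigr => j _; rewrite subSS.
  have -> : (2 * m.+1).+1 = (m.+1 + m.+2)%N by lia.
  rewrite -{1}[m.+2]add0n big_addn addnK big_mkord.
  by apply: eq_bigr => j _; rewrite addnC addSnnS.
rewrite /g rmorphD /= map_polyC hornerD hornerC rmorph_sum /=.
rewrite horner_sum mulrDr mulr_sumr coef_map mulrC; congr (_ + _).
apply: eq_bigr => j _.
rewrite map_polyZ hornerZ horner_dickson // !coef_map /=.
rewrite fsym ?ltn_ord // -subSS.
rewrite rmorphM rmorphXn /= exprD.
have -> : (e%:~R / z) ^+ j.+1 = e%:~R ^+ j.+1 * z ^- j.+1 by rewrite exprMn exprVn.
have e2j : e%:~R ^+ j.+1 * e%:~R ^+ j.+1 = 1 :> F by rewrite -exprMn -expr2 eF expr1n.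
have zj : z ^+ j.+1 != 0 by rewrite expf_neq0.
have zz : z ^+ m.+1 = z ^+ (m.+1 - j.+1) * z ^+ j.+1 by rewrite -exprD subnK.
rewrite zz; move: zj e2j; set Z := z ^+ j.+1; set E := e%:~R ^+ j.+1; set w := z ^+ _.
set c := _%:~R => zj e2j.
have -> : w * Z * (E * c * (Z + E * Z^-1)) = E * E * c * w + E * c * (w * Z * Z) by field.
by rewrite e2j mul1r.
Qed.

Let F : {poly algC} := map_poly intr f.
Let G : {poly algC} := map_poly intr g.

Lemma twisted_factor (ys : seq algC) : G = \prod_(y <- ys) ('X - y%:P) ->
  F = \prod_(y <- ys) ('X ^+ 2 - y *: 'X + (e%:~R)%:P).
Proof.
move=> GE; have sys : size ys = m.+1.
  have := congr1 (size \o polyseq) GE; rewrite /= size_prod_XsubC.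
  rewrite size_map_poly_id0; first by case: quotient_poly_monic => -> _ [].
  by rewrite (monicP (proj2 quotient_poly_monic)) oner_eq0.
set Q := RHS; apply/eqP; rewrite -subr_eq0.
(* Both sides agree away from 0, so [X (F - Q) - 1] has no root. *)
suff : 'X * (F - Q) == 0 by rewrite mulf_eq0 polyX_eq0.
set P := 'X * (F - Q).
have P0 z : P.[z] = 0.
  rewrite hornerM hornerX; have [->|z0] := eqVneq z 0; first by rewrite mul0r.
  rewrite hornerD hornerN horner_quotient_poly // -/G GE !horner_prod -sys -prod_const_seq.
  rewrite -big_split /= (eq_bigr (fun y => ('X ^+ 2 - y *: 'X + (e%:~R)%:P).[z])) ?subrr ?mulr0 //.
  by move=> y _; rewrite hornerXsubC !(hornerD, hornerN, hornerZ, hornerC, hornerXn, hornerX); field.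
have : size (P - 1) == 1.
  apply/negPn/negP => /closed_rootP [z /rootP].
  by rewrite hornerD hornerN hornerC P0 add0r => /eqP; rewrite oppr_eq0 oner_eq0.
case/size_poly1P => c c0 /eqP; rewrite subr_eq -polyCD => /eqP PE.
by have := P0 0; rewrite PE hornerC => ->; rewrite polyC0.
Qed.

(** A root [y] of [g] yields two roots [a], [b] of [f] with [a + b = y] and [a b = e]. At such a
    root [r], the factor of [f] attached to another root [z] of [g] equals [r (y - z)], so the
    derivatives of [f] at [a] and [b] multiply to [- e^m (y^2 - 4 e)] times the square of the
    derivative of [g] at [y]. Repeated roots are included. *)
Lemma discriminant_twisted_roots (ys : seq algC) : G = \prod_(y <- ys) ('X - y%:P) ->
  discriminant f = \prod_(y <- ys) (y ^+ 2 - 4 * e%:~R) *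
                   (\prod_(y <- ys) (map_poly intr g^`()).[y]) ^+ 2.
Proof.
move=> GE; have sys : size ys = m.+1.
  have := congr1 (size \o polyseq) GE; rewrite /= size_prod_XsubC.
  rewrite size_map_poly_id0; first by case: quotient_poly_monic => -> _ [].
  by rewrite (monicP (proj2 quotient_poly_monic)) oner_eq0.
have FE := twisted_factor GE.
pose a (y : algC) : algC := (y + sqrtC (y ^+ 2 - 4 * e%:~R)) / 2.
pose b (y : algC) : algC := (y - sqrtC (y ^+ 2 - 4 * e%:~R)) / 2.
have ab (y : algC) : a y + b y = y by rewrite /a /b; field.
have amb (y : algC) : a y * b y = e%:~R.
  have := sqrtCK (y ^+ 2 - 4 * e%:~R); rewrite /a /b; set t := sqrtC _ => tt.
  have -> : (y + t) / 2 * ((y - t) / 2) = (y ^+ 2 - t ^+ 2) / 4 by field.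
  by rewrite tt; field.
have qab (y : algC) : 'X ^+ 2 - y *: 'X + (e%:~R)%:P = ('X - (a y)%:P) * ('X - (b y)%:P).
  by rewrite -(amb y) -{1}(ab y) polyCM -mul_polyC polyCD; ring.
have rsE : F = \prod_(r <- map a ys ++ map b ys) ('X - r%:P).
  by rewrite FE big_cat /= !big_map -big_split /=; apply: eq_bigr => y _; rewrite qab.
have /prod_XsubC_eq prs : \prod_(r <- croots f) ('X - r%:P) =
    \prod_(r <- map a ys ++ map b ys) ('X - r%:P) by rewrite -rsE /F crootsE.
rewrite (discriminantE fm sf) (perm_big _ prs) /= big_cat /= !big_map -big_split /=.
have dF (r y : algC) : y \in ys -> r ^+ 2 - y * r + e%:~R = 0 ->
    F^`().[r] = (2 * r - y) * (r ^+ m * G^`().[y]).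
  move=> yin ry; rewrite FE GE !(big_rem y yin) /= !derivM.
  rewrite !(derivD, derivN, derivZ, derivX, derivXn, derivC, derivB) /=.
  rewrite !(hornerE, horner_prod) /= ry subrr !mul0r !addr0 subr0 mul1r -!mulrA.
  congr (_ * _); first by rewrite mulr_natl.
  have -> : r ^+ m = \prod_(z <- rem y ys) r.
    by rewrite prod_const_seq size_rem // sys.
  rewrite -big_split /=; apply: eq_bigr => z _; rewrite !hornerE.
  have -> : r ^+ 2 - z * r + e%:~R = (r ^+ 2 - y * r + e%:~R) + r * (y - z) by ring.
  by rewrite ry add0r.
rewrite big_seq (eq_bigr (fun y => (- e%:~R ^+ m) * ((y ^+ 2 - 4 * e%:~R) * G^`().[y] ^+ 2))); last first.
  move=> y yin; rewrite -!deriv_map -/F.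
  have rt r : ('X - (a y)%:P) * ('X - (b y)%:P) = 'X ^+ 2 - y *: 'X + (e%:~R)%:P ->
      (r - a y) * (r - b y) = 0 -> r ^+ 2 - y * r + e%:~R = 0.
    by move/(congr1 (horner^~ r)); rewrite !hornerE => -> .
  rewrite (dF (a y) y) ?(dF (b y) y) //; last 2 first.
  - by apply: rt; rewrite ?qab // subrr mulr0.
  - by apply: rt; rewrite ?qab // subrr mul0r.
  have -> : e%:~R ^+ m = a y ^+ m * b y ^+ m :> algC by rewrite -exprMn amb.
  have -> : y ^+ 2 - 4 * e%:~R = (a y - b y) ^+ 2.
    by rewrite -(amb y); move: (ab y); move: (a y) (b y) => u v <-; ring.
  have -> : 2 * a y - y = a y - b y by move: (ab y); move: (a y) (b y) => u v <-; ring.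
  have -> : 2 * b y - y = b y - a y by move: (ab y); move: (a y) (b y) => u v <-; ring.
  by ring.
rewrite -big_seq big_split /= prod_const_seq big_split /= prodrXl sys -deriv_map -/G mulrA.
(* ['C(2 * m.+1, 2)] has the parity of [m.+1], which cancels the sign in [- e ^+ m]; the remaining
   exponent [m * m.+1] of [e] is even. *)
suff -> : (-1) ^+ 'C(2 * m.+1, 2) * (- e%:~R ^+ m) ^+ m.+1 = 1 :> algC by rewrite mul1r.
rewrite [X in _ * X]exprNn mulrA -exprD -exprM -signr_odd oddD.
have -> : odd 'C(2 * m.+1, 2) = odd m.+1.
  by rewrite bin2 mul2n -doubleMl doubleK oddM doubleS /= odd_double andbT.
rewrite addbb mul1r -(odd_double_half (m * m.+1)) oddM /= andbN add0n.
by rewrite -mul2n exprM -rmorphXn /= e2 expr1n.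
Qed.

(** [j] stands for the offset [j.+1] from the central coefficient, so [odd j] marks the even
    offsets. Their Dickson polynomials take integral values at [2 z] when [z^2 = e]; those of odd
    offset take values in [z] times the integers. *)
Definition even_part : int :=
  \sum_(j < m.+1 | odd j) e ^+ uphalf j * f`_(m.+1 + j.+1).
Definition odd_part : int :=
  \sum_(j < m.+1 | ~~ odd j) e ^+ j./2 * f`_(m.+1 + j.+1).
Definition twisted_norm : int :=
  (f`_m.+1 + 2 * even_part) ^+ 2 - e * (2 * odd_part) ^+ 2.

Lemma horner_quotient_poly_sqrt (z : algC) : z ^+ 2 = e%:~R ->
  G.[2 * z] = (f`_m.+1 + 2 * even_part)%:~R + z * (2 * odd_part)%:~R.
Proof.
move=> z2; have z0 : z != 0.
  apply/eqP => zE; have /eqP := congr1 (intr : int -> algC) e2.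
  by rewrite rmorphXn /= -z2 zE !expr0n /= eq_sym oner_eq0.
have -> : 2 * z = z + e%:~R / z by rewrite -z2; field.
rewrite /G /g rmorphD /= map_polyC hornerD hornerC rmorph_sum /= horner_sum.
rewrite (bigID (fun j : 'I__ => odd j)) /= addrA rmorphD /=.
rewrite /even_part /odd_part !mulr_sumr !rmorph_sum /= mulr_sumr.
have ez : e%:~R / z = z by rewrite -z2; field.
congr (_ + _ + _); apply: eq_bigr => j oj.
  rewrite map_polyZ hornerZ horner_dickson // ez !rmorphM rmorphXn /= -z2 -exprM.
  have -> : (2 * uphalf j)%N = j.+1 by rewrite mul2n uphalfE even_halfK //= oj.
  by ring.
rewrite map_polyZ hornerZ horner_dickson // ez !rmorphM rmorphXn /= -z2 -exprM.
rewrite mul2n even_halfK // exprS.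
by ring.
Qed.

Lemma discriminant_twisted :
  exists D : int, discriminant f = (twisted_norm * D ^+ 2)%:~R.
Proof.
have [sg gm] := quotient_poly_monic.
have [ys] := closed_field_poly_normal G.
rewrite (monicP (monic_map _ gm)) scale1r => GE.
have [N [NP _ _ _ _]] := poly_norm gm sg.
exists (N g^`()); rewrite (discriminant_twisted_roots GE) (NP _ _ GE) rmorphM rmorphXn /=.
congr (_ * _); pose z : algC := sqrtC e%:~R; have z2 : z ^+ 2 = e%:~R := sqrtCK _.
rewrite /twisted_norm rmorphB rmorphXn [X in _ - X]rmorphM rmorphXn /=.
transitivity (G.[2 * z] * G.[2 * - z]).
  rewrite GE !horner_prod -big_split; apply: eq_bigr => y _ /=.
  by rewrite !hornerE -z2; ring.
by rewrite !horner_quotient_poly_sqrt ?sqrrN // -z2; ring.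
Qed.

End TwistedReciprocal.

Section OddDiscriminant.
Variables (f : {poly int}) (m : nat).
Hypotheses (fm : f \is monic) (sf : size f = (2 * m.+1).+1).
Hypothesis f_odd : forall i, (i <= 2 * m.+1)%N -> (f`_i)%:~R = 1 :> 'F_2.

(** Modulo 2, [(X - 1) f] is [X^(n+1) - 1], whose derivative is [X^n] as [n] is even. Hence
    [(X - 1) f' + f] is congruent to [X^n], where adding [f] does not change the norm because [f]
    vanishes at its own roots. The norm of [X] is the constant term up to sign, which is odd. *)
Lemma discriminant_odd : exists d : int, discriminant f = d%:~R /\ d%:~R = 1 :> 'F_2.
Proof.
have sf' : size f = (2 * m).+3 by rewrite sf; lia.
have [N [NP NM N2 NX NC]] := poly_norm fm sf'.
exists ((-1) ^+ 'C(2 * m.+1, 2) * N f^`()); split.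
  by rewrite (discriminantE fm sf) (NP _ _ (crootsE fm)) rmorphM rmorphXn /=.
have F2 (x y : 'F_2) : x * y = 1 -> y = 1.
  by case: x y => [[|[|x]] //= Hx] [[|[|y]] //= Hy] /(congr1 val) //= _; apply: val_inj.
have N1 : (-1) = 1 :> 'F_2 by apply: val_inj.
rewrite rmorphM rmorphXn rmorphN1 N1 expr1n mul1r.
suff : (N (('X - 1) * f^`()))%:~R = 1 :> 'F_2.
  by rewrite NM rmorphM; apply: F2.
have -> : N (('X - 1) * f^`()) = N (('X - 1) * f^`() + f).
  have inj : injective (intr : int -> algC) by exact: intr_inj.
  apply: inj; rewrite -!(NP _ _ (crootsE fm)) !big_seq; apply: eq_bigr => r rin.
  rewrite rmorphD /= hornerD (crootsE fm); suff /rootP -> : root (\prod_(s <- croots f) ('X - s%:P)) r by rewrite addr0.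
  by rewrite root_prod_XsubC.
have N1' : N 1 = 1 by have := NC 1; rewrite expr1n.
have NXn k : N ('X ^+ k) = N 'X ^+ k.
  by elim: k => [|k IH]; rewrite ?expr0 // !exprS NM IH.
transitivity ((N ('X ^+ (2 * m.+1)))%:~R : 'F_2).
  apply: N2; apply/polyP => i; rewrite !coef_map /= coefD mulrBl mul1r coefB.
  have -> : ('X * f^`())`_i = f`_i *+ i by case: i => [|i]; rewrite coefXM //= coef_deriv.
  rewrite coef_deriv coefXn !rmorphD rmorphN !rmorphMn /=.
  have f_big j : (2 * m.+1 < j)%N -> f`_j = 0 by move=> lt; rewrite nth_default // sf.
  have [lt|gt|->] := ltngtP i (2 * m.+1).
  - rewrite !f_odd ?(ltnW lt) // mulrS opprD addrCA subrr addr0.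
    by rewrite N1 -mulr2n; apply: val_inj.
  - by rewrite !f_big ?(ltn_trans gt (ltnSn i)) // !mulr0z !mul0rn oppr0 !addr0.
  - rewrite [f`_(2 * m.+1).+1]f_big // mulr0z mul0rn subr0 f_odd // mulnC -mulr_natr natrM.
    have -> : 2%:R = 0 :> 'F_2 by apply: val_inj.
    by rewrite !mulr0 add0r.
have NXE : (N 'X)%:~R = 1 :> 'F_2.
  by rewrite NX rmorphM rmorphXn rmorphN1 /= N1 expr1n mul1r f_odd.
by rewrite NXn rmorphXn /= NXE expr1n.
Qed.
End OddDiscriminant.

(** The odd discriminant excludes [D = 0]. After that [twisted_norm * D^2 = k^2] forces [D] to
    divide [k], and the quotient is the required root. *)
Lemma square_disc_twisted (e : int) (f : {poly int}) (m : nat) :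
    e ^+ 2 = 1 -> f \is monic -> size f = (2 * m.+1).+1 ->
    (forall j, (j <= m.+1)%N -> f`_(m.+1 + j) = e ^+ j * f`_(m.+1 - j)) ->
    (forall i, (i <= 2 * m.+1)%N -> (f`_i)%:~R = 1 :> 'F_2) ->
  square_disc f <-> exists c : int, twisted_norm e f m = c ^+ 2.
Proof.
move=> e2 fm sf fsym fodd.
have [D DE] := discriminant_twisted e2 fm sf fsym.
have [d [dE d1]] := discriminant_odd fm sf fodd.
have D0 : D != 0.
  apply/eqP => D0; move: dE; rewrite DE D0 expr0n mulr0 => /intr_inj dE.
  by move: d1; rewrite -dE rmorph0 => /eqP; rewrite eq_sym oner_eq0.
rewrite /square_disc DE; split=> [[k /intr_inj kE]|[c ->]]; last first.
  by exists (c * D); rewrite exprMn.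
have : (D ^+ 2 %| k ^+ 2)%Z by rewrite -kE dvdz_mull.
rewrite dvdz_pexp2r // => /dvdzP [c cE].
by exists c; apply/(mulIf (expf_neq0 2 D0)); rewrite kE cE exprMn.
Qed.

End Discriminant.

(** * Counting sign vectors *)

Module Counting.

Import all_boot all_order all_algebra all_field boolp ring zify.
Import GRing.Theory Num.Theory.
Import Discriminant.
Local Open Scope ring_scope.
Set Implicit Arguments.
Unset Strict Implicit.
Unset Printing Implicit Defensive.

Lemma sgnb2 b : sgnb b ^+ 2 = 1. Proof. by case: b. Qed.
Lemma coef_littlewood n (a : {ffun 'I_n -> bool}) i :
  (littlewood a)`_i = if insub i is Some j then sgnb (a j) else (i == n)%:R.
Proof.
rewrite /littlewood coefD coefXn coef_sum; case: insubP => [j lt jE|].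
  rewrite (bigD1 j) //= big1 ?addr0; last first.
    by move=> l lj; rewrite coefZ coefXn -jE (inj_eq val_inj) eq_sym (negPf lj) mulr0.
  by rewrite coefZ coefXn -jE eqxx mulr1 ltn_eqF ?ltn_ord // add0r.
rewrite -leqNgt => le; rewrite big1 ?addr0 // => l _.
by rewrite coefZ coefXn gtn_eqF ?mulr0 // (leq_trans _ le).
Qed.

Lemma littlewood_monic n (a : {ffun 'I_n -> bool}) :
  size (littlewood a) = n.+1 /\ littlewood a \is monic.
Proof.
have lt : (size (\sum_(i < n) sgnb (a i) *: 'X^i)%R < size ('X^n : {poly int})%R)%N.
  rewrite size_polyXn ltnS (leq_trans (size_sum _ _ _)) //; apply/bigmax_leqP => i _.
  by rewrite (leq_trans (size_scale_leq _ _)) // size_polyXn.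
by rewrite /littlewood size_polyDl // size_polyXn monicE lead_coefDl // lead_coefXn.
Qed.

Lemma littlewood_odd n (a : {ffun 'I_n -> bool}) i : (i <= n)%N ->
  ((littlewood a)`_i)%:~R = 1 :> 'F_2.
Proof.
rewrite leq_eqVlt coef_littlewood => /predU1P [->|lt].
  by rewrite insubN ?ltnn // eqxx.
rewrite insubT; case: (a _) => //=; by apply: val_inj.
Qed.

Definition twisted_sym (e : int) (M : nat) (f : {poly int}) : Prop :=
  forall j, (j <= M)%N -> f`_(M + j) = e ^+ j * f`_(M - j).

Lemma reciprocal_twisted M f : reciprocal (2 * M) f <-> twisted_sym 1 M f.
Proof.
split=> [fr j le|fs i le].
  by rewrite expr1n mul1r fr; [congr (_`_ _) |]; lia.
have [le'|gt] := leqP i M.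
  have := fs (M - i)%N (leq_subr _ _); rewrite expr1n mul1r subKn // => <-.
  by congr (_`_ _); lia.
have := fs (i - M)%N; rewrite expr1n mul1r subnKC ?(ltnW gt) // => ->; last by lia.
by congr (_`_ _); lia.
Qed.

Lemma skew_reciprocal_twisted M f : skew_reciprocal (2 * M) f <-> twisted_sym (-1) M f.
Proof.
have sgnM : (-1) ^+ ((2 * M * (2 * M - 1)) %/ 2) = (-1) ^+ M :> int.
  rewrite -mulnA mulKn // -signr_odd oddM; case: (posnP M) => [->//|M0].
  by rewrite (_ : odd (2 * M - 1)) ?andbT ?signr_odd //; lia.
have N1 (p q : nat) : odd p = odd q -> (-1) ^+ p = (-1) ^+ q :> int.
  by move=> pq; rewrite -signr_odd pq signr_odd.
split=> [fr j le|fs i le].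
  rewrite fr ?sgnM; last by lia.
  rewrite mulrA -exprD; congr (_ * _`_ _); last by lia.
  by apply: N1; lia.
rewrite sgnM mulrA -exprD; have [le'|gt] := leqP i M.
  have := fs (M - i)%N (leq_subr _ _); rewrite subKn // => fi.
  have -> : (2 * M - i = M + (M - i))%N by lia.
  by rewrite fi mulrA -exprD -signr_odd (_ : odd _ = false) ?mul1r //; lia.
have := fs (i - M)%N; rewrite subnKC ?(ltnW gt) // => ->; last by lia.
congr (_ * _`_ _); last by lia.
by apply: N1; lia.
Qed.

Definition is_sq (z : int) : bool := `[< exists c : int, z = c ^+ 2 >].

Definition twisted_set (e : int) (M : nat) : {set {ffun 'I_(2 * M) -> bool}} :=
  [set a | `[< twisted_sym e M (littlewood a) /\ square_disc (littlewood a) >] ].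

Lemma cardR_twisted_set M : cardR (2 * M) = #|twisted_set 1 M|.
Proof.
apply: eq_card => a; rewrite !inE; apply/asboolP/asboolP;
  by move=> [/reciprocal_twisted ? ?].
Qed.

Lemma cardS_twisted_set M : cardS (2 * M) = #|twisted_set (-1) M|.
Proof.
apply: eq_card => a; rewrite !inE; apply/asboolP/asboolP;
  by move=> [/skew_reciprocal_twisted ? ?].
Qed.

Section Half.
Variables (e : int) (m : nat).
Hypothesis e2 : e ^+ 2 = 1.
Local Notation M := m.+1.

(* [s j] is the sign of the coefficient of degree [M + j]; the others follow by symmetry. *)
Definition half_sign (s : {ffun 'I_M -> bool}) (j : nat) : int :=
  if insub j is Some i then sgnb (s i) else 1.

Definition extend (s : {ffun 'I_M -> bool}) : {ffun 'I_(2 * M) -> bool} :=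
  [ffun i : 'I_(2 * M) => 0 < if (i < M)%N then e ^+ (M - i) * half_sign s (M - i) else half_sign s (i - M)].

Definition restrict (a : {ffun 'I_(2 * M) -> bool}) : {ffun 'I_M -> bool} :=
  [ffun j : 'I_M => 0 < (littlewood a)`_(M + j)].

Let e_sgn j : exists b, e ^+ j = sgnb b.
Proof.
case/eqP: (e2); rewrite -subr_eq0 subr_sqr_1 mulf_eq0 subr_eq0 addr_eq0.
by case/orP => /eqP ->; [exists true; rewrite expr1n | exists (~~ odd j); rewrite -signr_odd; case: odd].
Qed.

Lemma half_sign_sgn s j : exists b, half_sign s j = sgnb b.
Proof. by rewrite /half_sign; case: insub => [i|]; [exists (s i)| exists true]. Qed.

Lemma sgnb_gt0 (z : int) b : z = sgnb b -> sgnb (0 < z) = z.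
Proof. by move=> ->; case: b. Qed.

Lemma coef_extend_hi s j : (j <= M)%N -> (littlewood (extend s))`_(M + j) = half_sign s j.
Proof.
rewrite leq_eqVlt coef_littlewood => /predU1P [->|lt].
  rewrite insubN; last by rewrite -leqNgt; lia.
  (* At [j = M] the default value [1] of [half_sign] is the leading coefficient. *)
  by rewrite /half_sign insubN ?ltnn // addnn -mul2n eqxx.
have lt' : (M + j < 2 * M)%N by lia.
rewrite insubT ffunE /= ltnNge leq_addr /= addKn.
by have [b E] := half_sign_sgn s j; apply: sgnb_gt0 E.
Qed.

Lemma twisted_extend s : twisted_sym e M (littlewood (extend s)).
Proof.
case=> [|j] lt; first by rewrite expr0 mul1r subn0 addn0.
rewrite coef_extend_hi // coef_littlewood.
have lt' : (M - j.+1 < 2 * M)%N by lia.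
rewrite insubT ffunE /= subKn // (_ : (M - j.+1 < M)%N); last by lia.
have [b E] := half_sign_sgn s j.+1; have [c E'] := e_sgn j.+1.
rewrite (@sgnb_gt0 _ (b == c)); last by rewrite E E'; case: b c {E E'} => [] [].
by rewrite mulrA -exprD addnn -mul2n exprM e2 expr1n mul1r.
Qed.

Lemma extendK s : restrict (extend s) = s.
Proof.
apply/ffunP => j; rewrite ffunE coef_extend_hi ?(ltnW (ltn_ord j)) //.
by rewrite /half_sign valK; case: (s j).
Qed.

Lemma restrictK a : twisted_sym e M (littlewood a) -> extend (restrict a) = a.
Proof.
move=> sa; have hi j : (j <= M)%N -> half_sign (restrict a) j = (littlewood a)`_(M + j).
  rewrite leq_eqVlt /half_sign => /predU1P [->|lt].
    rewrite insubN ?ltnn // coef_littlewood insubN; first by rewrite addnn -mul2n eqxx.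
    by rewrite -leqNgt; lia.
  rewrite insubT ffunE /= coef_littlewood.
  have lt' : (M + j < 2 * M)%N by lia.
  by rewrite insubT; apply: sgnb_gt0; reflexivity.
apply/ffunP => i; rewrite ffunE; have ai : (littlewood a)`_i = sgnb (a i).
  by rewrite coef_littlewood valK.
have sgn_gt0 b : (0 < sgnb b) = b by case: b.
case: ifPn => [lt|].
  rewrite hi ?leq_subr // sa ?leq_subr // subKn ?(ltnW lt) //.
  by rewrite mulrA -exprD addnn -mul2n exprM e2 expr1n mul1r ai sgn_gt0.
rewrite -leqNgt => le; rewrite hi ?subnKC // ?ai ?sgn_gt0 //.
by have := ltn_ord i; lia.
Qed.

Lemma card_twisted_set :
  #|twisted_set e M| =
  (\sum_(s : {ffun 'I_M -> bool}) is_sq (twisted_norm e (littlewood (extend s)) m))%N.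
Proof.
have -> : twisted_set e M = extend @: [set s | is_sq (twisted_norm e (littlewood (extend s)) m)].
  apply/setP => a; rewrite inE; apply/asboolP/imsetP.
    move=> [sa da]; exists (restrict a); rewrite ?restrictK // inE restrictK //.
    have [sz mon] := littlewood_monic a.
    apply/asboolP; apply/(square_disc_twisted e2 mon sz sa) => // i; exact: littlewood_odd.
  case=> s; rewrite inE => /asboolP sq ->.
  have sa := @twisted_extend s; split=> //; have [sz mon] := littlewood_monic (extend s).
  apply/(square_disc_twisted e2 mon sz sa) => // i; exact: littlewood_odd.
rewrite card_imset; last exact: can_inj extendK.
by rewrite -sum1_card big_mkcond /=; apply: eq_bigr => s _; rewrite inE; case: is_sq.
Qed.

Lemma twisted_norm_extend s :
  twisted_norm e (littlewood (extend s)) m =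
  (half_sign s 0 + 2 * \sum_(j < M | odd j) e ^+ uphalf j * half_sign s j.+1) ^+ 2
  - e * (2 * \sum_(j < M | ~~ odd j) e ^+ j./2 * half_sign s j.+1) ^+ 2.
Proof.
rewrite /twisted_norm /even_part /odd_part.
have -> : (littlewood (extend s))`_M = half_sign s 0 by rewrite -(@coef_extend_hi s 0) // addn0.
by congr ((_ + 2 * _) ^+ 2 - _ * (2 * _) ^+ 2); apply: eq_bigr => j _; rewrite coef_extend_hi.
Qed.
End Half.

(** * Sign sums as binomial sums *)

Lemma sum_ffun_lift (T : finType) n (i0 : 'I_n.+1) (F : {ffun 'I_n.+1 -> T} -> nat) :
  (\sum_(s : {ffun 'I_n.+1 -> T}) F s =
   \sum_(b : T) \sum_(s : {ffun 'I_n -> T})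
     F [ffun i => if unlift i0 i is Some j then s j else b])%N.
Proof.
rewrite pair_big /=.
pose h (p : T * {ffun 'I_n -> T}) : {ffun 'I_n.+1 -> T} :=
  [ffun i => if unlift i0 i is Some j then p.2 j else p.1].
pose h' (s : {ffun 'I_n.+1 -> T}) : T * {ffun 'I_n -> T} :=
  (s i0, [ffun j : 'I_n => s (lift i0 j)]).
rewrite (reindex h) //; exists h' => [[b s] _|s _].
  congr (_, _); first by rewrite ffunE unlift_none.
  by apply/ffunP => j; rewrite !ffunE liftK.
by apply/ffunP => i; rewrite !ffunE; case: unliftP => [j ->|->] //=; rewrite ffunE.
Qed.

Lemma sum_bin_recr p (F : nat -> nat) :
  (\sum_(i < p.+2) 'C(p.+1, i) * F i =
   \sum_(i < p.+1) 'C(p, i) * F i + \sum_(i < p.+1) 'C(p, i) * F i.+1)%N.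
Proof.
rewrite big_ord_recl [X in (_ = X + _)%N]big_ord_recl /= !bin0.
under eq_bigr => i _ do rewrite /bump add1n binS mulnDl.
rewrite big_split /= big_ord_recr /= bin_small // mul0n addn0.
by rewrite -addnA; congr (_ + _)%N.
Qed.

(** The fixed signs [tau] disappear because each free sign takes both values. The odd and the even
    indices then form two independent walks, with [i] and [l] counting the steps up; adding one sign
    lengthens one of them by Pascal's rule. *)
Lemma sum_sign_walk n (tau : nat -> bool) (H : int -> int -> nat) :
  (\sum_(s : {ffun 'I_n -> bool})
      H (\sum_(j < n | odd j) sgnb (tau j) * sgnb (s j))%R
        (\sum_(j < n | ~~ odd j) sgnb (tau j) * sgnb (s j))%R =
   \sum_(i < n./2.+1) \sum_(l < (uphalf n).+1) 'C(n./2, i) * 'C(uphalf n, l) *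
      H ((2 * i)%:Z - (n./2)%:Z)%R ((2 * l)%:Z - (uphalf n)%:Z)%R)%N.
Proof.
elim: n H => [|n IH] H.
  rewrite !big_ord1 bin0 mul1n (big_pred1 [ffun _ => true]).
    by rewrite !big_ord0 mul1n subrr.
  by move=> s; apply/esym/eqP/ffunP => -[].
have Hs b (s : {ffun 'I_n -> bool}) (P : pred nat) :
   \sum_(j < n.+1 | P j) sgnb (tau j) * sgnb
     ([ffun i => if unlift ord_max i is Some j then s j else b] j) =
   \sum_(j < n | P j) sgnb (tau j) * sgnb (s j) + (if P n then sgnb (tau n) * sgnb b else 0).
  rewrite big_mkcond big_ord_recr /= ffunE unlift_none -big_mkcond /=; congr (_ + _).
  rewrite big_mkcond [RHS]big_mkcond; apply: eq_bigr => j _ /=; case: ifP => // _.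
  by rewrite ffunE -[widen_ord _ j](_ : lift ord_max j = _) ?liftK //; apply: val_inj; rewrite /= /bump leqNgt ltn_ord.
rewrite (sum_ffun_lift ord_max) big_bool /=.
have step (b : bool) : (\sum_(s : {ffun 'I_n -> bool})
  H (\sum_(j < n.+1 | odd j) sgnb (tau j) * sgnb
     ([ffun i => if unlift ord_max i is Some j then s j else b] j))%R
    (\sum_(j < n.+1 | ~~ odd j) sgnb (tau j) * sgnb
     ([ffun i => if unlift ord_max i is Some j then s j else b] j))%R =
   \sum_(i < n./2.+1) \sum_(l < (uphalf n).+1) 'C(n./2, i) * 'C(uphalf n, l) *
     H ((2 * i)%:Z - (n./2)%:Z + (if odd n then sgnb (tau n) * sgnb b else 0))%R
     ((2 * l)%:Z - (uphalf n)%:Z + (if ~~ odd n then sgnb (tau n) * sgnb b else 0))%R)%N.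
  rewrite -(IH (fun x y => H (x + (if odd n then sgnb (tau n) * sgnb b else 0))
             (y + (if ~~ odd n then sgnb (tau n) * sgnb b else 0)))).
  by apply: eq_bigr => s _; rewrite (Hs b s odd) (Hs b s (fun j => ~~ odd j)).
rewrite !step.
have sgn2 (F : int -> nat) : (F (sgnb (tau n) * sgnb true)%R + F (sgnb (tau n) * sgnb false)%R = F (-1)%R + F 1%R)%N.
  by case: (tau n); rewrite /= ?mulrN1 ?mulN1r ?opprK ?mulr1 // addnC.
rewrite -big_split /=; case on: (odd n).
- have q1 : uphalf n = (n./2).+1 by rewrite uphalf_half on.
  rewrite q1; set p := n./2.
  pose K (i : nat) := (\sum_(l < p.+2) 'C(p.+1, l) * H ((2 * i)%:Z - p.+1%:Z)%R ((2 * l)%:Z - p.+1%:Z)%R)%N.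
  transitivity (\sum_(i < p.+2) 'C(p.+1, i) * K i)%N; last first.
    by apply: eq_bigr => i _; rewrite big_distrr; apply: eq_bigr => l _ /=; rewrite mulnA.
  rewrite sum_bin_recr -big_split /=; apply: eq_bigr => i _.
  rewrite /K !big_distrr -!big_split /=; apply: eq_bigr => l _.
  rewrite -!mulnDr mulnA !addr0; congr (_ * _)%N.
  rewrite (sgn2 (fun x => H ((2 * i)%:Z - p%:Z + x) _)) -/p; congr (H _ _ + H _ _)%N; lia.
- have q0 : uphalf n = n./2 by rewrite uphalf_half on.
  rewrite q0; set p := n./2.
  apply: eq_bigr => i _.
  transitivity ('C(p, i) * \sum_(l < p.+2) 'C(p.+1, l) * H ((2 * i)%:Z - p%:Z)%R ((2 * l)%:Z - p.+1%:Z)%R)%N; last first.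
    by rewrite big_distrr; apply: eq_bigr => l _ /=; rewrite mulnA.
  rewrite (sum_bin_recr _ (fun l => H _ ((2 * l)%:Z - p.+1%:Z)%R)) -!big_split big_distrr /=; apply: eq_bigr => l _.
  rewrite -!mulnDr mulnA !addr0; congr (_ * _)%N.
  rewrite (sgn2 (fun x => H _ ((2 * l)%:Z - p%:Z + x))); congr (H _ _ + H _ _)%N; lia.
Qed.

Lemma sgnbX c k : sgnb c ^+ k = sgnb (c || ~~ odd k).
Proof. by case: c => /=; rewrite ?expr1n // -signr_odd; case: odd. Qed.

(** Three independent contributions remain: the central sign [b] and the two walks. The last index
    [j = m] is the leading coefficient, which is fixed, so it shifts one of the walks; the parity of
    [m] decides which. *)
Lemma card_twisted_set_walk (c : bool) (m : nat) (e := sgnb c) :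
  (#|twisted_set e m.+1| = \sum_(b : bool) \sum_(i < m./2.+1) \sum_(l < (uphalf m).+1)
     'C(m./2, i) * 'C(uphalf m, l) *
     is_sq ((sgnb b + 2 * ((2 * i)%:Z - (m./2)%:Z + (if odd m then e ^+ uphalf m else 0))) ^+ 2
      - e * (2 * ((2 * l)%:Z - (uphalf m)%:Z + (if odd m then 0 else e ^+ m./2))) ^+ 2)%R)%N.
Proof.
have e2 : e ^+ 2 = 1 by exact: sgnb2.
rewrite card_twisted_set // (sum_ffun_lift ord0); apply: eq_bigr => b _.
pose tau j := c || ~~ odd (if odd j then uphalf j else j./2).
rewrite -(sum_sign_walk m tau (fun x y =>
  is_sq ((sgnb b + 2 * (x + (if odd m then e ^+ uphalf m else 0))) ^+ 2
      - e * (2 * (y + (if odd m then 0 else e ^+ m./2))) ^+ 2)%R : nat)).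
apply: eq_bigr => s _; rewrite (twisted_norm_extend e2).
set s' := finfun _.
have h0 : half_sign s' 0 = sgnb b.
  rewrite /half_sign insubT ffunE (_ : Sub _ _ = ord0) ?unlift_none //; exact: val_inj.
have hS (j : 'I_m) : half_sign s' j.+1 = sgnb (s j).
  have lt : (j.+1 < m.+1)%N by rewrite ltnS.
  rewrite /half_sign insubT ffunE (_ : Sub _ _ = lift ord0 j) ?liftK //; exact: val_inj.
have hm : half_sign s' m.+1 = 1 by rewrite /half_sign insubN ?ltnn.
have sum (P : pred nat) (f : nat -> nat) : (forall j, P j -> e ^+ f j = sgnb (tau j)) ->
   \sum_(j < m.+1 | P j) e ^+ f j * half_sign s' j.+1 =
   \sum_(j < m | P j) sgnb (tau j) * sgnb (s j) + (if P m then e ^+ f m else 0).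
  move=> ef; rewrite big_mkcond big_ord_recr /= hm mulr1 -big_mkcond /=; congr (_ + _).
  by apply: eq_bigr => j Pj; rewrite hS ef.
rewrite h0 (sum odd uphalf); last by move=> j oj; rewrite /tau oj /e sgnbX.
rewrite (sum (fun j => ~~ odd j) half); last by move=> j /negPf oj; rewrite /tau oj /e sgnbX.
by rewrite if_neg.
Qed.

Section OneDimensional.
Variable phi : int -> nat.
Hypothesis phiN : forall x, phi (- x) = phi x.
Local Open Scope nat_scope.

Lemma sum_double n (F : nat -> nat) :
  \sum_(t < (2 * n)) F t = \sum_(c < n) (F (2 * c) + F (2 * c).+1).
Proof.
elim: n => [|n IH]; first by rewrite muln0 !big_ord0.
by rewrite [RHS]big_ord_recr /= -IH mulnS add2n !big_ord_recr /= addnA.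
Qed.

Lemma sum_central_split k (F : nat -> nat) :
  \sum_(i < 2 * k) F i = \sum_(c < k) (F (k + c) + F (k - c.+1)).
Proof.
rewrite mul2n -addnn -(big_mkord xpredT F) (big_cat_nat (n := k)) ?leq_addr //=.
rewrite -{2}[k]add0n big_addn addnK !big_mkord addnC big_split /=; congr (_ + _).
  by apply: eq_bigr => i _; rewrite addnC.
by rewrite (reindex_inj rev_ord_inj).
Qed.

Lemma bin_central_sym k c : c < k -> 'C((2 * k).-1, k - c.+1) = 'C((2 * k).-1, k + c).
Proof. by move=> lt; rewrite -[RHS]bin_sub; [congr 'C(_, _) |]; lia. Qed.

Lemma bin_pred_Pascal k c : 0 < k ->
  'C(2 * k, c.+1) = 'C((2 * k).-1, c.+1) + 'C((2 * k).-1, c).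
Proof. by case: k => // k _; rewrite mulnS /= binS. Qed.

(** Evenness of [phi] folds the sum onto the positive odd numbers [2 t + 1], and [uphalf t] is the
    integer nearest to [(2 t + 1) / 4]. *)
Lemma sum_middle_hi k : 0 < k ->
  \sum_(b : bool) \sum_(i < (2 * k).-1.+1)
    'C((2 * k).-1, i) * phi (sgnb b + 2 * ((2 * i)%:Z - ((2 * k).-1)%:Z + 1))%R =
  \sum_(t < (2 * k).+1) 'C(2 * k, k + uphalf t) * phi (2 * t%:Z + 1)%R.
Proof.
move=> k0; rewrite prednK ?muln_gt0 // exchange_big /=.
under eq_bigr => i _ do rewrite big_bool /= -mulnDr.
rewrite (sum_central_split _ (fun i => 'C((2 * k).-1, i) *
  (phi (1 + 2 * ((2 * i)%:Z - ((2 * k).-1)%:Z + 1)) +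
   phi (-1 + 2 * ((2 * i)%:Z - ((2 * k).-1)%:Z + 1)))%R)).
(* The shifted and doubled walk visits multiples of 4, and the central sign moves it by one, to
   [4 c + 1] or [4 c - 1]. Each [psi c.+1] is reached from two neighbouring positions, whose
   binomial coefficients merge by Pascal's rule. *)
pose psi (c : nat) := phi (4 * c%:Z + 1)%R + phi (4 * c%:Z - 1)%R.
transitivity (\sum_(c < k) 'C((2 * k).-1, k + c) * (psi c + psi c.+1)).
  apply: eq_bigr => c _; rewrite bin_central_sym // -mulnDr; congr (_ * _).
  rewrite /psi addnC; congr (_ + _); last by congr (phi _ + phi _); lia.
  by rewrite -phiN -[phi (-1 + _)]phiN addnC; congr (phi _ + phi _); have := ltn_ord c; lia.
rewrite big_ord_recl /= addn0 (sum_double _ (fun t => 'C(2 * k, k + uphalf t.+1) * phi (2 * (t.+1)%:Z + 1)%R)).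
under eq_bigr => c _ do rewrite mulnDr.
rewrite big_split /=.
have -> : \sum_(c < k) 'C((2 * k).-1, k + c) * psi c =
   'C((2 * k).-1, k) * psi 0 + \sum_(c < k) 'C((2 * k).-1, k + c.+1) * psi c.+1.
  transitivity (\sum_(c < k.+1) 'C((2 * k).-1, k + c) * psi c).
    by rewrite big_ord_recr /= bin_small ?mul0n ?addn0 //; lia.
  by rewrite big_ord_recl /= addn0.
rewrite -addnA; congr (_ + _).
  have -> : psi 0 = 2 * phi 1%R.
    by rewrite /psi mulr0 add0r sub0r phiN addnn mul2n.
  rewrite mulnA; congr (_ * phi _).
  have := bin_pred_Pascal k.-1 k0; rewrite prednK // => ->.
  by have := bin_central_sym k0; rewrite subn1 addn0 => ->; rewrite addnn muln2.
rewrite -big_split /=; apply: eq_bigr => c _.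
have -> : (2 * c)./2 = c by lia.
have -> : uphalf (2 * c) = c by lia.
transitivity ('C(2 * k, k + c.+1) * psi c.+1).
  by rewrite addnS bin_pred_Pascal // mulnDl.
by rewrite /psi mulnDr addnC; congr (_ * phi _ + _ * phi _); lia.
Qed.

(** Without the shift the doubled walk visits [4 c + 2] and its negative. The neighbours [4 c + 1]
    and [4 c + 3] are reached from there only, so no coefficients merge, and the factor 2 comes from
    folding by evenness. *)
Lemma sum_middle_lo k : 0 < k ->
  \sum_(b : bool) \sum_(i < (2 * k).-1.+1)
    'C((2 * k).-1, i) * phi (sgnb b + 2 * ((2 * i)%:Z - ((2 * k).-1)%:Z))%R =
  2 * \sum_(t < (2 * k).+1) 'C((2 * k).-1, k + t./2) * phi (2 * t%:Z + 1)%R.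
Proof.
move=> k0; rewrite prednK ?muln_gt0 // exchange_big /=.
under eq_bigr => i _ do rewrite big_bool /= -mulnDr.
rewrite (sum_central_split _ (fun i => 'C((2 * k).-1, i) *
  (phi (1 + 2 * ((2 * i)%:Z - ((2 * k).-1)%:Z)) +
   phi (-1 + 2 * ((2 * i)%:Z - ((2 * k).-1)%:Z)))%R)).
rewrite big_ord_recr /= [X in _ = 2 * (_ + X)](_ : _ = 0) ?addn0; last first.
  by rewrite bin_small //; lia.
rewrite (sum_double _ (fun t => 'C((2 * k).-1, k + t./2) * phi (2 * t%:Z + 1)%R)).
rewrite big_distrr /=; apply: eq_bigr => c _; rewrite bin_central_sym //.
have -> : (2 * c)./2 = c by lia.
have -> : uphalf (2 * c) = c by lia.
have lt := ltn_ord c.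
have -> : (1 + 2 * ((2 * (k + c))%:Z - ((2 * k).-1)%:Z) = 2 * ((2 * c).+1)%:Z + 1)%R by lia.
have -> : (-1 + 2 * ((2 * (k + c))%:Z - ((2 * k).-1)%:Z) = 2 * (2 * c)%:Z + 1)%R by lia.
have -> : (1 + 2 * ((2 * (k - c.+1))%:Z - ((2 * k).-1)%:Z) = - (2 * (2 * c)%:Z + 1))%R by lia.
have -> : (-1 + 2 * ((2 * (k - c.+1))%:Z - ((2 * k).-1)%:Z) = - (2 * ((2 * c).+1)%:Z + 1))%R by lia.
by rewrite !phiN; ring.
Qed.

(** By evenness the fixed last step [e] can be replaced by the average over both signs. This turns a
    walk with [(2 * k).-1] free steps into one with [2 * k], at the price of the factor 2. *)
Lemma sum_pairs (e : int) k : 0 < k -> (e = 1 \/ e = -1)%R ->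
  2 * \sum_(l < (2 * k).-1.+1) 'C((2 * k).-1, l) * phi (2 * ((2 * l)%:Z - ((2 * k).-1)%:Z + e))%R =
  \sum_(l < (2 * k).+1) 'C(2 * k, l) * phi (4 * (l%:Z - k%:Z))%R.
Proof.
move=> k0 e1.
pose S (d : nat) := \sum_(l < (2 * k).-1.+1) 'C((2 * k).-1, l) * phi (4 * ((l + d)%:Z - k%:Z))%R.
have S01 : S 0 = S 1.
  rewrite /S (reindex_inj rev_ord_inj) /=; apply: eq_bigr => l _.
  have lt := ltn_ord l; rewrite subSS bin_sub; last by lia.
  by rewrite -phiN; congr (_ * phi _); lia.
have -> : \sum_(l < (2 * k).-1.+1) 'C((2 * k).-1, l) * phi (2 * ((2 * l)%:Z - ((2 * k).-1)%:Z + e))%R = S 0.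
  case: e1 => ->; [rewrite S01|]; apply: eq_bigr => l _; congr (_ * phi _); lia.
have -> : 2 * S 0 = S 0 + S 1 by rewrite -S01 addnn mul2n.
have := sum_bin_recr (2 * k).-1 (fun l => phi (4 * (l%:Z - k%:Z))%R).
have e2k : (2 * k).-1.+1 = 2 * k by lia.
rewrite -[_.-1.+2]/(_.-1.+1.+1) e2k => ->.
by rewrite /S e2k; congr (_ + _); apply: eq_bigr => l _; rewrite ?addn0 ?addn1.
Qed.
End OneDimensional.

(** Here [m] is odd, so the leading coefficient shifts the walk inside [x], with the sign
    [e ^+ (2 * k) = 1]. *)
Lemma card_twisted_set_8k_sq (c : bool) k (e := sgnb c) : (0 < k)%N ->
  (#|twisted_set e (4 * k)| = \sum_(t < (2 * k).+1) \sum_(l < (2 * k).+1)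
     'C(2 * k, k + uphalf t) * 'C(2 * k, l) *
     is_sq ((2 * t%:Z + 1) ^+ 2 - e * (4 * (l%:Z - k%:Z)) ^+ 2)%R)%N.
Proof.
move=> k0; have -> : (4 * k = ((2 * k).-1 + (2 * k)).+1)%N by lia.
rewrite card_twisted_set_walk; set m := (_ + _)%N.
have om : odd m by lia.
have -> : m./2 = (2 * k).-1 by lia.
have -> : uphalf m = (2 * k)%N by lia.
rewrite om exprM sgnb2 expr1n.
pose phi (x : int) : nat := (\sum_(l < (2 * k).+1) 'C(2 * k, l) * is_sq (x ^+ 2 - e * (4 * (l%:Z - k%:Z)) ^+ 2)%R)%N.
have phiN x : phi (- x) = phi x.
  by apply: eq_bigr => l _; rewrite sqrrN.
have := sum_middle_hi phiN k0.
have dist (C : nat) (x : int) : (C * phi x = \sum_(l < (2 * k).+1) C * 'C(2 * k, l) * is_sq (x ^+ 2 - e * (4 * (l%:Z - k%:Z)) ^+ 2)%R)%N.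
  by rewrite /phi big_distrr; apply: eq_bigr => l _; rewrite /= mulnA.
under eq_bigr => b _ do under eq_bigr => i _ do rewrite dist.
under [RHS]eq_bigr => t _ do rewrite dist.
move=> <-; apply: eq_bigr => b _; apply: eq_bigr => i _; apply: eq_bigr => l _.
by congr (_ * nat_of_bool (is_sq (_ - _ * _ ^+ 2)))%N; lia.
Qed.

(** Here [m] is even, so the leading coefficient shifts the walk inside [y], with a sign that may be
    negative. The factor 2 gained by folding [x] is the one that [sum_pairs] consumes. *)
Lemma card_twisted_set_8k2_sq (c : bool) k (e := sgnb c) : (0 < k)%N ->
  (#|twisted_set e (4 * k).-1| = \sum_(t < (2 * k).+1) \sum_(l < (2 * k).+1)
     'C((2 * k).-1, k + t./2) * 'C(2 * k, l) *
     is_sq ((2 * t%:Z + 1) ^+ 2 - e * (4 * (l%:Z - k%:Z)) ^+ 2)%R)%N.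
Proof.
move=> k0; have -> : ((4 * k).-1 = ((2 * k).-1 + (2 * k).-1).+1)%N by lia.
rewrite card_twisted_set_walk; set m := (_ + _)%N.
have om : odd m = false by lia.
have -> : m./2 = (2 * k).-1 by lia.
have -> : uphalf m = (2 * k).-1 by lia.
rewrite om.
have e1 : (sgnb c ^+ (2 * k).-1 = 1 \/ sgnb c ^+ (2 * k).-1 = -1).
  by rewrite sgnbX; case: (_ || _); [left|right].
set e' := sgnb c ^+ _ in e1 *.
pose phi (x : int) : nat := (\sum_(l < (2 * k).-1.+1) 'C((2 * k).-1, l) *
   is_sq (x ^+ 2 - e * (2 * ((2 * l)%:Z - ((2 * k).-1)%:Z + e')) ^+ 2)%R)%N.
have phiN x : phi (- x) = phi x.
  by apply: eq_bigr => l _; rewrite sqrrN.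
have := sum_middle_lo phiN k0.
have dist (C : nat) (x : int) : (C * phi x = \sum_(l < (2 * k).-1.+1) C * 'C((2 * k).-1, l) *
   is_sq (x ^+ 2 - e * (2 * ((2 * l)%:Z - ((2 * k).-1)%:Z + e')) ^+ 2)%R)%N.
  by rewrite /phi big_distrr; apply: eq_bigr => l _; rewrite /= mulnA.
under eq_bigr => b _ do under eq_bigr => i _ do rewrite dist.
move=> E; transitivity (2 * \sum_(t < (2 * k).+1) 'C((2 * k).-1, k + t./2) * phi (2 * t%:Z + 1)%R)%N.
  rewrite -E; apply: eq_bigr => b _; apply: eq_bigr => i _; apply: eq_bigr => l _.
  by congr (_ * nat_of_bool (is_sq (_ - _ * _ ^+ 2)))%N; rewrite addr0.
rewrite big_distrr /=; apply: eq_bigr => t _; rewrite mulnCA.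
have psiN y : (fun y => is_sq ((2 * t%:Z + 1) ^+ 2 - e * y ^+ 2) : nat) (- y) =
   (fun y => is_sq ((2 * t%:Z + 1) ^+ 2 - e * y ^+ 2) : nat) y by rewrite /= sqrrN.
rewrite (sum_pairs psiN k0 e1) big_distrr /=.
by apply: eq_bigr => l _; rewrite mulnA.
Qed.

End Counting.

(** * Pythagorean triples *)

Module Parametrization.

Import all_boot all_order all_algebra all_field boolp ring zify.
Import Order.TTheory GRing.Theory Num.Theory.
Import Counting.
Local Open Scope nat_scope.
Set Implicit Arguments.
Unset Strict Implicit.
Unset Printing Implicit Defensive.

Definition sqfree (d : nat) : bool :=
  (0 < d) && [forall s : 'I_d.+1, (s ^ 2 %| d) ==> (s == 1 :> nat)].

Lemma sqfreeP d : reflect (0 < d /\ forall s, s ^ 2 %| d -> s = 1) (sqfree d).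
Proof.
apply: (iffP andP) => -[d0]; last first.
  by move=> h; split=> //; apply/forallP => s; apply/implyP => /h ->.
move/forallP => h; split=> // s sd; have lt : s < d.+1.
  rewrite ltnS (leq_trans _ (dvdn_leq d0 sd)) //; case: (posnP s) => [->//|s0].
  by rewrite -{1}[s]expn1 leq_pexp2l.
by have := h (Ordinal lt); rewrite sd /= => /eqP.
Qed.

Lemma sqfree_decomp n : 0 < n -> exists d s, [/\ sqfree d, 0 < s & n = d * s ^ 2].
Proof.
elim/ltn_ind: n => n IH n0; have [sf|] := boolP (sqfree n).
  by exists n, 1; rewrite sf muln1.
rewrite /sqfree n0 /= negb_forall => /existsP [[s /= _]]; rewrite negb_imply => /andP [sn s1].
have [m mE] := dvdnP sn; have m0 : 0 < m by move: n0; rewrite mE; case: m {mE}.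
have s0 : 0 < s by move: n0; rewrite mE; case: {+}s => //; rewrite muln0.
have s2 : 1 < s by lia.
have [||d [r [sfd r0 rE]]] := IH m => //.
  by rewrite mE -{1}[m]muln1 ltn_pmul2l // (leq_trans s2) // -{1}(expn1 s) leq_pexp2l.
by exists d, (r * s); split=> //; rewrite ?muln_gt0 ?r0 // mE rE expnMn mulnA.
Qed.

(** After division of [s] and [s'] by their gcd, the coprime squares [t ^ 2] and [t' ^ 2] divide
    [d'] and [d] respectively, hence are 1. *)
Lemma sqfree_uniq d d' s s' : sqfree d -> sqfree d' -> 0 < s ->
  d * s ^ 2 = d' * s' ^ 2 -> d = d' /\ s = s'.
Proof.
move=> /sqfreeP [d0 dP] /sqfreeP [d0' dP'] s0 E.
have g0 : 0 < gcdn s s' by rewrite gcdn_gt0 s0.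
have [t tE] := dvdnP (dvdn_gcdl s s'); have [t' tE'] := dvdnP (dvdn_gcdr s s').
set g := gcdn s s' in g0 tE tE'.
have co : coprime t t'.
  have : gcdn (t * g) (t' * g) = g by rewrite -tE -tE'.
  by rewrite -muln_gcdl -{2}[g]mul1n => /eqP; rewrite eqn_pmul2r.
have E' : d * t ^ 2 = d' * t' ^ 2.
  apply/eqP; have g20 : 0 < g ^ 2 by rewrite expn_gt0 g0.
  rewrite -(eqn_pmul2r g20); have e a b : a * b ^ 2 * g ^ 2 = a * (b * g) ^ 2 by ring.
  by rewrite !e -tE -tE' E.
have t1 : t = 1.
  by apply: dP'; rewrite -(Gauss_dvdl _ (coprimeXl 2 (coprimeXr 2 co))) -E' dvdn_mull.
have t1' : t' = 1.
  have co' : coprime t' t by rewrite coprime_sym.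
  by apply: dP; rewrite -(Gauss_dvdl _ (coprimeXl 2 (coprimeXr 2 co'))) E' dvdn_mull.
split; last by rewrite tE tE' t1 t1'.
by move: E'; rewrite t1 t1' !muln1.
Qed.

Lemma sqr_gcdn a b : gcdn a b ^ 2 = gcdn (a ^ 2) (b ^ 2).
Proof.
have [->|b0] := posnP b; first by rewrite exp0n // !gcdn0.
have g0 : 0 < gcdn a b by rewrite gcdn_gt0 b0 orbT.
have [t tE] := dvdnP (dvdn_gcdl a b); have [t' tE'] := dvdnP (dvdn_gcdr a b).
set g := gcdn a b in g0 tE tE' *.
have co : coprime t t'.
  have : gcdn (t * g) (t' * g) = g by rewrite -tE -tE'.
  by rewrite -muln_gcdl -{2}[g]mul1n => /eqP; rewrite eqn_pmul2r.
by rewrite tE tE' !expnMn -muln_gcdl (eqP (coprimeXl 2 (coprimeXr 2 co))) mul1n.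
Qed.

Lemma coprime_mul_sqr a b c : coprime a b -> a * b = c ^ 2 -> exists r, a = r ^ 2.
Proof.
move=> co abc; exists (gcdn a c); rewrite sqr_gcdn -abc -mulnn -muln_gcdr.
by rewrite (eqP co) muln1.
Qed.

(** Divided by their gcd [g], the numbers [P] and [Q] become coprime with a square product, hence
    squares. The common [d] is the squarefree part of [g]. *)
Lemma sqr_mul_common P Q c : 0 < P -> 0 < Q -> P * Q = c ^ 2 ->
  exists d u v, [/\ sqfree d, 0 < u, 0 < v, P = d * u ^ 2 & Q = d * v ^ 2].
Proof.
move=> P0 Q0 PQ; have g0 : 0 < gcdn P Q by rewrite gcdn_gt0 P0.
have [a aE] := dvdnP (dvdn_gcdl P Q); have [b bE] := dvdnP (dvdn_gcdr P Q).
set g := gcdn P Q in g0 aE bE.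
have co : coprime a b.
  have : gcdn (a * g) (b * g) = g by rewrite -aE -bE.
  by rewrite -muln_gcdl -{2}[g]mul1n => /eqP; rewrite eqn_pmul2r.
have /dvdnP [r rE] : g %| c.
  by rewrite -(@dvdn_pexp2r _ _ 2) // -PQ aE bE mulnACA -mulnn dvdn_mull.
have ab : a * b = r ^ 2.
  have g20 : 0 < g ^ 2 by rewrite expn_gt0 g0.
  apply/eqP; rewrite -(eqn_pmul2r g20); have -> : r ^ 2 * g ^ 2 = (r * g) ^ 2 by ring.
  by rewrite -rE -PQ aE bE mulnACA mulnn.
have [u uE] := coprime_mul_sqr co ab.
have [v vE] : exists r, b = r ^ 2 by apply: (@coprime_mul_sqr b a r); rewrite 1?coprime_sym // mulnC.
have [d [s [sfd s0 gE]]] := sqfree_decomp g0.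
exists d, (s * u), (s * v); split=> //.
- by rewrite muln_gt0 s0; case: u uE P0 aE => // -> ; rewrite mul0n => /[swap] ->.
- by rewrite muln_gt0 s0; case: v vE Q0 bE => // -> ; rewrite mul0n => /[swap] ->.
- by rewrite aE gE uE; ring.
- by rewrite bE gE vE; ring.
Qed.

(* The solutions of [x ^ 2 - y ^ 2 = z ^ 2] ([c = true]) and [x ^ 2 + y ^ 2 = z ^ 2] ([c = false])
   with [x] odd and [4 | y] have [x = leg c d u v] and [2 * y = d * u ^ 2 - d * v ^ 2]. *)
Definition leg (c : bool) (d u v : nat) : nat :=
  if c then (d * u ^ 2 + d * v ^ 2)./2 else d * u * v.

Definition parametrizes (c : bool) (x : nat) (w : int) (d u v : nat) : bool :=
  (leg c d u v == x) && ((d * u ^ 2)%:Z - (d * v ^ 2)%:Z == 8 * w)%R.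

(** Both equations factor as a difference of squares whose factors differ by [8 w]:
    [(x + 4 w) (x - 4 w) = z^2] for [c = true], and [(z + 4 w) (z - 4 w) = x^2] for [c = false]. *)
Lemma two_squares_factor (c : bool) (x : nat) (w : int) : odd x ->
  is_sq (x%:Z ^+ 2 - sgnb c * (4 * w) ^+ 2)%R ->
  exists P Q r : nat, [/\ odd P, odd Q, P * Q = r ^ 2,
    (P%:Z - Q%:Z = 8 * w)%R & if c then P + Q = 2 * x else r = x].
Proof.
move=> ox /asboolP [z zE]; set za := `|z|%N.
have zz : (z ^+ 2 = za%:Z ^+ 2)%R by rewrite /za abszE real_normK ?num_real.
rewrite zz in zE; clearbody za; clear z zz. move: zE; case: c => /= zE.
  have PQ : ((x%:Z + 4 * w) * (x%:Z - 4 * w) = za%:Z ^+ 2)%R by rewrite -zE; ring.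
  have [p0 q0] : (0 < x%:Z + 4 * w /\ 0 < x%:Z - 4 * w)%R by nia.
  have [P PE] : exists P : nat, (P%:Z = x%:Z + 4 * w)%R by exists `|(x%:Z + 4 * w)%R|%N; lia.
  have [Q QE] : exists Q : nat, (Q%:Z = x%:Z - 4 * w)%R by exists `|(x%:Z - 4 * w)%R|%N; lia.
  have {}PQ : (P%:Z * Q%:Z = za%:Z ^+ 2)%R by rewrite PE QE.
  have PQn : P * Q = za ^ 2 by lia.
  by exists P, Q, za; split=> //; lia.
have PQ : ((za%:Z + 4 * w) * (za%:Z - 4 * w) = x%:Z ^+ 2)%R.
  have -> : (x%:Z ^+ 2 = za%:Z ^+ 2 - (4 * w) ^+ 2)%R by rewrite -zE; ring.
  by ring.
have [p0 q0] : (0 < za%:Z + 4 * w /\ 0 < za%:Z - 4 * w)%R by nia.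
have [P PE] : exists P : nat, (P%:Z = za%:Z + 4 * w)%R by exists `|(za%:Z + 4 * w)%R|%N; lia.
have [Q QE] : exists Q : nat, (Q%:Z = za%:Z - 4 * w)%R by exists `|(za%:Z - 4 * w)%R|%N; lia.
have {}PQ : (P%:Z * Q%:Z = x%:Z ^+ 2)%R by rewrite PE QE.
have PQn : P * Q = x ^ 2 by lia.
have oPQ : odd (P * Q) by rewrite PQn oddX ox orbT.
move: oPQ; rewrite oddM => /andP [oP oQ].
by exists P, Q, x; split=> //; lia.
Qed.

Lemma odd_leg_true d u v : odd d -> odd u -> odd v ->
  2 * leg true d u v = d * u ^ 2 + d * v ^ 2.
Proof.
move=> od ou ov; rewrite /leg mul2n; apply: even_halfK.
by rewrite oddD !oddM od ou ov.
Qed.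

(** The crude bounds on [d], [u], [v] serve to replace the search for parameters by a finite sum
    with a cutoff linear in [k]. *)
Lemma parametrizes_exists (c : bool) (x : nat) (w : int) : odd x ->
  is_sq (x%:Z ^+ 2 - sgnb c * (4 * w) ^+ 2)%R ->
  exists d u v, [/\ sqfree d && odd d, odd u, odd v, parametrizes c x w d u v &
    [/\ d <= x + 8 * `|w|, u <= x + 8 * `|w| & v <= x + 8 * `|w|]].
Proof.
move=> ox /(two_squares_factor ox) [P [Q [r [oP oQ PQ PmQ PpQ]]]].
have P0 : 0 < P by case: P oP {PQ PmQ PpQ}.
have Q0 : 0 < Q by case: Q oQ {PQ PmQ PpQ}.
have [d [u [v [sfd u0 v0 PE QE]]]] := sqr_mul_common P0 Q0 PQ.
have /andP [od ou] : odd d && odd u by move: oP; rewrite PE oddM oddX.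
have /andP [_ ov] : odd d && odd v by move: oQ; rewrite QE oddM oddX.
have d0 : 0 < d by case: (d) od.
(* When the product is [x ^ 2], a [P] above this bound would put [Q = P - 8 w] above [x] as well. *)
have bP : P <= x + 8 * `|w|.
  case: c PpQ => [PpQ|rx]; first by lia.
  rewrite leqNgt; apply/negP => lt; have : x * x < P * Q by apply: ltn_mul; lia.
  by rewrite PQ rx mulnn ltnn.
have bQ : Q <= x + 8 * `|w|.
  case: c PpQ => [PpQ|rx]; first by lia.
  rewrite leqNgt; apply/negP => lt; have : x * x < P * Q by apply: ltn_mul; lia.
  by rewrite PQ rx mulnn ltnn.
have le_d n k : 0 < k -> n <= n * k ^ 2 by move=> k0; rewrite leq_pmulr // expn_gt0 k0.
have le_u n k : 0 < n -> 0 < k -> k <= n * k ^ 2.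
  by move=> n0 k0; rewrite -mulnn mulnA leq_pmull // muln_gt0 n0.
exists d, u, v; split=> //; first by rewrite sfd.
  rewrite /parametrizes -PE -QE PmQ eqxx andbT; case: c PpQ => [PpQ|rx].
    have := odd_leg_true od ou ov; rewrite -PE -QE PpQ => /eqP.
    by rewrite eqn_pmul2l.
  rewrite /= -rx -(@eqn_exp2r _ _ 2) // -PQ PE QE; apply/eqP; ring.
by split; [apply: leq_trans bP | apply: leq_trans bP | apply: leq_trans bQ]; rewrite ?PE ?QE ?le_d ?le_u.
Qed.

(** The two forms of [leg] exchange roles: when one of [(d u^2 + d v^2) / 2] and [d u v] is [x], the
    other is the root. *)
Lemma parametrizes_sq (c : bool) (x : nat) (w : int) d u v :
  odd d -> odd u -> odd v -> parametrizes c x w d u v ->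
  is_sq (x%:Z ^+ 2 - sgnb c * (4 * w) ^+ 2)%R.
Proof.
move=> od ou ov /andP [/eqP xE /eqP dE]; apply/asboolP.
case: c xE => xE.
  have := odd_leg_true od ou ov; rewrite xE => E.
  exists (Posz (d * u * v)).
  have -> : (x%:Z ^+ 2 - sgnb true * (4 * w) ^+ 2 = (x%:Z + 4 * w) * (x%:Z - 4 * w))%R.
    by rewrite /=; ring.
  have -> : (x%:Z + 4 * w = (d * u ^ 2)%:Z)%R by lia.
  have -> : (x%:Z - 4 * w = (d * v ^ 2)%:Z)%R by lia.
  by rewrite !PoszM; ring.
have := odd_leg_true od ou ov; set s := leg true d u v => E.
exists (Posz s).
have -> : (4 * w = s%:Z - (d * v ^ 2)%:Z)%R by lia.
have -> : (s%:Z = (x%:Z ^+ 2 - x%:Z ^+ 2) + s%:Z)%R by ring.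
rewrite -xE /=; have E' : (2 * s%:Z = (d * u ^ 2)%:Z + (d * v ^ 2)%:Z)%R by lia.
have Eu : ((d * u ^ 2)%:Z = 2 * s%:Z - (d * v ^ 2)%:Z)%R by lia.
have Ep : ((d * u * v)%:Z ^+ 2 = (d * u ^ 2)%:Z * (d * v ^ 2)%:Z)%R by rewrite !PoszM; ring.
by rewrite subrr add0r Ep Eu; ring.
Qed.

(** By uniqueness of the squarefree part it is enough to recover [d u^2] and [d v^2]. Their
    difference is [8 w], and [x] fixes their sum or their product; in the latter case the product is
    strictly increasing along pairs of given difference. *)
Lemma parametrizes_inj (c : bool) (x : nat) (w : int) d u v d' u' v' :
  sqfree d && odd d -> odd u -> odd v -> sqfree d' && odd d' -> odd u' -> odd v' ->
  parametrizes c x w d u v -> parametrizes c x w d' u' v' ->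
  [/\ d = d', u = u' & v = v'].
Proof.
move=> /andP [sd od] ou ov /andP [sd' od'] ou' ov' /andP [/eqP xE /eqP dE] /andP [/eqP xE' /eqP dE'].
have u0 : 0 < u by case: (u) ou.
have v0 : 0 < v by case: (v) ov.
have s1 := odd_leg_true od ou ov; have s1' := odd_leg_true od' ou' ov'.
suff PE : d * u ^ 2 = d' * u' ^ 2.
  have [dd uu] := sqfree_uniq sd sd' u0 PE; split=> //.
  have QE : d * v ^ 2 = d' * v' ^ 2 by lia.
  by case: (sqfree_uniq sd sd' v0 QE).
case: c xE xE' => xE xE'; first by rewrite xE in s1; rewrite xE' in s1'; lia.
have p : (d * u ^ 2) * (d * v ^ 2) = x ^ 2 by rewrite -xE /=; ring.
have p' : (d' * u' ^ 2) * (d' * v' ^ 2) = x ^ 2 by rewrite -xE' /=; ring.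
have : 0 < d' * u' ^ 2 by rewrite muln_gt0 expn_gt0; case: (d') (u') od' ou' => [|?] [|?].
have : 0 < d * v ^ 2 by rewrite muln_gt0 expn_gt0 v0; case: (d) od.
move: p p' dE dE'; move: (d * u ^ 2) (d * v ^ 2) (d' * u' ^ 2) (d' * v' ^ 2) => P Q P' Q' p p' dE dE' Q0 P0'.
have [lt|lt|//] := ltngtP P P'.
  by have : P * Q < P' * Q' by [apply: ltn_mul; lia]; rewrite p p' ltnn.
by have : P' * Q' < P * Q by [apply: ltn_mul; lia]; rewrite p p' ltnn.
Qed.

(** This is the absolute value of [w]; the division is exact, odd squares being 1 modulo 8. *)
Definition offset (d u v : nat) : nat := `|(Posz (d * u ^ 2) - Posz (d * v ^ 2))%R| %/ 8.

Lemma odd_sqr_mod8 u : odd u -> exists a, u ^ 2 = 8 * a + 1.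
Proof.
move=> ou; have -> : u = (u./2).*2.+1 by have := odd_double_half u; rewrite ou.
move: (u./2) => h; have [a aE] : exists a, h * h.+1 = 2 * a.
  by exists (h * h.+1)./2; rewrite mul2n even_halfK // oddM /= andbN.
by exists a; lia.
Qed.

Lemma odd_leg c d u v : odd d -> odd u -> odd v -> odd (leg c d u v).
Proof.
move=> od ou ov; case: c; last by rewrite /leg !oddM od ou ov.
have := odd_leg_true od ou ov.
have [a ->] := odd_sqr_mod8 ou; have [b ->] := odd_sqr_mod8 ov => E.
have -> : leg true d u v = d * (4 * (a + b) + 1) by lia.
by rewrite oddM od oddD oddM.
Qed.

Lemma offset_dvd d u v : odd u -> odd v -> exists w : int,
  (Posz (d * u ^ 2) - Posz (d * v ^ 2) = 8 * w)%R /\ offset d u v = `|w|.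
Proof.
move=> ou ov; have [a aE] := odd_sqr_mod8 ou; have [b bE] := odd_sqr_mod8 ov.
exists (d%:Z * (a%:Z - b%:Z))%R; rewrite /offset aE bE.
have -> : (Posz (d * (8 * a + 1)) - Posz (d * (8 * b + 1)) = 8 * (d%:Z * (a%:Z - b%:Z)))%R by rewrite !PoszM !PoszD; ring.
by split=> //; rewrite abszM mulKn.
Qed.

(** Existence and uniqueness of the parameters turn the indicator of a square into a sum over
    triples with at most one nonzero term, which allows the order of summation to be exchanged. *)
Lemma is_sq_sum_parametrizes (c : bool) k (t l : 'I_(2 * k).+1) (L := 20 * k + 20) :
  is_sq ((2 * t%:Z + 1) ^+ 2 - sgnb c * (4 * (l%:Z - k%:Z)) ^+ 2)%R =
  \sum_(p : 'I_L * ('I_L * 'I_L) | sqfree p.1 && odd p.1)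
    parametrizes c (2 * t + 1) (l%:Z - k%:Z)%R p.1 (2 * p.2.1 + 1) (2 * p.2.2 + 1) :> nat.
Proof.
have tE : (2 * t%:Z + 1 = (2 * t + 1)%N%:Z)%R by lia.
have odd2 i : odd (2 * i + 1) by lia.
rewrite tE; case: (boolP (is_sq _)) => [sq|nsq]; last first.
  rewrite big1 // => -[d [i j]] /= /andP [sd od]; case: (boolP (parametrizes _ _ _ _ _ _)) => // pa.
  by case/negP: nsq; apply: parametrizes_sq pa.
have [d [u [v [sd ou ov pa [bd bu bv]]]]] := parametrizes_exists (odd2 t) sq.
(* [t] is at most [2 k] and the difference [l - k] at most [k] in absolute value, so the left side
   is at most [12 k + 1]. *)
have bnd : 2 * t + 1 + 8 * `|(l%:Z - k%:Z)%R| < L by rewrite /L; have := ltn_ord t; have := ltn_ord l; lia.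
have uE : 2 * u./2 + 1 = u by have := odd_double_half u; rewrite ou; lia.
have vE : 2 * v./2 + 1 = v by have := odd_double_half v; rewrite ov; lia.
have ld : d < L by apply: leq_ltn_trans bnd.
have lu : u./2 < L by apply: leq_ltn_trans bnd; lia.
have lv : v./2 < L by apply: leq_ltn_trans bnd; lia.
rewrite (bigD1 (Ordinal ld, (Ordinal lu, Ordinal lv))) //= uE vE pa big1 ?addn0 //.
move=> [d' [i j]] /= /andP [sd' ne]; case: (boolP (parametrizes _ _ _ _ _ _)) => // pa'.
have [dd uu vv] := parametrizes_inj sd ou ov sd' (odd2 i) (odd2 j) pa pa'.
case/negP: ne; rewrite !xpair_eqE -!val_eqE /= dd uu vv eqxx /=.
by apply/andP; split; apply/eqP; lia.
Qed.

(** A triple [(d, u, v)] determines [t] and [l]. If either falls out of range, the right side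
    vanishes too, by [W0] or by a binomial coefficient equal to zero. The sign of [w], lost in
    [offset], is restored by the symmetry of ['C(2 * k, l)]. *)
Lemma sum_is_sq (c : bool) k (W : nat -> nat) (L := 20 * k + 20) :
  (forall t, 2 * k < t -> W t = 0) ->
  \sum_(t < (2 * k).+1) \sum_(l < (2 * k).+1) W t * 'C(2 * k, l) *
     is_sq ((2 * t%:Z + 1) ^+ 2 - sgnb c * (4 * (l%:Z - k%:Z)) ^+ 2)%R =
  \sum_(d < L | sqfree d && odd d) \sum_(i < L) \sum_(j < L)
    W (leg c d (2 * i + 1) (2 * j + 1))./2 * 'C(2 * k, k + offset d (2 * i + 1) (2 * j + 1)).
Proof.
move=> W0.
under eq_bigr => t _ do under eq_bigr => l _ do rewrite is_sq_sum_parametrizes big_distrr /=.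
rewrite pair_big /= exchange_big /=.
under [RHS]eq_bigr => d _ do rewrite pair_big /=.
rewrite [RHS]pair_big /=; apply: eq_big => [p|[d [i j]] /= /andP [sd od]]; first by rewrite andbT.
rewrite -(pair_big xpredT xpredT (fun (t l : 'I_(2 * k).+1) => W t * 'C(2 * k, l) *
  parametrizes c (2 * t + 1) (l%:Z - k%:Z)%R d (2 * i + 1) (2 * j + 1))) /=.
have odd2 n : odd (2 * n + 1) by lia.
have ol := odd_leg c od (odd2 i) (odd2 j).
have [w [wE ->]] := offset_dvd d (odd2 i) (odd2 j).
set x := leg _ _ _ _ in ol *.
have pE (t l : nat) : parametrizes c (2 * t + 1) (l%:Z - k%:Z)%R d (2 * i + 1) (2 * j + 1) =
   (t == x./2) && (l%:Z - k%:Z == w)%R.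
  rewrite /parametrizes -/x wE; have := odd_double_half x; rewrite ol; lia.
have [le|gt] := leqP x./2 (2 * k); last first.
  rewrite W0 // mul0n big1 // => t _; rewrite big1 // => l _; rewrite pE.
  by rewrite ltn_eqF ?muln0 // (leq_trans (ltn_ord t)).
rewrite (bigD1 (Ordinal (le : x./2 < (2 * k).+1))) //= [X in _ + X]big1 ?addn0; last first.
  by move=> t; rewrite -val_eqE /= => /negPf ne; rewrite big1 // => l _; rewrite pE ne muln0.
have [lew|gtw] := leqP `|w| k; last first.
  rewrite bin_small ?muln0; last by lia.
  rewrite big1 // => l _; rewrite pE (_ : _ == w = false) ?andbF ?muln0 //.
  by have := ltn_ord l; lia.
have [l0 l0E] : exists l0 : nat, Posz l0 = (k%:Z + w)%R by exists `|(k%:Z + w)%R|; lia.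
have ll0 : l0 < (2 * k).+1 by lia.
rewrite (bigD1 (Ordinal ll0)) //= [X in _ + X]big1 ?addn0; last first.
  move=> l; rewrite -val_eqE /= => /eqP ne; rewrite pE (_ : _ == w = false) ?andbF ?muln0 //.
  by apply/eqP => E; apply: ne; lia.
rewrite pE eqxx (_ : _ == w) ?muln1; last by lia.
congr (_ * _); have [w0|w0] := lerP 0%R w; first by congr 'C(_, _); lia.
by rewrite -bin_sub; [congr 'C(_, _); lia | lia].
Qed.

Theorem card_twisted_set_8k (c : bool) k (L := 20 * k + 20) : 0 < k ->
  #|twisted_set (sgnb c) (4 * k)| =
  \sum_(d < L | sqfree d && odd d) \sum_(i < L) \sum_(j < L)
    'C(2 * k, k + uphalf (leg c d (2 * i + 1) (2 * j + 1))./2) *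
    'C(2 * k, k + offset d (2 * i + 1) (2 * j + 1)).
Proof.
move=> k0; rewrite card_twisted_set_8k_sq //.
rewrite (sum_is_sq c (W := fun t => 'C(2 * k, k + uphalf t))) // => t lt.
by rewrite bin_small //; lia.
Qed.

Theorem card_twisted_set_8k2 (c : bool) k (L := 20 * k + 20) : 0 < k ->
  #|twisted_set (sgnb c) (4 * k).-1| =
  \sum_(d < L | sqfree d && odd d) \sum_(i < L) \sum_(j < L)
    'C((2 * k).-1, k + (leg c d (2 * i + 1) (2 * j + 1))./2./2) *
    'C(2 * k, k + offset d (2 * i + 1) (2 * j + 1)).
Proof.
move=> k0; rewrite card_twisted_set_8k2_sq //.
rewrite (sum_is_sq c (W := fun t => 'C((2 * k).-1, k + t./2))) // => t lt.
by rewrite bin_small //; lia.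
Qed.

End Parametrization.

(** * Asymptotics *)

Module Asymptotics.

Import all_boot zify.
Import Lra Psatz.
Import Counting Parametrization.
Local Open Scope R_scope.
Set Implicit Arguments.
Unset Strict Implicit.
Unset Printing Implicit Defensive.

(** ** Lattice means *)

HB.instance Definition _ := Monoid.isComLaw.Build R 0 Rplus
  (fun x y z => esym (Rplus_assoc x y z)) Rplus_comm Rplus_0_l.

Notation "\rsum_ ( i < n ) F" := (\big[Rplus/0]_(i < n) F)
  (at level 41, F at level 41, i, n at level 50).
Notation "\rsum_ ( i < n | P ) F" := (\big[Rplus/0]_(i < n | P) F)
  (at level 41, F at level 41, i, n at level 50).

Section Sums.
Variables (I : Type) (r : seq I) (P : pred I).
Implicit Types F G : I -> R.

Lemma rsum_le F G : (forall i, P i -> F i <= G i) ->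
  \big[Rplus/0]_(i <- r | P i) F i <= \big[Rplus/0]_(i <- r | P i) G i.
Proof. by move=> h; apply: (big_ind2 Rle) => [|*|//]; lra. Qed.

Lemma rsum_ge0 F : (forall i, P i -> 0 <= F i) -> 0 <= \big[Rplus/0]_(i <- r | P i) F i.
Proof. by move=> h; apply: (big_ind (fun x => 0 <= x)) => [|*|//]; lra. Qed.

Lemma rsum_scal c F : c * \big[Rplus/0]_(i <- r | P i) F i = \big[Rplus/0]_(i <- r | P i) (c * F i).
Proof. by apply: (big_morph (Rmult c)) => [x y|]; ring. Qed.

Lemma rsum_sub F G : \big[Rplus/0]_(i <- r | P i) F i - \big[Rplus/0]_(i <- r | P i) G i =
  \big[Rplus/0]_(i <- r | P i) (F i - G i).
Proof.
have -> : \big[Rplus/0]_(i <- r | P i) (F i - G i) = \big[Rplus/0]_(i <- r | P i) (F i + -1 * G i).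
  by apply: eq_bigr => i _; ring.
by rewrite big_split /= -rsum_scal; ring.
Qed.

Lemma rsum_abs F : Rabs (\big[Rplus/0]_(i <- r | P i) F i) <= \big[Rplus/0]_(i <- r | P i) Rabs (F i).
Proof.
apply: (big_ind2 (fun x y => Rabs x <= y)) => [|x1 y1 x2 y2|i _]; try lra.
  by rewrite Rabs_R0; lra.
by have := Rabs_triang x1 x2; lra.
Qed.

Lemma rsum_INR (F : I -> nat) :
  INR (\sum_(i <- r | P i) F i)%N = \big[Rplus/0]_(i <- r | P i) INR (F i).
Proof. by apply: (big_morph INR) => [x y|//]; exact: plus_INR. Qed.
End Sums.

Lemma rsumS n (F : nat -> R) : \rsum_(i < n.+1) F i = (\rsum_(i < n) F i) + F n.
Proof. by rewrite big_ord_recr. Qed.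

Lemma rsum_const n c : \rsum_(i < n) c = INR n * c.
Proof.
elim: n => [|n IH]; first by rewrite big_ord0 /=; ring.
by rewrite big_ord_recr IH S_INR /=; ring.
Qed.

Lemma rsum_filter_le n (P : pred nat) F : (forall i, 0 <= F i) ->
  \rsum_(i < n | P i) F i <= \rsum_(i < n) F i.
Proof. by move=> h; rewrite big_mkcond; apply: rsum_le => i _; case: (P i) => //; lra. Qed.

Lemma rsum_telescope n (F : nat -> R) : \rsum_(i < n) (F i.+1 - F i) = F n - F 0%N.
Proof.
elim: n => [|n IH]; first by rewrite big_ord0; ring.
by rewrite big_ord_recr IH /=; ring.
Qed.

Definition od (i : nat) : R := 2 * INR i + 1.

Lemma od_ge1 i : 1 <= od i. Proof. by rewrite /od; have := pos_INR i; lra. Qed.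

Section MonotoneSum.
Variable f : R -> R.
Hypothesis f_cont : forall x, continuous f x.
Hypothesis f_decr : forall x y, 0 <= x <= y -> f y <= f x.

Lemma ex_RInt_cont a b : ex_RInt f a b.
Proof. by apply: ex_RInt_continuous => x _; apply: f_cont. Qed.

Lemma RInt_split a b c : RInt f a c = RInt f a b + RInt f b c.
Proof. by rewrite -(RInt_Chasles f a b c) //; apply: ex_RInt_cont. Qed.

Lemma RInt_decr_bounds a b : 0 <= a <= b ->
  (b - a) * f b <= RInt f a b <= (b - a) * f a.
Proof.
move=> [a0 ab]; have ei := ex_RInt_cont a b; split.
  have <- : RInt (fun=> f b) a b = (b - a) * f b by rewrite RInt_const.
  apply: RInt_le => // [|x [ax xb]]; first exact: ex_RInt_const.
  by apply: f_decr; lra.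
have <- : RInt (fun=> f a) a b = (b - a) * f a by rewrite RInt_const.
apply: RInt_le => // [|x [ax xb]]; first exact: ex_RInt_const.
by apply: f_decr; lra.
Qed.

(** On each interval the error is at most the length times the drop of [f], and the drops telescope.
    Free sample points allow both midpoints, as in [h * od i] with [t = 2 h], and left ends. *)
Lemma sum_sample_RInt (t : R) (xi : nat -> R) n : 0 < t ->
  (forall i, t * INR i <= xi i <= t * INR i.+1) ->
  Rabs (t * (\rsum_(i < n) f (xi i)) - RInt f 0 (t * INR n)) <= t * (f 0 - f (t * INR n)).
Proof.
move=> t0 hx; elim: n => [|n IH].
  rewrite big_ord0 /= !Rmult_0_r RInt_point /zero /=; split_Rabs; lra.
rewrite (rsumS n (fun i => f (xi i))) (RInt_split 0 (t * INR n)).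
have n0 : 0 <= t * INR n by apply: Rmult_le_pos; [lra | exact: pos_INR].
have [x1 x2] := hx n.
have [b1 b2] : (t * INR n.+1 - t * INR n) * f (t * INR n.+1) <= RInt f (t * INR n) (t * INR n.+1) <=
   (t * INR n.+1 - t * INR n) * f (t * INR n) by apply: RInt_decr_bounds; lra.
have e : t * INR n.+1 - t * INR n = t by rewrite S_INR; ring.
rewrite e in b1 b2.
have f1 : f (xi n) <= f (t * INR n) by apply: f_decr; lra.
have f2 : f (t * INR n.+1) <= f (xi n) by apply: f_decr; lra.
have f1' := Rmult_le_compat_l t _ _ (Rlt_le _ _ t0) f1.
have f2' := Rmult_le_compat_l t _ _ (Rlt_le _ _ t0) f2.
have -> S J1 J2 : t * (S + f (xi n)) - (J1 + J2) = (t * S - J1) + (t * f (xi n) - J2).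
  by ring.
by move: IH; split_Rabs; lra.
Qed.
End MonotoneSum.

Definition dsum (L : nat) (F : nat -> nat -> R) : R := \rsum_(i < L) (\rsum_(j < L) (F i j)).

(** The reference majorant: its lattice sums are bounded uniformly in the mesh, and its product form
    reduces them to one variable. *)
Definition dom (X Y : R) : R := / (1 + X) ^ 2 * / (1 + Y) ^ 2.

Lemma dom_pos X Y : 0 <= X -> 0 <= Y -> 0 < dom X Y.
Proof. by move=> X0 Y0; apply: Rmult_lt_0_compat; apply: Rinv_0_lt_compat; apply: pow_lt; lra. Qed.

Lemma dsum_le L F G : (forall i j, F i j <= G i j) -> dsum L F <= dsum L G.
Proof. by move=> h; apply: rsum_le => i _; apply: rsum_le. Qed.

Lemma dsum_ge0 L F : (forall i j, 0 <= F i j) -> 0 <= dsum L F.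
Proof. by move=> h; apply: rsum_ge0 => i _; apply: rsum_ge0. Qed.

Lemma dsum_scal L c F : c * dsum L F = dsum L (fun i j => c * F i j).
Proof. by rewrite /dsum rsum_scal; apply: eq_bigr => i _; rewrite rsum_scal. Qed.

Lemma dsum_sub L F G : dsum L F - dsum L G = dsum L (fun i j => F i j - G i j).
Proof. by rewrite /dsum rsum_sub; apply: eq_bigr => i _; rewrite rsum_sub. Qed.

Lemma dsum_abs L F : Rabs (dsum L F) <= dsum L (fun i j => Rabs (F i j)).
Proof.
apply: Rle_trans (rsum_abs _ _ _) _; apply: rsum_le => i _; exact: rsum_abs.
Qed.

Lemma dsum_prod L (a b : nat -> R) :
  dsum L (fun i j => a i * b j) = (\rsum_(i < L) a i) * (\rsum_(j < L) b j).
Proof.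
rewrite /dsum Rmult_comm rsum_scal; apply: eq_bigr => i _.
by rewrite [RHS]Rmult_comm rsum_scal.
Qed.

Lemma od_pos h i : 0 < h -> 0 < h * od i.
Proof. by move=> h0; have := od_ge1 i; nra. Qed.

Lemma sum_dom1_le h L : 0 < h -> h * (\rsum_(i < L) (/ (1 + h * od i) ^ 2)) <= 1.
Proof.
move=> h0; rewrite rsum_scal.
(* The points [h * od i] are midpoints of intervals of length [2 h], and [(a + h)^2 >= a (a + 2 h)]
   compares the terms with a telescoping sum. *)
pose F i := - / (1 + h * (2 * INR i)).
apply: (@Rle_trans _ (\rsum_(i < L) (F i.+1 - F i))).
  apply: rsum_le => i _; rewrite /F S_INR /od.
  have i0 := pos_INR i; set a := 1 + h * (2 * INR i).
  have a1 : 1 <= a by rewrite /a; nra.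
  have -> : 1 + h * (2 * INR i + 1) = a + h by rewrite /a; ring.
  have -> : 1 + h * (2 * (INR i + 1)) = a + 2 * h by rewrite /a; ring.
  have -> : - / (a + 2 * h) - - / a = 2 * h * / (a * (a + 2 * h)) by field; lra.
  have le : / (a + h) ^ 2 <= / (a * (a + 2 * h)) by apply: Rinv_le_contravar; nra.
  have : 0 < / (a * (a + 2 * h)) by apply: Rinv_0_lt_compat; nra.
  by nra.
rewrite rsum_telescope /F /= !Rmult_0_r Rplus_0_r Rinv_1.
have : 0 < / (1 + h * (2 * INR L)) by apply: Rinv_0_lt_compat; have := pos_INR L; nra.
by lra.
Qed.

Lemma dsum_dom_le h L : 0 < h -> h ^ 2 * dsum L (fun i j => dom (h * od i) (h * od j)) <= 1.
Proof.
move=> h0; rewrite /dom (dsum_prod L (fun i => / (1 + h * od i) ^ 2) (fun i => / (1 + h * od i) ^ 2)).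
have := sum_dom1_le L h0; set S := \rsum_(i < L) _ => S1.
have S0 : 0 <= S.
  by apply: rsum_ge0 => i _; apply/Rlt_le/Rinv_0_lt_compat/pow_lt; have := od_pos i h0; lra.
have hS : 0 <= h * S by nra.
have -> : h ^ 2 * (S * S) = (h * S) * (h * S) by ring.
by nra.
Qed.

(* Lattice sums are continuous in the sup norm weighted by [dom], uniformly in the mesh [h]. *)
Lemma dsum_approx h L e F G : 0 < h -> 0 <= e ->
  (forall i j, Rabs (F i j - G i j) <= e * dom (h * od i) (h * od j)) ->
  Rabs (h ^ 2 * dsum L F - h ^ 2 * dsum L G) <= e.
Proof.
move=> h0 e0 FG; have h2 : 0 < h ^ 2 by apply: pow_lt.
have -> : h ^ 2 * dsum L F - h ^ 2 * dsum L G = h ^ 2 * (dsum L F - dsum L G) by ring.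
rewrite Rabs_mult (Rabs_pos_eq (h ^ 2)); last lra.
rewrite dsum_sub; have le1 := dsum_abs L (fun i j => F i j - G i j).
have le2 := dsum_le L FG; have := dsum_dom_le L h0.
rewrite -dsum_scal in le2; move: le1 le2; set D := dsum L (fun i j => dom _ _).
by move=> le1 le2 le3; have := Rle_trans _ _ _ le1 le2; nra.
Qed.

(** Odd multiples of [h] have spacing [2 h], so [c] stands for a quarter of the integral of [phi]
    over the positive quadrant. The truncation [L] is tied to [h] only by [M <= h * INR L], which
    lets one [L] serve many meshes. *)
Definition lattice_mean (phi : R -> R -> R) (c : R) : Prop :=
  forall e, 0 < e -> exists d M, 0 < d /\ forall h L, 0 < h < d -> M <= h * INR L ->
    Rabs (h ^ 2 * dsum L (fun i j => phi (h * od i) (h * od j)) - c) <= e.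

Lemma lattice_mean_ext phi psi c : (forall X Y, 0 < X -> 0 < Y -> phi X Y = psi X Y) ->
  lattice_mean phi c -> lattice_mean psi c.
Proof.
move=> E H e e0; have [d [M [d0 HM]]] := H e e0; exists d, M; split=> // h L hd hM.
have -> : dsum L (fun i j => psi (h * od i) (h * od j)) = dsum L (fun i j => phi (h * od i) (h * od j)).
  by apply: eq_bigr => i _; apply: eq_bigr => j _; rewrite E //; apply: od_pos; lra.
exact: HM.
Qed.

Lemma lattice_mean_approx phi c :
  (forall e, 0 < e -> exists psi c', [/\ lattice_mean psi c', Rabs (c' - c) <= e &
     forall X Y, 0 < X -> 0 < Y -> Rabs (phi X Y - psi X Y) <= e * dom X Y]) ->
  lattice_mean phi c.
Proof.
move=> H e e0; have e3 : 0 < e / 3 by lra.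
have [psi [c' [mp cc pp]]] := H _ e3.
have [d [M [d0 HM]]] := mp _ e3; exists d, M; split=> // h L hd hM.
have h0 : 0 < h by lra.
have := HM h L hd hM; have := @dsum_approx h L (e / 3) (fun i j => phi (h * od i) (h * od j))
   (fun i j => psi (h * od i) (h * od j)) h0 (Rlt_le _ _ e3).
have hyp i j : Rabs (phi (h * od i) (h * od j) - psi (h * od i) (h * od j)) <=
  e / 3 * dom (h * od i) (h * od j) by apply: pp; apply: od_pos.
move=> /(_ hyp); move: cc; split_Rabs; lra.
Qed.

Lemma lattice_mean_lin phi psi a b c c' : lattice_mean phi c -> lattice_mean psi c' ->
  lattice_mean (fun X Y => a * phi X Y + b * psi X Y) (a * c + b * c').
Proof.
move=> H H' e e0; pose K := Rabs a + Rabs b + 1.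
have a0 := Rabs_pos a; have b0 := Rabs_pos b; have K0 : 0 < K by rewrite /K; lra.
have eK : 0 < e / K by apply: Rdiv_lt_0_compat.
have [d [M [d0 HM]]] := H _ eK; have [d' [M' [d0' HM']]] := H' _ eK.
exists (Rmin d d'), (Rmax M M'); split; first exact: Rmin_glb_lt.
move=> h L [h0 hd] hM.
have := HM h L (conj h0 (Rlt_le_trans _ _ _ hd (Rmin_l _ _))) (Rle_trans _ _ _ (Rmax_l _ _) hM).
have := HM' h L (conj h0 (Rlt_le_trans _ _ _ hd (Rmin_r _ _))) (Rle_trans _ _ _ (Rmax_r _ _) hM).
have -> : dsum L (fun i j => a * phi (h * od i) (h * od j) + b * psi (h * od i) (h * od j)) =
   a * dsum L (fun i j => phi (h * od i) (h * od j)) + b * dsum L (fun i j => psi (h * od i) (h * od j)).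
  rewrite !dsum_scal /dsum -big_split; apply: eq_bigr => i _.
  by rewrite -big_split.
set S' := dsum _ _; set S := dsum _ _ => h2 h1.
have -> : h ^ 2 * (a * S + b * S') - (a * c + b * c') = a * (h ^ 2 * S - c) + b * (h ^ 2 * S' - c') by ring.
apply: Rle_trans (Rabs_triang _ _) _; rewrite !Rabs_mult.
have eE : e = K * (e / K) by field; lra.
have p0 := Rabs_pos (h ^ 2 * S - c); have p0' := Rabs_pos (h ^ 2 * S' - c').
rewrite eE; move: (e / K) eK h1 h2 => q q0 h1 h2.
apply: (@Rle_trans _ (Rabs a * q + Rabs b * q)); last by rewrite /K; nra.
by apply: Rplus_le_compat; apply: Rmult_le_compat_l.
Qed.

Definition line_mean (f : R -> R) (c : R) : Prop :=
  forall e, 0 < e -> exists d M, 0 < d /\ forall h L, 0 < h < d -> M <= h * INR L ->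
    Rabs (h * (\rsum_(i < L) f (h * od i)) - c) <= e.

Lemma lattice_mean_prod f a : line_mean f a -> lattice_mean (fun X Y => f X * f Y) (a * a).
Proof.
move=> H e e0; pose K := 2 * Rabs a + 1; have a0 := Rabs_pos a.
have K0 : 0 < K by rewrite /K; lra.
have q0 : 0 < Rmin 1 (e / K) by apply: Rmin_glb_lt; [lra | apply: Rdiv_lt_0_compat].
have [d [M [d0 HM]]] := H _ q0; exists d, M; split=> // h L hd hM.
have := HM h L hd hM; rewrite (dsum_prod L (fun i => f (h * od i)) (fun i => f (h * od i))).
set S := \rsum_(i < L) _ => hS.
have -> : h ^ 2 * (S * S) - a * a = (h * S - a) * ((h * S - a) + 2 * a) by ring.
rewrite Rabs_mult; have h1 := Rle_trans _ _ _ hS (Rmin_l _ _); have h2 := Rle_trans _ _ _ hS (Rmin_r _ _).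
have h3 : Rabs (h * S - a + 2 * a) <= K.
  have := Rabs_triang (h * S - a) (2 * a); rewrite Rabs_mult (Rabs_pos_eq 2) /K; lra.
have -> : e = e / K * K by field; lra.
by apply: Rmult_le_compat => //; apply: Rabs_pos.
Qed.

Lemma lattice_mean_unique phi c c' : lattice_mean phi c -> lattice_mean phi c' -> c = c'.
Proof.
move=> H H'; apply: cond_eq => e e0; have e3 : 0 < e / 3 by lra.
have [d [M [d0 HM]]] := H _ e3; have [d' [M' [d0' HM']]] := H' _ e3.
pose h := Rmin d d' / 2.
have m0 : 0 < Rmin d d' by apply: Rmin_glb_lt.
have h0 : 0 < h by rewrite /h; lra.
have [L HL] := INR_unbounded (Rmax M M' / h).
have hM : Rmax M M' <= h * INR L.
  have -> : Rmax M M' = h * (Rmax M M' / h) by field; lra.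
  by apply: Rmult_le_compat_l; lra.
have ml := Rmin_l d d'; have mr := Rmin_r d d'.
have Ml := Rmax_l M M'; have Mr := Rmax_r M M'.
have h1 : 0 < h < d by rewrite /h; lra.
have h2 : 0 < h < d' by rewrite /h; lra.
have := HM h L h1 (Rle_trans _ _ _ Ml hM); have := HM' h L h2 (Rle_trans _ _ _ Mr hM).
by split_Rabs; lra.
Qed.

Lemma line_mean_decr f I : (forall x, continuous f x) -> (forall x y, 0 <= x <= y -> f y <= f x) ->
  (forall x, 0 <= x -> 0 <= f x) ->
  (forall e, 0 < e -> exists M, forall x, M <= x -> Rabs (RInt f 0 x - I) <= e) ->
  line_mean f (I / 2).
Proof.
move=> fc fd f0 fI e e0; have [M HM] := fI e e0.
pose K := f 0 + 1; have K0 : 0 < K by have := f0 0 (Rle_refl 0); rewrite /K; lra.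
exists (e / (2 * K)), M; split; first by apply: Rdiv_lt_0_compat; lra.
move=> h L [h0 hd] hM.
have hL0 : 0 <= h * INR L by apply: Rmult_le_pos; [lra | exact: pos_INR].
have hi i : 2 * h * INR i <= h * od i <= 2 * h * INR i.+1 by rewrite S_INR /od; nra.
have h20 : 0 < 2 * h by lra.
have := sum_sample_RInt fc fd L h20 hi.
have I1 : Rabs (RInt f 0 (2 * h * INR L) - I) <= e by apply: HM; lra.
have fL : 0 <= f (2 * h * INR L) by apply: f0; lra.
have hK : h * K <= e / 2.
  have -> : e / 2 = e / (2 * K) * K by field; lra.
  by apply: Rmult_le_compat_r; lra.
have hfL : 0 <= h * f (2 * h * INR L) by apply: Rmult_le_pos; lra.
rewrite /K in hK; move: (\rsum_(i < L) _) I1 => S I1 S1.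
have S2 : Rabs (2 * h * S - RInt f 0 (2 * h * INR L)) <= 2 * h * f 0 by lra.
by move: I1 S2; split_Rabs; lra.
Qed.

(** * Lattice points in discs and radial functions *)

Definition ind_lt (x y : R) : R := if Rlt_dec x y then 1 else 0.

Lemma ind_lt1 x y : x < y -> ind_lt x y = 1.
Proof. by rewrite /ind_lt; case: Rlt_dec. Qed.

Lemma ind_lt0 x y : y <= x -> ind_lt x y = 0.
Proof. by rewrite /ind_lt; case: Rlt_dec => //= *; lra. Qed.

Lemma sum_ind_lt h y L : 0 < h -> 0 <= y <= 2 * h * INR L ->
  Rabs (h * (\rsum_(j < L) ind_lt (h * od j) y) - y / 2) <= h / 2.
Proof.
move=> h0 [y0 yL]; pose S L := h * (\rsum_(j < L) ind_lt (h * od j) y).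
(* Invariant: either all points so far lie below [y], or [y] has been passed and the count is
   final. *)
suff : (h * (2 * INR L - 1) < y /\ S L = h * INR L) \/
       (y <= h * (2 * INR L - 1) /\ Rabs (S L - y / 2) <= h / 2).
  rewrite /S => -[[lt ->]|[_ //]].
  by split_Rabs; lra.
elim: {yL} L => [|L IH].
  by left; rewrite /S big_ord0 /=; split; [nra | ring].
have SS : S L.+1 = S L + h * ind_lt (h * od L) y by rewrite /S (rsumS L (fun j => ind_lt (h * od j) y)); ring.
have e : h * (2 * INR L.+1 - 1) = h * od L by rewrite S_INR /od; ring.
have mono : h * (2 * INR L - 1) <= h * od L by rewrite /od; nra.
rewrite SS e /ind_lt; case: Rlt_dec => lt.
  left; split=> //; case: IH => [[_ ->]|[le _]]; last by lra.
  by rewrite S_INR /=; ring.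
right; split; first by lra.
case: IH => [[lt' E]|[le ab]]; last by rewrite /= Rmult_0_r Rplus_0_r.
by rewrite E /=; rewrite /od in lt; split_Rabs; lra.
Qed.

Section Circle.
Variable r : R.
Hypothesis r0 : 0 < r.
(** Since [sqrt] is [0] on negative numbers, [f] vanishes beyond [r] and is continuous and
    nonincreasing on the whole half-line. *)
Let f x := sqrt (r ^ 2 - x ^ 2).

Lemma semicircle_cont x : continuous f x.
Proof.
apply: continuous_comp; last exact: continuous_sqrt.
by apply: (ex_derive_continuous (fun x => r ^ 2 - x ^ 2)); auto_derive.
Qed.

Lemma semicircle_decr x y : 0 <= x <= y -> f y <= f x.
Proof. by move=> xy; apply: sqrt_le_1_alt; nra. Qed.

Lemma RInt_semicircle M : r <= M -> RInt f 0 M = PI * r ^ 2 / 4.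
Proof.
move=> rM; rewrite (RInt_split semicircle_cont 0 r).
have -> : RInt f r M = 0.
  transitivity (RInt (fun=> 0) r M); last by rewrite RInt_const /scal /= /mult /=; ring.
  apply: RInt_ext => x; rewrite Rmin_left // Rmax_right // => -[x1 x2].
  by rewrite /f sqrt_neg_0 //; nra.
rewrite Rplus_0_r.
have <- : RInt (fun y => scal (r * cos y) (f (r * sin y))) 0 (PI / 2) = RInt f 0 r.
  have := @RInt_comp R_CompleteNormedModule f (fun y => r * sin y) (fun y => r * cos y) 0 (PI / 2).
  rewrite sin_0 sin_PI2 Rmult_0_r Rmult_1_r => -> //.
    by move=> x _; apply: semicircle_cont.
  move=> x _; split; first by auto_derive => //; ring.
  by apply: (ex_derive_continuous (fun y => r * cos y)); auto_derive.
have pi0 := PI_RGT_0.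
transitivity (RInt (fun y => r ^ 2 * (cos y) ^ 2) 0 (PI / 2)).
  apply: RInt_ext => y; rewrite Rmin_left ?Rmax_right; [|lra..] => -[y1 y2].
  rewrite /scal /= /mult /= /f.
  have -> : r ^ 2 - (r * sin y) ^ 2 = (r * cos y) ^ 2.
    by have := sin2_cos2 y; rewrite /Rsqr => e; have -> : (r * cos y) ^ 2 = r ^ 2 * (1 - sin y * sin y) by [rewrite -e; ring]; ring.
  rewrite sqrt_pow2; first by ring.
  by apply: Rmult_le_pos; [lra | apply: cos_ge_0; lra].
apply: is_RInt_unique.
pose F y := r ^ 2 * (y + sin y * cos y) / 2.
have -> : PI * r ^ 2 / 4 = minus (F (PI / 2)) (F 0).
  by rewrite /F /minus /plus /opp /= cos_PI2 sin_0; field.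
apply (is_RInt_derive F) => x _.
  rewrite /F; auto_derive => //; have := sin2_cos2 x; rewrite /Rsqr => e.
  have -> : 1 * cos x * cos x + sin x * (1 * - sin x) = 2 * cos x ^ 2 - 1 by nra.
  by field.
by apply: (ex_derive_continuous (fun y => r ^ 2 * cos y ^ 2)); auto_derive.
Qed.

Lemma ind_disc X Y : 0 < X -> 0 < Y -> ind_lt (X ^ 2 + Y ^ 2) (r ^ 2) = ind_lt Y (f X).
Proof.
move=> X0 Y0; rewrite /ind_lt /f; case: Rlt_dec => lt; case: Rlt_dec => lt' //; exfalso.
  by apply: lt'; rewrite -(sqrt_pow2 Y); [apply: sqrt_lt_1_alt; nra | lra].
apply: lt; case: (Rle_lt_dec (r ^ 2 - X ^ 2) 0) => le.
  by rewrite sqrt_neg_0 // in lt'; lra.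
by have := sqrt_sqrt _ (Rlt_le _ _ le); nra.
Qed.

(** The points are counted column by column: each column is an interval of height [f], and the sum
    of the heights is a Riemann sum for a quarter of the disc. *)
Lemma lattice_mean_disc : lattice_mean (fun X Y => ind_lt (X ^ 2 + Y ^ 2) (r ^ 2)) (PI * r ^ 2 / 16).
Proof.
move=> e e0; pose K := 2 * r + 1.
have K0 : 0 < K by rewrite /K; lra.
exists (Rmin 1 (e / K)), r; split; first by apply: Rmin_glb_lt; [lra | exact: Rdiv_lt_0_compat].
move=> h L [h0 hd] hM.
have h1 : h < 1 by apply: Rlt_le_trans hd (Rmin_l _ _).
have he : h < e / K by apply: Rlt_le_trans hd (Rmin_r _ _).
have fr : f 0 = r by rewrite /f -[X in _ = X]sqrt_pow2; [congr sqrt; ring | lra].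
pose A := \rsum_(i < L) f (h * od i).
(* The indicator records that empty columns carry no error; [h / 2] summed over all [L] columns
   would not stay small. *)
have inner i : Rabs (h * (\rsum_(j < L) ind_lt ((h * od i) ^ 2 + (h * od j) ^ 2) (r ^ 2)) - f (h * od i) / 2)
    <= h / 2 * ind_lt (h * od i) r.
  have -> : \rsum_(j < L) ind_lt ((h * od i) ^ 2 + (h * od j) ^ 2) (r ^ 2) = \rsum_(j < L) ind_lt (h * od j) (f (h * od i)).
    by apply: eq_bigr => j _; apply: ind_disc; apply: od_pos.
  have p := od_pos i h0.
  rewrite [in X in _ <= X]/ind_lt; case: Rlt_dec => lt.
    rewrite Rmult_1_r; apply: sum_ind_lt => //; split; first exact: sqrt_pos.
    by have := @semicircle_decr 0 (h * od i); rewrite fr; lra.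
  have -> : f (h * od i) = 0 by rewrite /f sqrt_neg_0 //; nra.
  rewrite big1 /=; first by rewrite !Rmult_0_r; split_Rabs; lra.
  by move=> j _; have := od_pos j h0; rewrite /ind_lt; case: Rlt_dec => /= lt2 lt1; lra.
have h20 : 0 < 2 * h by lra.
have hi i : 2 * h * INR i <= h * od i <= 2 * h * INR i.+1 by rewrite S_INR /od; nra.
have := sum_sample_RInt semicircle_cont semicircle_decr L h20 hi.
rewrite RInt_semicircle; last by lra.
rewrite -/A fr => S1; have fL : 0 <= f (2 * h * INR L) by apply: sqrt_pos.
have outer : Rabs (h ^ 2 * dsum L (fun i j => ind_lt ((h * od i) ^ 2 + (h * od j) ^ 2) (r ^ 2)) - h * A / 2)
   <= h * (r / 2 + h / 2) / 2.
  have -> : h ^ 2 * dsum L (fun i j => ind_lt ((h * od i) ^ 2 + (h * od j) ^ 2) (r ^ 2)) - h * A / 2 =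
    h * (\rsum_(i < L) (h * (\rsum_(j < L) ind_lt ((h * od i) ^ 2 + (h * od j) ^ 2) (r ^ 2)) - f (h * od i) / 2)).
    rewrite -rsum_sub.
    have -> : \rsum_(i < L) (h * (\rsum_(j < L) ind_lt ((h * od i) ^ 2 + (h * od j) ^ 2) (r ^ 2))) =
      h * dsum L (fun i j => ind_lt ((h * od i) ^ 2 + (h * od j) ^ 2) (r ^ 2)) by rewrite /dsum rsum_scal.
    have -> : \rsum_(i < L) (f (h * od i) / 2) = / 2 * A by rewrite rsum_scal; apply: eq_bigr => i _; field.
    by field.
  rewrite Rabs_mult (Rabs_pos_eq h); last lra.
  have b1 : Rabs (\rsum_(i < L) (h * (\rsum_(j < L) ind_lt ((h * od i) ^ 2 + (h * od j) ^ 2) (r ^ 2)) - f (h * od i) / 2))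
     <= \rsum_(i < L) (h / 2 * ind_lt (h * od i) r).
    by apply: Rle_trans (rsum_abs _ _ _) _; apply: rsum_le => i _; exact: inner.
  rewrite -rsum_scal in b1.
  have T1 : Rabs (h * (\rsum_(i < L) ind_lt (h * od i) r) - r / 2) <= h / 2 by apply: sum_ind_lt; lra.
  move: b1 T1; set T := \rsum_(i < L) ind_lt _ _; set X := Rabs _ => b1 T1.
  have T2 : h * T <= r / 2 + h / 2 by move: T1; split_Rabs; lra.
  have b2 : X <= (r / 2 + h / 2) / 2 by lra.
  by have := Rmult_le_compat_l h _ _ (Rlt_le _ _ h0) b2; lra.
have hK : h * K <= e.
  have -> : e = e / K * K by field; lra.
  by apply: Rmult_le_compat_r; lra.
rewrite /K in hK.
move: S1 outer; set D := h ^ 2 * _ => S1 outer.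
have hfL : 0 <= h * f (2 * h * INR L) by apply: Rmult_le_pos; lra.
have hh : h * h <= h by nra.
have S2 : Rabs (2 * h * A - PI * r ^ 2 / 4) <= 2 * h * r by lra.
by move: S2 outer; split_Rabs; lra.
Qed.
End Circle.

Lemma lattice_mean0 : lattice_mean (fun _ _ => 0) 0.
Proof.
move=> e e0; exists 1, 0; split; first lra.
move=> h L _ _; rewrite /dsum big1; last by move=> i _; rewrite big1.
by rewrite Rmult_0_r Rminus_0_r Rabs_R0; lra.
Qed.

Lemma lattice_mean_sum n (a : nat -> R) (phi : nat -> R -> R -> R) (c : nat -> R) :
  (forall j, lattice_mean (phi j) (c j)) ->
  lattice_mean (fun X Y => \rsum_(j < n) (a j * phi j X Y)) (\rsum_(j < n) (a j * c j)).
Proof.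
move=> H; elim: n => [|n IH].
  rewrite big_ord0; apply: lattice_mean_ext lattice_mean0 => X Y _ _.
  by rewrite big_ord0.
rewrite (rsumS n (fun j => a j * c j)).
have := lattice_mean_lin 1 (a n) IH (H n); rewrite Rmult_1_l.
apply: lattice_mean_ext => X Y _ _.
by rewrite (rsumS n (fun j => a j * phi j X Y)) Rmult_1_l.
Qed.

Section Radial.
Variables (g : R -> R) (K Lam I : R).
Hypothesis g_cont : forall x, continuous g x.
Hypothesis g_decr : forall x y, 0 <= x <= y -> g y <= g x.
Hypothesis g_lip : forall x y, 0 <= x <= y -> g x - g y <= Lam * (y - x).
Hypothesis g_ge0 : forall x, 0 <= x -> 0 <= g x.
Hypothesis g_decay : forall r, 0 <= r -> g (r ^ 2) * (1 + r) ^ 5 <= K.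
Hypothesis g_int : forall e, 0 < e -> exists M, forall x, M <= x -> Rabs (RInt g 0 x - I) <= e.

(** Layer-cake approximation of [g]: as a function of [X^2 + Y^2] it is a finite combination of
    indicators of discs, whose means are known. *)
Let layer (t : R) n w := \rsum_(j < n) ((g (t * INR j) - g (t * INR j.+1)) * ind_lt w (t * INR j.+1)).

Lemma layer_cake t n w : 0 < t -> 0 <= w -> 0 <= Lam ->
  (w < t * INR n -> Rabs (layer t n w - (g w - g (t * INR n))) <= Lam * t) /\
  (t * INR n <= w -> layer t n w = 0).
Proof.
move=> t0 w0 L0; elim: n => [|n [IH1 IH2]].
  by split=> [|_]; [rewrite /= Rmult_0_r; lra | rewrite /layer big_ord0].
have LS : layer t n.+1 w = layer t n w + (g (t * INR n) - g (t * INR n.+1)) * ind_lt w (t * INR n.+1).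
  by rewrite /layer (rsumS n (fun j => (g (t * INR j) - g (t * INR j.+1)) * ind_lt w (t * INR j.+1))).
have n0 := pos_INR n; have tn : t * INR n.+1 = t * INR n + t by rewrite S_INR; ring.
have tn0 : 0 <= t * INR n by apply: Rmult_le_pos; lra.
rewrite LS; case: (Rlt_le_dec w (t * INR n.+1)) => lt; split=> lt'; try lra; last first.
  by rewrite ind_lt0 // IH2; [ring | lra].
rewrite (ind_lt1 lt).
case: (Rlt_le_dec w (t * INR n)) => c.
  by move: (IH1 c); split_Rabs; lra.
rewrite (IH2 c); have := @g_lip (t * INR n) w (conj tn0 c); have := @g_decr (t * INR n) w (conj tn0 c).
have : Lam * (w - t * INR n) <= Lam * t by apply: Rmult_le_compat_l; lra.
by split_Rabs; lra.
Qed.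

Lemma sum_Abel (a : nat -> R) n :
  \rsum_(j < n) ((a j - a j.+1) * INR j.+1) = (\rsum_(j < n) a j) - INR n * a n.
Proof.
elim: n => [|n IH]; first by rewrite !big_ord0 /=; ring.
rewrite (rsumS n (fun j => (a j - a j.+1) * INR j.+1)) (rsumS n a) IH S_INR.
by ring.
Qed.

Lemma dom_radial X Y : 0 < X -> 0 < Y -> / (1 + sqrt (X ^ 2 + Y ^ 2)) ^ 4 <= dom X Y.
Proof.
move=> X0 Y0; set r := sqrt _; have s0 : 0 <= X ^ 2 + Y ^ 2 by nra.
have Xr : X <= r by rewrite /r -{1}(sqrt_pow2 X); [apply: sqrt_le_1_alt; nra | lra].
have Yr : Y <= r by rewrite /r -{1}(sqrt_pow2 Y); [apply: sqrt_le_1_alt; nra | lra].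
have -> : / (1 + r) ^ 4 = / (1 + r) ^ 2 * / (1 + r) ^ 2 by field; lra.
have inv_le Z : 0 < Z -> Z <= r -> / (1 + r) ^ 2 <= / (1 + Z) ^ 2.
  by move=> Z0 Zr; apply: Rinv_le_contravar; [apply: pow_lt; lra | apply: pow_incr; lra].
have p : 0 <= / (1 + r) ^ 2 by apply/Rlt_le/Rinv_0_lt_compat/pow_lt; lra.
by apply: Rmult_le_compat => //; apply: inv_le.
Qed.

(** It suffices to approximate by layers in the norm weighted by [dom]. At radius [r] the weight is
    at least [(1 + r)^-4], so the fifth power in [g_decay] makes the error beyond a large radius
    small. *)
Lemma lattice_mean_radial : lattice_mean (fun X Y => g (X ^ 2 + Y ^ 2)) (PI * I / 16).
Proof.
apply: lattice_mean_approx => e e0.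
have K0 : 0 <= K.
  by have := g_decay (Rle_refl 0); have := g_ge0 (Rle_refl 0); rewrite /= !Rmult_0_l; lra.
have L0 : 0 <= Lam by have := @g_lip 0 1 ltac:(lra); have := @g_decr 0 1 ltac:(lra); lra.
have e4 : 0 < e / 4 by lra.
have [M HM] := g_int e4.
(* Beyond [M] the integral of [g] is within [e / 4] of its limit, and [4 * K / e] brings the
   weighted tail [K / (1 + r)] below [e / 4]. *)
pose r := Rmax 1 (Rmax M (4 * K / e)).
have r1 : 1 <= r by apply: Rmax_l.
have rM : M <= r ^ 2.
  have : M <= r by apply: Rle_trans (Rmax_r _ _); apply: Rmax_l.
  by nra.
have rK : K / (1 + r) <= e / 4.
  have : 4 * K / e <= r by apply: Rle_trans (Rmax_r _ _); apply: Rmax_r.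
  move=> h; apply: (Rmult_le_reg_r (1 + r)); first lra.
  have -> : K / (1 + r) * (1 + r) = K by field; lra.
  have -> : K = 4 * K / e * e / 4 by field; lra.
  by have := Rmult_le_compat_r e _ _ (Rlt_le _ _ e0) h; nra.
have g0 := g_ge0 (Rle_refl 0).
(* [t * B] has to absorb the layer error [Lam * t] with weight [(1 + r) ^ 4] and the Riemann sum
   error [t * g 0]. *)
pose B := Lam * (1 + r) ^ 4 + g 0 + 1.
have p4 : 0 < (1 + r) ^ 4 by apply: pow_lt; lra.
have B0 : 0 < B by rewrite /B; nra.
have [J HJ] := INR_unbounded (r ^ 2 * B * 4 / e).
have J0 : 0 < INR J.
  by apply: Rlt_trans HJ; apply: Rdiv_lt_0_compat => //; apply: Rmult_lt_0_compat; [apply: Rmult_lt_0_compat => //; nra | lra].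
pose t := r ^ 2 / INR J.
have t0 : 0 < t by apply: Rdiv_lt_0_compat => //; nra.
have tJ : t * INR J = r ^ 2 by rewrite /t; field; lra.
have tB : t * B <= e / 4.
  have : r ^ 2 * B * 4 <= e * INR J.
    have := Rmult_lt_compat_r e _ _ e0 HJ.
    by have -> : r ^ 2 * B * 4 / e * e = r ^ 2 * B * 4 by [field; lra]; lra.
  move=> h; apply: (Rmult_le_reg_r (INR J)) => //.
  by have -> : t * B * INR J = r ^ 2 * B by [rewrite -tJ; ring]; lra.
exists (fun X Y => layer t J (X ^ 2 + Y ^ 2)).
exists (\rsum_(j < J) ((g (t * INR j) - g (t * INR j.+1)) * (PI * (t * INR j.+1) / 16))).
have gr : g (r ^ 2) * (1 + r) ^ 5 <= K by apply: g_decay; lra.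
have gr0 : 0 <= g (r ^ 2) by apply: g_ge0; nra.
have gr4 : g (r ^ 2) * (1 + r) ^ 4 <= e / 4.
  apply: Rle_trans rK; apply: (Rmult_le_reg_r (1 + r)); first lra.
  by have -> : K / (1 + r) * (1 + r) = K by [field; lra]; lra.
split.
- apply: (@lattice_mean_sum J (fun j => g (t * INR j) - g (t * INR j.+1))
    (fun j X Y => ind_lt (X ^ 2 + Y ^ 2) (t * INR j.+1)) (fun j => PI * (t * INR j.+1) / 16)) => j.
  have p : 0 < t * INR j.+1 by apply: Rmult_lt_0_compat => //; apply: lt_0_INR; lia.
  have := @lattice_mean_disc (sqrt (t * INR j.+1)) (sqrt_lt_R0 _ p).
  by rewrite -Rsqr_pow2 Rsqr_sqrt; last lra.
(* By Abel summation the mean of the layers is a Riemann sum for the integral of [g], minus a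
   boundary term that [g_decay] bounds. *)
- have -> : \rsum_(j < J) ((g (t * INR j) - g (t * INR j.+1)) * (PI * (t * INR j.+1) / 16)) =
     PI / 16 * (t * (\rsum_(j < J) g (t * INR j)) - r ^ 2 * g (r ^ 2)).
    have := sum_Abel (fun j => g (t * INR j)) J; rewrite tJ => E.
    have -> : PI / 16 * (t * (\rsum_(j < J) g (t * INR j)) - r ^ 2 * g (r ^ 2)) =
      PI / 16 * t * ((\rsum_(j < J) g (t * INR j)) - INR J * g (r ^ 2)) by rewrite -tJ; ring.
    by rewrite -E rsum_scal; apply: eq_bigr => j _; field.
  have hx j : t * INR j <= t * INR j <= t * INR j.+1 by rewrite S_INR; nra.
  have := sum_sample_RInt g_cont g_decr J t0 hx; rewrite tJ.
  have := HM _ rM; set S := \rsum_(j < J) _ => h1 h2.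
  have h3 : r ^ 2 * g (r ^ 2) <= e / 4.
    apply: Rle_trans gr4; rewrite Rmult_comm; apply: Rmult_le_compat_l => //.
    by apply: (@Rle_trans _ ((1 + r) ^ 2)); [apply: pow_incr; lra | apply: Rle_pow; [lra | lia]].
  have h4 : t * (g 0 - g (r ^ 2)) <= e / 4.
    by apply: Rle_trans tB; apply: Rmult_le_compat_l; [lra | rewrite /B; nra].
  have h5 : 0 <= r ^ 2 * g (r ^ 2) by apply: Rmult_le_pos => //; nra.
  have pi0 := PI_RGT_0; have pi4 := PI_4.
  have -> : PI / 16 * (t * S - r ^ 2 * g (r ^ 2)) - PI * I / 16 = PI / 16 * (t * S - r ^ 2 * g (r ^ 2) - I) by field.
  rewrite Rabs_mult (Rabs_pos_eq (PI / 16)); last lra.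
  have h6 : Rabs (t * S - r ^ 2 * g (r ^ 2) - I) <= e by move: h1 h2; split_Rabs; lra.
  have := Rabs_pos (t * S - r ^ 2 * g (r ^ 2) - I).
  by nra.
move=> X Y X0 Y0; set w := X ^ 2 + Y ^ 2; have w0 : 0 <= w by rewrite /w; nra.
apply: Rle_trans (Rmult_le_compat_l _ _ _ (Rlt_le _ _ e0) (dom_radial X0 Y0)).
rewrite -/w; set s := sqrt w; have s0 : 0 <= s by apply: sqrt_pos.
have sw : s ^ 2 = w by rewrite /s -Rsqr_pow2 Rsqr_sqrt.
have ps : 0 < (1 + s) ^ 4 by apply: pow_lt; lra.
apply: (Rmult_le_reg_r ((1 + s) ^ 4)) => //.
have -> : e * / (1 + s) ^ 4 * (1 + s) ^ 4 = e by field; lra.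
have [H1 H2] := layer_cake J t0 w0 L0; rewrite tJ in H1 H2.
have [lt|le] := Rlt_le_dec w (r ^ 2).
  have sr : s <= r by nra.
  have srp : (1 + s) ^ 4 <= (1 + r) ^ 4 by apply: pow_incr; lra.
  have h1 : Rabs (g w - layer t J w) <= Lam * t + g (r ^ 2) by move: (H1 lt); split_Rabs; lra.
  have h2 : (Lam * t + g (r ^ 2)) * (1 + r) ^ 4 <= e.
    by move: tB; rewrite /B; nra.
  apply: Rle_trans h2; apply: Rmult_le_compat => //; [exact: Rabs_pos | lra].
rewrite (H2 le) Rminus_0_r Rabs_pos_eq; last exact: g_ge0.
have rs : r <= s by nra.
have gs : g (s ^ 2) * (1 + s) ^ 5 <= K by apply: g_decay.
rewrite -sw; apply: (Rmult_le_reg_r (1 + s)); first lra.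
apply: (@Rle_trans _ K); first by move: gs; rewrite /=; lra.
have -> : K = K / (1 + r) * (1 + r) by field; lra.
by apply: Rmult_le_compat; try lra; apply: Rdiv_le_0_compat; lra.
Qed.
End Radial.

(** * Gaussian and quartic integrals *)

Definition int_conv (f : R -> R) (I : R) : Prop :=
  forall e, 0 < e -> exists M, forall x, M <= x -> Rabs (RInt f 0 x - I) <= e.

Lemma exp_le x y : x <= y -> exp x <= exp y.
Proof. by case=> [lt|->]; [apply/Rlt_le/exp_increasing | lra]. Qed.

Lemma exp_pow_INR x n : exp x ^ n = exp (INR n * x).
Proof.
elim: n => [|n IH]; first by rewrite /= Rmult_0_l exp_0.
by rewrite S_INR Rmult_plus_distr_r Rmult_1_l exp_plus -IH /=; ring.
Qed.

Lemma exp_sqr_decay c n : 0 < c ->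
  exists K, 0 < K /\ forall r, 0 <= r -> exp (- (c * r ^ 2)) * (1 + r) ^ n <= K.
Proof.
(* [(1 + r)^n] is at most [exp (n r)], and completing the square bounds [n r - c r^2] by
   [n^2 / (4 c)]. *)
move=> c0; exists (exp (INR n ^ 2 / (4 * c))); split; first exact: exp_pos.
move=> r r0; apply: (@Rle_trans _ (exp (- (c * r ^ 2)) * exp (INR n * r))).
  apply: Rmult_le_compat_l; first exact/Rlt_le/exp_pos.
  rewrite -exp_pow_INR; apply: pow_incr; split; first lra.
  by apply: exp_ineq1_le.
rewrite -exp_plus; apply: exp_le.
have -> : INR n ^ 2 / (4 * c) = (- (c * r ^ 2) + INR n * r) + (2 * c * r - INR n) ^ 2 / (4 * c) by field; lra.
have : 0 <= (2 * c * r - INR n) ^ 2 / (4 * c) by apply: Rdiv_le_0_compat; [exact: pow2_ge_0 | lra].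
by lra.
Qed.

Lemma int_conv_exists f K : (forall x, continuous f x) -> (forall x, 0 <= x -> 0 <= f x) ->
  (forall x, 0 <= x -> f x * (1 + x) ^ 2 <= K) -> exists I, int_conv f I /\ 0 <= I.
Proof.
move=> fc f0 fK.
have K0 : 0 <= K by have := fK 0 (Rle_refl 0); have := f0 0 (Rle_refl 0); nra.
have mono x y : 0 <= x <= y -> RInt f 0 x <= RInt f 0 y.
  move=> [x0 xy]; rewrite (RInt_split fc 0 x y).
  have : 0 <= RInt f x y.
    by apply: RInt_ge_0 => //; [apply: ex_RInt_cont | move=> z [z1 z2]; apply: f0; lra].
  by lra.
have bnd x : 0 <= x -> RInt f 0 x <= K.
  move=> x0; have dF y : 0 <= y -> is_derive (fun y => - K * / (1 + y)) y (K * / (1 + y) ^ 2).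
    by move=> y0; auto_derive; [lra | field; lra].
  have iF : is_RInt (fun y => K * / (1 + y) ^ 2) 0 x (- K * / (1 + x) - - K * / (1 + 0)).
    apply (is_RInt_derive (fun y => - K * / (1 + y))) => y; rewrite Rmin_left // Rmax_right // => -[y0 _].
      exact: dF.
    by apply: (ex_derive_continuous (fun y => K * / (1 + y) ^ 2)); auto_derive; have : 0 < (1 + y) ^ 2 by [apply: pow_lt; lra]; rewrite /=; lra.
  apply: (@Rle_trans _ (- K * / (1 + x) - - K * / (1 + 0))).
    rewrite -(is_RInt_unique _ _ _ _ iF); apply: RInt_le => //.
    - exact: ex_RInt_cont.
    - by eexists; exact: iF.
    move=> y [y0 _]; have p : 0 < (1 + y) ^ 2 by apply: pow_lt; lra.
    by apply: (Rmult_le_reg_r ((1 + y) ^ 2)) => //; have := fK y ltac:(lra); rewrite Rmult_assoc Rinv_l; lra.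
  have : 0 <= K * / (1 + x) by apply: Rmult_le_pos => //; apply/Rlt_le/Rinv_0_lt_compat; lra.
  by rewrite Rplus_0_r Rinv_1; lra.
pose E z := exists x, 0 <= x /\ z = RInt f 0 x.
have [||I [I1 I2]] := completeness E.
- by exists K => z [x [x0 ->]]; apply: bnd.
- by exists (RInt f 0 0), 0; split=> //; lra.
exists I; split; last first.
  have E0 : E (RInt f 0 0) by exists 0; split=> //; lra.
  by have := I1 _ E0; rewrite RInt_point.
move=> e e0; have [[x [x0 xe]]|] := Classical_Prop.classic (exists x, 0 <= x /\ I - e < RInt f 0 x).
  exists x => y xy; have := mono x y (conj x0 xy).
  have : RInt f 0 y <= I by apply: I1; exists y; split=> //; lra.
  by split_Rabs; lra.
move=> no; have : I <= I - e; last by lra.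
apply: I2 => z [x [x0 ->]]; apply: Rnot_lt_le => lt; apply: no.
by exists x.
Qed.

Lemma int_conv_scale f a I : (forall x, continuous f x) -> 0 < a -> int_conv f I ->
  int_conv (fun x => f (x / a)) (a * I).
Proof.
move=> fc a0 HI e e0; have ea : 0 < e / a by apply: Rdiv_lt_0_compat.
have [M HM] := HI _ ea; exists (a * M) => x xM.
have -> : RInt (fun x => f (x / a)) 0 x = a * RInt f 0 (x / a).
  have := @RInt_comp_lin R_CompleteNormedModule f (/ a) 0 0 x.
  rewrite Rmult_0_r !Rplus_0_r (Rmult_comm (/ a) x) -/(x / a) => <-; last by apply: ex_RInt_cont.
  rewrite -[RHS]/(scal a (RInt (fun y => scal (/ a) (f (/ a * y + 0))) 0 x)).
  rewrite -RInt_scal; last first.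
    apply: ex_RInt_cont => y; apply: continuous_scal_r.
    apply: (continuous_comp (fun y => / a * y + 0) f) => //.
    by apply: (ex_derive_continuous (fun y => / a * y + 0)); auto_derive.
  apply: RInt_ext => y _; rewrite /scal /= /mult /=.
  have -> : / a * y + 0 = y / a by field; lra.
  by rewrite -Rmult_assoc Rinv_r; [rewrite Rmult_1_l | lra].
have -> : a * RInt f 0 (x / a) - a * I = a * (RInt f 0 (x / a) - I) by ring.
rewrite Rabs_mult (Rabs_pos_eq a); last lra.
have -> : e = a * (e / a) by field; lra.
apply: Rmult_le_compat_l; first lra.
apply: HM; apply: (Rmult_le_reg_l a) => //.
by have -> : a * (x / a) = x by field; lra.
Qed.

Lemma exp_cont_poly (p : R -> R) x : ex_derive p x -> continuous (fun x => exp (- p x)) x.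
Proof.
by move=> dp; apply: (ex_derive_continuous (fun x => exp (- p x))); auto_derive.
Qed.

Definition gauss x := exp (- x ^ 2).
Definition quartic x := exp (- x ^ 4).

Lemma gauss_cont x : continuous gauss x.
Proof. by apply: (exp_cont_poly (p := fun x => x ^ 2)); auto_derive. Qed.

Lemma quartic_cont x : continuous quartic x.
Proof. by apply: (exp_cont_poly (p := fun x => x ^ 4)); auto_derive. Qed.

Lemma gauss_decr x y : 0 <= x <= y -> gauss y <= gauss x.
Proof. by move=> xy; apply: exp_le; nra. Qed.

Lemma quartic_decr x y : 0 <= x <= y -> quartic y <= quartic x.
Proof. by move=> xy; apply: exp_le; apply: Ropp_le_contravar; apply: pow_incr. Qed.

Lemma gauss_decay n : exists K, 0 < K /\ forall r, 0 <= r -> gauss r * (1 + r) ^ n <= K.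
Proof.
have [K [K0 H]] := @exp_sqr_decay 1 n Rlt_0_1.
by exists K; split=> // r r0; have := H r r0; rewrite Rmult_1_l.
Qed.

(** [r^4 >= r^2 - 1] reduces this to the Gaussian bound, at the price of a factor [exp c]. *)
Lemma quartic_scaled_decay c n : 0 < c ->
  exists K, 0 < K /\ forall r, 0 <= r -> exp (- (c * r ^ 4)) * (1 + r) ^ n <= K.
Proof.
move=> c0; have [K [K0 H]] := @exp_sqr_decay c n c0.
exists (exp c * K); split; first by apply: Rmult_lt_0_compat => //; exact: exp_pos.
move=> r r0; apply: Rle_trans (Rmult_le_compat_l _ _ _ (Rlt_le _ _ (exp_pos c)) (H r r0)).
rewrite -Rmult_assoc -exp_plus; apply: Rmult_le_compat_r; first by apply: pow_le; lra.
by apply: exp_le; have : 0 <= (r ^ 2 - 1) ^ 2 by [exact: pow2_ge_0]; nra.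
Qed.

(** Polar coordinates in discrete form: the mean of [exp (- (X^2 + Y^2))] is [(I / 2)^2] as a
    product and [PI / 16] as a radial function, and means are unique. *)
Lemma gauss_integral : int_conv gauss (sqrt PI / 2).
Proof.
have [K [K0 HK]] := gauss_decay 2.
have gpos x : 0 <= x -> 0 <= gauss x by move=> _; apply/Rlt_le/exp_pos.
have [I [HI I0]] := int_conv_exists gauss_cont gpos HK.
suff -> : sqrt PI / 2 = I by [].
have lm1 := lattice_mean_prod (line_mean_decr gauss_cont gauss_decr gpos HI).
pose g w := exp (- w).
have gc x : continuous g x by apply: (exp_cont_poly (p := fun x => x)); auto_derive.
have gd x y : 0 <= x <= y -> g y <= g x by move=> xy; apply: exp_le; lra.
have gl x y : 0 <= x <= y -> g x - g y <= 1 * (y - x).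
  move=> xy; rewrite /g; have -> : - y = - x + - (y - x) by ring.
  rewrite exp_plus; have := exp_ineq1_le (- (y - x)); have := exp_pos (- x).
  have : exp (- x) <= 1 by rewrite -exp_0; apply: exp_le; lra.
  by nra.
have [K5 [K50 HK5]] := gauss_decay 5.
have gi : int_conv g 1.
  have ri x : RInt g 0 x = 1 - exp (- x).
    apply is_RInt_unique.
    have -> : 1 - exp (- x) = minus ((fun t => - exp (- t)) x) ((fun t => - exp (- t)) 0).
      by rewrite /minus /plus /opp /= Ropp_0 exp_0; ring.
    apply (is_RInt_derive (fun t => - exp (- t))) => t _; last exact: gc.
    by auto_derive => //; rewrite /g; ring.
  move=> e e0; exists (/ e) => x xe; rewrite ri.
  have ie : 0 < / e by apply: Rinv_0_lt_compat.
  have p := exp_pos (- x).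
  have -> : 1 - exp (- x) - 1 = - exp (- x) by ring.
  rewrite Rabs_Ropp Rabs_pos_eq; last lra.
  have h : exp (- x) * exp x = 1 by rewrite -exp_plus Rplus_opp_l exp_0.
  have h1 := exp_ineq1_le x; have h2 : e * / e = 1 by field; lra.
  have h3 : 1 <= e * exp x by apply: (@Rle_trans _ (e * x)); [nra | apply: Rmult_le_compat_l; lra].
  have px := exp_pos x.
  apply: (Rmult_le_reg_r (exp x)) => //; lra.
have lm2 := lattice_mean_radial gc gd gl (fun x _ => Rlt_le _ _ (exp_pos _)) HK5 gi.
have E : lattice_mean (fun X Y => g (X ^ 2 + Y ^ 2)) (I / 2 * (I / 2)).
  apply: lattice_mean_ext lm1 => X Y _ _; rewrite /gauss /g -exp_plus; congr exp; ring.
have := lattice_mean_unique lm2 E => e.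
have pi0 := PI_RGT_0.
have -> : PI = (2 * I) ^ 2 by lra.
by rewrite sqrt_pow2; lra.
Qed.

Lemma lattice_mean_S :
  lattice_mean (fun X Y => exp (- ((X ^ 2 + Y ^ 2) ^ 2 / 64))) (PI * sqrt PI / 4).
Proof.
have -> : PI * sqrt PI / 4 = PI * (8 * (sqrt PI / 2)) / 16 by field.
pose g w := gauss (w / 8).
have gE w : g w = exp (- (w ^ 2 / 64)) by rewrite /g /gauss; congr exp; field.
apply: (@lattice_mean_ext (fun X Y => g (X ^ 2 + Y ^ 2))) => [X Y _ _|]; first exact: gE.
have gdf x : is_derive g x (- (x / 32) * exp (- (x ^ 2 / 64))).
  apply: (is_derive_ext (fun w => exp (- (w ^ 2 / 64)))) => [t|]; first by rewrite gE.
  by auto_derive => //; have -> : x * (x * 1) * / 64 = x ^ 2 / 64 by [field]; field.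
have gc x : continuous g x by apply: ex_derive_continuous; eexists; exact: gdf.
have gd x y : 0 <= x <= y -> g y <= g x by move=> xy; apply: gauss_decr; lra.
have gl x y : 0 <= x <= y -> g x - g y <= 1 * (y - x).
  move=> [x0 xy].
  have [||c [cxy E]] := MVT_gen g x y (fun x => - (x / 32) * exp (- (x ^ 2 / 64))).
  - by move=> z _; exact: gdf.
  - move=> z _; apply: derivable_continuous_pt; exists (- (z / 32) * exp (- (z ^ 2 / 64))).
    by apply/is_derive_Reals.
  rewrite Rmin_left // Rmax_right // in cxy.
  have e1 : exp (- (c ^ 2 / 64)) * exp (c ^ 2 / 64) = 1 by rewrite -exp_plus Rplus_opp_l exp_0.
  have e2 := exp_ineq1_le (c ^ 2 / 64); have e3 := exp_pos (- (c ^ 2 / 64)).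
  have e4 : c / 32 <= exp (c ^ 2 / 64) by nra.
  have e5 : c / 32 * exp (- (c ^ 2 / 64)) <= 1 by nra.
  have -> : g x - g y = (c / 32 * exp (- (c ^ 2 / 64))) * (y - x) by lra.
  by apply: Rmult_le_compat_r; lra.
have c64 : 0 < / 64 by lra.
have [K [K0 HK]] := @quartic_scaled_decay (/ 64) 5 c64.
apply: (lattice_mean_radial gc gd gl (fun x _ => Rlt_le _ _ (exp_pos _)) (K := K)).
  move=> r r0; have := HK r r0; rewrite gE.
  by have -> : / 64 * r ^ 4 = (r ^ 2) ^ 2 / 64 by field.
by apply: (int_conv_scale gauss_cont) => //; [lra | exact: gauss_integral].
Qed.

Lemma Rpower_pow4 x : 0 < x -> Rpower (x ^ 4) (1 / 4) = x.
Proof.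
move=> x0; have -> : x ^ 4 = Rpower x 4 by rewrite -(Rpower_pow 4 x x0); congr Rpower; rewrite /=; ring.
by rewrite Rpower_mult; have -> : 4 * (1 / 4) = 1 by [field]; rewrite Rpower_1.
Qed.

Lemma pow4_Rpower t : 0 < t -> (Rpower t (1 / 4)) ^ 4 = t.
Proof.
move=> t0; rewrite -Rpower_pow; last by apply: exp_pos.
by rewrite Rpower_mult; have -> : 1 / 4 * INR 4 = 1 by [rewrite /=; field]; rewrite Rpower_1.
Qed.

(** Substitution [t = y^4]. The antiderivative [Phi] is differentiated on [t > 0] only; the
    singularity at [0] is controlled by the size of [Phi a]. *)
Lemma Gamma_quarter I : int_conv quartic I -> Gamma (1 / 4) = 4 * I.
Proof.
move=> HI; apply is_RInt_gen_unique.
pose Phi t := 4 * RInt quartic 0 (Rpower t (1 / 4)).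
have dPhi t : 0 < t -> is_derive Phi t (Rpower t (1 / 4 - 1) * exp (- t)).
  move=> t0; have e4 : quartic (Rpower t (1 / 4)) = exp (- t) by rewrite /quartic pow4_Rpower.
  have -> : Rpower t (1 / 4 - 1) * exp (- t) =
     scal 4 (scal (/ 4 * Rpower t (1 / 4 - 1)) (quartic (Rpower t (1 / 4)))).
    by rewrite e4 /scal /= /mult /=; field.
  apply: is_derive_scal.
  apply: (is_derive_comp (fun y => RInt quartic 0 y) (fun t => Rpower t (1 / 4))).
    apply: (is_derive_RInt quartic _ 0); last exact: quartic_cont.
    by apply: filter_forall => b; apply: RInt_correct; apply: ex_RInt_cont; exact: quartic_cont.
  rewrite /Rpower; auto_derive => //.
  have -> : (1 / 4 - 1) * ln t = 1 / 4 * ln t + - ln t by ring.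
  by rewrite exp_plus exp_Ropp exp_ln //; field; lra.
have iPhi a b : 0 < a -> 0 < b ->
    is_RInt (fun t => Rpower t (1 / 4 - 1) * exp (- t)) a b (Phi b - Phi a).
  move=> a0 b0; have m0 : 0 < Rmin a b by apply: Rmin_glb_lt.
  apply (is_RInt_derive Phi) => t [t1 t2]; first by apply: dPhi; lra.
  apply: ex_derive_continuous; rewrite /Rpower; auto_derive; lra.
move=> P [e HP]; have e0 := cond_pos e.
have e16 : 0 < e / 16 by lra.
have [M HM] := HI _ e16; pose N := Rmax M 1.
have N1 : 1 <= N by apply: Rmax_r.
have x0 : 0 < e / 16 by lra.
have x4 : 0 < (e / 16) ^ 4 by apply: pow_lt.
(* [Phi a] is at most [4 a^(1/4)], whence the threshold [(e / 16) ^ 4]; at the other end [Phi b] is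
   4 times an integral up to [b^(1/4)], whence [N ^ 4]. *)
apply: (Filter_prod _ _ _ (fun a => 0 < a < (e / 16) ^ 4) (fun b => N ^ 4 < b)).
- exists (mkposreal _ x4) => y; rewrite /ball /= /AbsRing_ball /abs /minus /plus /opp /= => h1 h2.
  by move: h1; split_Rabs; lra.
- by exists (N ^ 4).
move=> a b [a0 ae] Nb /=; have N4 : 0 < N ^ 4 by apply: pow_lt; lra.
exists (Phi b - Phi a); split; first by apply: iPhi; lra.
apply: HP; rewrite /ball /= /AbsRing_ball /abs /minus /plus /opp /=.
have q0 : 0 < Rpower a (1 / 4) by apply: exp_pos.
have qa : Rpower a (1 / 4) <= e / 16.
  by rewrite -(Rpower_pow4 x0); apply: Rle_Rpower_l; lra.
have qb : N <= Rpower b (1 / 4).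
  by rewrite -{1}(@Rpower_pow4 N); [apply: Rle_Rpower_l; lra | lra].
have hb : Rabs (RInt quartic 0 (Rpower b (1 / 4)) - I) <= e / 16.
  by apply: HM; apply: Rle_trans qb; exact: Rmax_l.
have q00 : quartic 0 = 1 by rewrite /quartic pow_ne_zero // Ropp_0 exp_0.
have [ha1 ha2] := RInt_decr_bounds quartic_cont quartic_decr (conj (Rle_refl 0) (Rlt_le _ _ q0)).
rewrite q00 Rminus_0_r Rmult_1_r in ha2.
have ha3 : 0 <= Rpower a (1 / 4) * quartic (Rpower a (1 / 4)).
  by apply: Rmult_le_pos; [lra | apply/Rlt_le/exp_pos].
by rewrite /Phi; move: hb ha1; rewrite Rminus_0_r; split_Rabs; lra.
Qed.

(** The exponent separates, so the mean is the square of a one-dimensional one. Rescaling by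
    [a = 32^(1/4)] produces [a^2 = 4 sqrt 2], the origin of [sqrt 2] in the limit. *)
Lemma lattice_mean_R :
  lattice_mean (fun X Y => exp (- ((X ^ 4 + Y ^ 4) / 32))) (Gamma (1 / 4) ^ 2 * sqrt 2 / 16).
Proof.
have [K [K0 HK]] := @quartic_scaled_decay 1 2 Rlt_0_1.
have qpos x : 0 <= x -> 0 <= quartic x by move=> _; apply/Rlt_le/exp_pos.
have [|I [HI I0]] := int_conv_exists quartic_cont qpos (K := K).
  by move=> r r0; have := HK r r0; rewrite Rmult_1_l.
rewrite (Gamma_quarter HI); pose a := Rpower 32 (1 / 4).
have a0 : 0 < a by apply: exp_pos.
have a4 : a ^ 4 = 32 by apply: pow4_Rpower; lra.
have a2 : a ^ 2 = 4 * sqrt 2.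
  have s0 := sqrt_pos 2; have s2 : sqrt 2 * sqrt 2 = 2 by apply: sqrt_sqrt; lra.
  have : (a ^ 2 - 4 * sqrt 2) * (a ^ 2 + 4 * sqrt 2) = 0.
    by have -> : (a ^ 2 - 4 * sqrt 2) * (a ^ 2 + 4 * sqrt 2) = a ^ 4 - 16 * (sqrt 2 * sqrt 2) by [ring]; lra.
  by move=> /Rmult_integral [|]; nra.
have sc x : quartic (x / a) = exp (- (x ^ 4 / 32)).
  by rewrite /quartic -a4; congr exp; field; lra.
have HI' := int_conv_scale quartic_cont a0 HI.
have lc x : continuous (fun x => quartic (x / a)) x.
  apply: (continuous_comp (fun x => x / a) quartic); last exact: quartic_cont.
  by apply: (ex_derive_continuous (fun x => x / a)); auto_derive.
have ia : 0 < / a by apply: Rinv_0_lt_compat.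
have ld x y : 0 <= x <= y -> quartic (y / a) <= quartic (x / a).
  by move=> xy; apply: quartic_decr; rewrite /Rdiv; nra.
have := lattice_mean_prod (line_mean_decr lc ld (fun x _ => Rlt_le _ _ (exp_pos _)) HI').
have -> : a * I / 2 * (a * I / 2) = (4 * I) ^ 2 * sqrt 2 / 16.
  by have -> : a * I / 2 * (a * I / 2) = a ^ 2 * I ^ 2 / 4 by [field]; rewrite a2; field.
apply: lattice_mean_ext => X Y _ _; rewrite !sc -exp_plus; congr exp; field.
Qed.

(** ** Wallis' product and the sum of the inverse squares *)

(** The Wallis integrals give the size of the central binomial coefficient; their companions with
    weight [x^2] give the sum of the inverse squares. *)
Definition cos_int (k : nat) : R := RInt (fun x => cos x ^ k) 0 (PI / 2).
Definition sqr_cos_int (k : nat) : R := RInt (fun x => x ^ 2 * cos x ^ k) 0 (PI / 2).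

Lemma cos_pow_cont k x : continuous (fun x => cos x ^ k) x.
Proof. by apply: (ex_derive_continuous (fun x => cos x ^ k)); auto_derive. Qed.

Lemma sqr_cos_pow_cont k x : continuous (fun x => x ^ 2 * cos x ^ k) x.
Proof. by apply: (ex_derive_continuous (fun x => x ^ 2 * cos x ^ k)); auto_derive. Qed.

Lemma RInt_is_derive (F f : R -> R) a b : (forall x, is_derive F x (f x)) ->
  (forall x, continuous f x) -> RInt f a b = F b - F a.
Proof. by move=> dF fc; apply is_RInt_unique; apply (is_RInt_derive F) => x _. Qed.

Lemma RInt_lin (f g : R -> R) a b p q : (forall x, continuous f x) -> (forall x, continuous g x) ->
  RInt (fun x => p * f x + q * g x) a b = p * RInt f a b + q * RInt g a b.
Proof.
move=> fc gc; apply is_RInt_unique.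
apply (is_RInt_plus (fun x => p * f x) (fun x => q * g x)).
  by apply: (is_RInt_scal f); apply: RInt_correct; apply: ex_RInt_cont.
by apply: (is_RInt_scal g); apply: RInt_correct; apply: ex_RInt_cont.
Qed.

(** Integration by parts, read backwards: [cos x ^ k.+1 * sin x] vanishes at both ends, and its
    derivative is the integrand of the relation. *)
Lemma cos_int_rec k : (INR k + 2) * cos_int k.+2 = (INR k + 1) * cos_int k.
Proof.
suff : (INR k + 2) * cos_int k.+2 + - (INR k + 1) * cos_int k = 0 by lra.
rewrite /cos_int -RInt_lin; try exact: cos_pow_cont.
rewrite (@RInt_is_derive (fun x => cos x ^ k.+1 * sin x)).
- by rewrite cos_PI2 sin_0 /=; ring.
- move=> x; auto_derive => //; rewrite -/(INR k.+1) S_INR.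
  have := sin2_cos2 x; rewrite /Rsqr => e.
  set s := sin x in e *; set c := cos x in e *; set q := c ^ k; rewrite /= -/q.
  have s2 : s * s = 1 - c * c by lra.
  transitivity (c * c * q - (INR k + 1) * q * (s * s)); first by ring.
  by rewrite s2; ring.
move=> x; apply: (ex_derive_continuous (fun x => (INR k + 2) * cos x ^ k.+2 + - (INR k + 1) * cos x ^ k)).
by auto_derive.
Qed.

Lemma sqr_cos_int_rec k :
  2 * cos_int k.+2 + (INR k + 2) ^ 2 * sqr_cos_int k.+2 = (INR k + 2) * (INR k + 1) * sqr_cos_int k.
Proof.
suff : 1 * (2 * cos_int k.+2 + (INR k + 2) ^ 2 * sqr_cos_int k.+2) +
   - ((INR k + 2) * (INR k + 1)) * sqr_cos_int k = 0 by lra.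
rewrite /cos_int /sqr_cos_int -RInt_lin; try exact: cos_pow_cont; try exact: sqr_cos_pow_cont.
rewrite -RInt_lin; try exact: sqr_cos_pow_cont; last first.
  move=> x; apply: (ex_derive_continuous (fun x => 2 * cos x ^ k.+2 + (INR k + 2) ^ 2 * (x ^ 2 * cos x ^ k.+2))).
  by auto_derive.
rewrite (@RInt_is_derive (fun x => 2 * x * cos x ^ k.+2 + (INR k + 2) * x ^ 2 * cos x ^ k.+1 * sin x)).
- by rewrite cos_PI2 sin_0 /=; ring.
- move=> x; auto_derive => //; rewrite -/(INR k.+1) -/(INR k.+2) !S_INR.
  have := sin2_cos2 x; rewrite /Rsqr => e.
  set s := sin x in e *; set c := cos x in e *; set q := c ^ k; rewrite /= -/q.
  have s2 : s * s = 1 - c * c by lra.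
  transitivity (2 * c * c * q + (INR k + 2) * x * x * q * (c * c) - (INR k + 2) * (INR k + 1) * x * x * q * (s * s)); first by ring.
  by rewrite s2; ring.
move=> x; apply: (ex_derive_continuous (fun x => 1 * (2 * cos x ^ k.+2 + (INR k + 2) ^ 2 * (x ^ 2 * cos x ^ k.+2)) +
   - ((INR k + 2) * (INR k + 1)) * (x ^ 2 * cos x ^ k))).
by auto_derive.
Qed.

Lemma cos_int0 : cos_int 0 = PI / 2.
Proof. by rewrite /cos_int /= RInt_const /scal /= /mult /=; ring. Qed.

Lemma cos_int1 : cos_int 1 = 1.
Proof.
rewrite /cos_int (@RInt_is_derive sin); first by rewrite sin_PI2 sin_0; ring.
  by move=> x; auto_derive => //=; ring.
exact: cos_pow_cont.
Qed.

Lemma sqr_cos_int0 : sqr_cos_int 0 = PI ^ 3 / 24.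
Proof.
rewrite /sqr_cos_int (@RInt_is_derive (fun x => x ^ 3 / 3)); first by field.
  by move=> x; auto_derive => //=; field.
exact: sqr_cos_pow_cont.
Qed.

Lemma cos_int_pos k : 0 < cos_int k.
Proof.
suff [] : 0 < cos_int k /\ 0 < cos_int k.+1 by [].
elim: k => [|k [IH1 IH2]]; first by rewrite cos_int0 cos_int1; have := PI_RGT_0; lra.
split=> //; have k0 := pos_INR k; have := cos_int_rec k => E.
have : 0 < (INR k + 1) * cos_int k by apply: Rmult_lt_0_compat; lra.
by rewrite -E => h; apply: (Rmult_lt_reg_l (INR k + 2)); lra.
Qed.

Lemma cos_int_decr k : cos_int k.+1 <= cos_int k.
Proof.
have pi0 := PI_RGT_0; apply: RInt_le; try lra; try by apply: ex_RInt_cont; exact: cos_pow_cont.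
move=> x [x1 x2] /=; have c0 : 0 <= cos x by apply: cos_ge_0; lra.
have := COS_bound x => -[_ c1]; have := pow_le _ k c0; nra.
Qed.

Lemma cos_int_prod k : (INR k + 1) * cos_int k.+1 * cos_int k = PI / 2.
Proof.
elim: k => [|k IH]; first by rewrite cos_int0 cos_int1 /=; ring.
have -> : (INR k.+1 + 1) * cos_int k.+2 * cos_int k.+1 = (INR k + 2) * cos_int k.+2 * cos_int k.+1.
  by rewrite S_INR; ring.
by rewrite cos_int_rec -IH; ring.
Qed.

Lemma central_bin_rec k :
  ((k.+1) * 'C(2 * k.+1, k.+1) = 2 * (2 * k).+1 * 'C(2 * k, k))%N.
Proof.
have := mul_bin_diag (2 * k.+1) k; rewrite mulnS add2n /= => E1.
have := mul_bin_down (2 * k).+1 k; rewrite /= (_ : (2 * k).+1 - k = k.+1)%N; last by lia.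
by move=> E2; nia.
Qed.

Lemma cos_int_even k : cos_int (2 * k) = PI / 2 * (INR 'C(2 * k, k) / 4 ^ k).
Proof.
elim: k => [|k IH]; first by rewrite muln0 bin0 cos_int0 /=; field.
have := cos_int_rec (2 * k); rewrite IH => E.
have k0 := pos_INR k.
have Ek : INR (2 * k) = 2 * INR k by rewrite mult_INR.
have := congr1 INR (central_bin_rec k); rewrite !mult_INR !S_INR Ek => E2.
have p4 : 4 ^ k <> 0 by apply: pow_nonzero; lra.
have e2 : (2 * k.+1)%N = (2 * k).+2 by lia.
rewrite e2 in E2 *.
apply: (Rmult_eq_reg_l (INR (2 * k) + 2)); last by rewrite Ek; lra.
rewrite E Ek /=; apply: (Rmult_eq_reg_l (4 ^ k)) => //; field_simplify; try lra.
move: E2; move: (INR 'C((2 * k).+2, k.+1)) (INR 'C(2 * k, k)) => u v E2.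
have E3 : (INR k + 1) * u = 2 * (2 * INR k + 1) * v by rewrite E2 /=; ring.
transitivity (PI * (2 * (2 * INR k + 1) * v) / 4); first by field.
by rewrite -E3; field.
Qed.

(** [cos_int (2 * k)] squared lies between its products with the next and with the previous
    integral, and [cos_int_prod] evaluates both. *)
Lemma wallis_bounds k : (0 < k)%N ->
  / PI * (1 - / (2 * INR k + 1)) <= INR k * INR 'C(2 * k, k) ^ 2 / 16 ^ k <= / PI.
Proof.
move=> k0; have pi0 := PI_RGT_0; have k1 : 1 <= INR k by apply: (le_INR 1); lia.
have E := cos_int_even k.
have p16 : 16 ^ k = 4 ^ k * 4 ^ k by rewrite -Rpow_mult_distr; congr pow; ring.
have p4 : 0 < 4 ^ k by apply: pow_lt; lra.
have -> : INR k * INR 'C(2 * k, k) ^ 2 / 16 ^ k = 4 * INR k / PI ^ 2 * cos_int (2 * k) ^ 2.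
  by rewrite E p16; field; split; lra.
have w0 := cos_int_pos (2 * k); have d1 := cos_int_decr (2 * k); have d2 := cos_int_decr (2 * k).-1.
have P1 := cos_int_prod (2 * k); have P2 := cos_int_prod (2 * k).-1.
have e : (2 * k).-1.+1 = (2 * k)%N by lia.
rewrite e -S_INR e in P2 d2.
have Ek : INR (2 * k) = 2 * INR k by rewrite mult_INR.
rewrite Ek in P1 P2.
have i0 : 0 < 4 * INR k / PI ^ 2 by apply: Rdiv_lt_0_compat; [lra | apply: pow_lt].
split.
  have h : PI / 2 / (2 * INR k + 1) <= cos_int (2 * k) ^ 2.
    apply: (Rmult_le_reg_l (2 * INR k + 1)); first lra.
    have -> : (2 * INR k + 1) * (PI / 2 / (2 * INR k + 1)) = PI / 2 by field; lra.
    by rewrite -P1 Rmult_assoc; apply: Rmult_le_compat_l; [lra | rewrite /= Rmult_1_r; apply: Rmult_le_compat_r; lra].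
  apply: Rle_trans (Rmult_le_compat_l _ _ _ (Rlt_le _ _ i0) h); apply: Req_le; field; lra.
have h : cos_int (2 * k) ^ 2 <= PI / 2 / (2 * INR k).
  apply: (Rmult_le_reg_l (2 * INR k)); first lra.
  have -> : (2 * INR k) * (PI / 2 / (2 * INR k)) = PI / 2 by field; lra.
  have -> : 2 * INR k * cos_int (2 * k) ^ 2 = 2 * INR k * cos_int (2 * k) * cos_int (2 * k) by ring.
  by rewrite -P2; apply: Rmult_le_compat_l => //; apply: Rmult_le_pos; lra.
apply: Rle_trans (Rmult_le_compat_l _ _ _ (Rlt_le _ _ i0) h) _; apply: Req_le; field; lra.
Qed.

Definition ratio k := sqr_cos_int (2 * k) / cos_int (2 * k).

(* Matsuoka's telescoping identity for the squares of the integers. *)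
Lemma inv_sqr_telescope k : / INR k.+1 ^ 2 = 2 * ratio k - 2 * ratio k.+1.
Proof.
rewrite /ratio; have e2 : (2 * k.+1)%N = (2 * k).+2 by lia.
rewrite e2; have k0 := pos_INR k.
have R1 := cos_int_rec (2 * k); have R2 := sqr_cos_int_rec (2 * k).
have Ek : INR (2 * k) = 2 * INR k by rewrite mult_INR.
have w1 := cos_int_pos (2 * k); have w2 := cos_int_pos (2 * k).+2.
rewrite Ek in R1 R2; rewrite S_INR.
move: (cos_int _) (cos_int _) (sqr_cos_int _) (sqr_cos_int _) w1 w2 R1 R2 => J I S T w1 w2 R1 R2.
have n0 : 0 < 2 * INR k + 1 by lra.
have -> : S = (2 * J + (2 * INR k + 2) ^ 2 * T) / ((2 * INR k + 2) * (2 * INR k + 1)).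
  by rewrite R2; field; lra.
have -> : I = (2 * INR k + 2) * J / (2 * INR k + 1) by rewrite R1; field; lra.
by field; lra.
Qed.

Lemma x_cos_le_sin x : 0 <= x <= PI / 2 -> x * cos x <= sin x.
Proof.
move=> [x0 x1]; have pi0 := PI_RGT_0.
have [||c [cx E]] := MVT_gen (fun t => sin t - t * cos t) 0 x (fun t => t * sin t).
- by move=> t _; auto_derive => //; ring.
- move=> t _; apply: derivable_continuous_pt; exists (t * sin t).
  by apply/is_derive_Reals; auto_derive => //; ring.
rewrite Rmin_left // Rmax_right // in cx.
have s0 : 0 <= sin c by apply: sin_ge_0; lra.
rewrite /= sin_0 in E; have : 0 <= c * sin c * (x - 0) by apply: Rmult_le_pos; [apply: Rmult_le_pos; lra | lra].
by lra.
Qed.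

(** From [x cos x <= sin x], with [m = 2 k - 2], the integrand [x^2 cos^(m+2) x] is at most
    [cos^m x - cos^(m+2) x]; the integral of the latter is [cos_int m.+2] divided by [2 k - 1]. *)
Lemma ratio_bounds k : (0 < k)%N -> 0 <= ratio k <= / INR k.
Proof.
move=> k0; have pi0 := PI_RGT_0; have k1 : 1 <= INR k by apply: (le_INR 1); lia.
have w := cos_int_pos (2 * k); have [m mE] : exists m, (2 * k)%N = m.+2 by exists (2 * k - 2)%N; lia.
have cm := cos_int_rec m; have wm := cos_int_pos m.
have Em : INR m = 2 * INR k - 2.
  by have := congr1 INR mE; rewrite mult_INR !S_INR /=; lra.
rewrite /ratio mE in w *; rewrite Em in cm.
have J0 : 0 <= sqr_cos_int m.+2.
  apply: RInt_ge_0; [lra | by apply: ex_RInt_cont; exact: sqr_cos_pow_cont | move=> x [x1 x2]].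
  by apply: Rmult_le_pos; [exact: pow2_ge_0 | apply: pow_le; apply: cos_ge_0; lra].
have J1 : sqr_cos_int m.+2 <= cos_int m - cos_int m.+2.
  have -> : cos_int m - cos_int m.+2 = RInt (fun x => 1 * cos x ^ m + -1 * cos x ^ m.+2) 0 (PI / 2).
    by rewrite RInt_lin; try exact: cos_pow_cont; rewrite /cos_int; ring.
  apply: RInt_le; [lra | by apply: ex_RInt_cont; exact: sqr_cos_pow_cont | | move=> x [x1 x2]].
    apply: ex_RInt_cont => x; apply: (ex_derive_continuous (fun x => 1 * cos x ^ m + -1 * cos x ^ m.+2)).
    by auto_derive.
  have c0 : 0 <= cos x by apply: cos_ge_0; lra.
  have xs := @x_cos_le_sin x ltac:(lra); have := sin2_cos2 x; rewrite /Rsqr => e.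
  have p := pow_le _ m c0.
  have h : (x * cos x) * (x * cos x) <= sin x * sin x by apply: Rmult_le_compat; nra.
  have -> : x ^ 2 * cos x ^ m.+2 = (x * cos x) * (x * cos x) * cos x ^ m by rewrite /=; ring.
  have -> : 1 * cos x ^ m + -1 * cos x ^ m.+2 = (1 - cos x * cos x) * cos x ^ m by rewrite /=; ring.
  by apply: Rmult_le_compat_r => //; lra.
split; first by apply: Rdiv_le_0_compat.
apply: (Rmult_le_reg_r (cos_int m.+2)) => //.
have -> : sqr_cos_int m.+2 / cos_int m.+2 * cos_int m.+2 = sqr_cos_int m.+2 by field; lra.
apply: Rle_trans J1 _; apply: (Rmult_le_reg_l (INR k)); first lra.
have -> : INR k * (/ INR k * cos_int m.+2) = cos_int m.+2 by field; lra.
by nra.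
Qed.

Definition odd_inv_sqr (n : nat) : R := \rsum_(i < n) (/ od i ^ 2).

Lemma odd_inv_sqrE n : odd_inv_sqr n = PI ^ 2 / 8 - 2 * ratio (2 * n) + ratio n / 2.
Proof.
pose B n := \rsum_(i < n) (/ INR i.+1 ^ 2).
have BE m : B m = PI ^ 2 / 6 - 2 * ratio m.
  have r0 : ratio 0 = PI ^ 2 / 12.
    by rewrite /ratio muln0 cos_int0 sqr_cos_int0; field; have := PI_RGT_0; lra.
  rewrite /B (eq_bigr (fun i : 'I_m => - 2 * ratio i.+1 - - 2 * ratio i)).
    by rewrite (rsum_telescope m (fun i => - 2 * ratio i)) r0; field.
  by move=> i _; rewrite inv_sqr_telescope; ring.
have -> : odd_inv_sqr n = B (2 * n)%N - B n / 4.
  elim: n => [|n IH]; first by rewrite /odd_inv_sqr /B !big_ord0; field.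
  have e2 : (2 * n.+1)%N = (2 * n).+2 by lia.
  have n0 := pos_INR n.
  rewrite /odd_inv_sqr (rsumS n (fun i => / od i ^ 2)) -/(odd_inv_sqr n) IH e2 /B.
  rewrite (rsumS n (fun i => / INR i.+1 ^ 2)) (rsumS _ (fun i => / INR i.+1 ^ 2)) (rsumS _ (fun i => / INR i.+1 ^ 2)).
  have -> : INR (2 * n).+1 = 2 * INR n + 1 by rewrite S_INR mult_INR.
  have -> : INR (2 * n).+2 = 2 * INR n + 2 by rewrite !S_INR mult_INR /=; ring.
  by rewrite /od S_INR; field; lra.
by rewrite !BE; field.
Qed.

Lemma odd_inv_sqr_lower e : 0 < e -> exists n, (0 < n)%N /\ PI ^ 2 / 8 - e <= odd_inv_sqr n.
Proof.
move=> e0; have [n Hn] := INR_unbounded (1 / e); exists n.+1; split=> //.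
have [r0 _] := @ratio_bounds n.+1 isT; have h2 : (0 < 2 * n.+1)%N by lia.
have [_ r2] := ratio_bounds h2; rewrite odd_inv_sqrE.
have n0 := pos_INR n.
have -> : e = 1 / e * e * e by field; lra.
have : / INR (2 * n.+1) * 2 <= e; last by rewrite (_ : 1 / e * e * e = e); [lra | field; lra].
rewrite mult_INR (S_INR n); have -> : / (INR 2 * (INR n + 1)) * 2 = / (INR n + 1) by rewrite /=; field; lra.
apply: (Rmult_le_reg_r (INR n + 1)); first lra.
rewrite Rinv_l; last lra.
have := Rmult_lt_compat_r e _ _ e0 Hn; have -> : 1 / e * e = 1 by field; lra.
by lra.
Qed.

Lemma odd_inv_sqr_upper n : odd_inv_sqr n <= PI ^ 2 / 8.
Proof.
apply: le_epsilon => e e0; have [N HN] := INR_unbounded (1 / e).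
have h : (0 < n + N.+1)%N by lia.
apply: (@Rle_trans _ (odd_inv_sqr (n + N.+1)%N)).
  elim: (N.+1) => [|k IH]; first by rewrite addn0; lra.
  rewrite addnS {2}/odd_inv_sqr (rsumS _ (fun i => / od i ^ 2)) -/(odd_inv_sqr (n + k)).
  have : 0 < / od (n + k) ^ 2 by apply/Rinv_0_lt_compat/pow_lt; have := od_ge1 (n + k); lra.
  by lra.
rewrite odd_inv_sqrE; have [_ r1] := ratio_bounds h; have h2 : (0 < 2 * (n + N.+1))%N by lia.
have [r0 _] := ratio_bounds h2.
suff : / INR (n + N.+1) <= e by lra.
have n0 := pos_INR n; have N0 := pos_INR N; rewrite plus_INR S_INR.
apply: (Rmult_le_reg_r (INR n + (INR N + 1))); first lra.
rewrite Rinv_l; last lra.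
have := Rmult_lt_compat_r e _ _ e0 HN; have -> : 1 / e * e = 1 by field; lra.
by nra.
Qed.

(** ** Odd squarefree numbers *)

Definition odd_harmonic (m : nat) : R := \rsum_(i < m) (/ od i).
Definition sqfree_harmonic (N : nat) : R := \rsum_(d < N | sqfree d && odd d) (/ INR d).

Lemma ln_le_sub1 x : 0 < x -> ln x <= x - 1.
Proof. by move=> x0; have := exp_ineq1_le (ln x); rewrite exp_ln //; lra. Qed.

Lemma odd_harmonic_lower m : / 2 * ln (2 * INR m + 1) <= odd_harmonic m.
Proof.
elim: m => [|m IH].
  by rewrite /odd_harmonic big_ord0 /= Rmult_0_r Rplus_0_l ln_1; lra.
rewrite /odd_harmonic (rsumS m (fun i => / od i)) -/(odd_harmonic m) S_INR /od.
have m0 := pos_INR m; have -> : 2 * (INR m + 1) + 1 = 2 * INR m + 3 by ring.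
have : ln (2 * INR m + 3) - ln (2 * INR m + 1) <= 2 * / (2 * INR m + 1).
  rewrite -ln_div; try lra; apply: Rle_trans (ln_le_sub1 _) _; first by apply: Rdiv_lt_0_compat; lra.
  by apply: Req_le; field; lra.
by lra.
Qed.

Lemma odd_harmonic_upper m : odd_harmonic m.+1 <= 1 + / 2 * ln (2 * INR m + 1).
Proof.
elim: m => [|m IH].
  rewrite /odd_harmonic (rsumS 0 (fun i => / od i)) big_ord0 /od /= Rmult_0_r !Rplus_0_l Rinv_1 ln_1; lra.
rewrite /odd_harmonic (rsumS m.+1 (fun i => / od i)) -/(odd_harmonic m.+1) S_INR /od S_INR.
have m0 := pos_INR m; have -> : 2 * (INR m + 1) + 1 = 2 * INR m + 3 by ring.
have h : ln (2 * INR m + 1) - ln (2 * INR m + 3) <= - (2 * / (2 * INR m + 3)).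
  rewrite -ln_div; try lra; apply: Rle_trans (ln_le_sub1 _) _; first by apply: Rdiv_lt_0_compat; lra.
  by apply: Req_le; field; lra.
by lra.
Qed.

Section Parametrized.
Variables (N S M : nat).

Let idx (d i : nat) : nat := (d * (2 * i + 1) ^ 2)%N.

Lemma inv_idx d i : (0 < d)%N -> / INR (idx d i) = / INR d * / od i ^ 2.
Proof.
move=> d0; have d1 : 0 < INR d by apply: lt_0_INR; lia.
have e : INR (2 * i + 1) = od i by rewrite plus_INR mult_INR.
have := od_ge1 i; rewrite /idx mult_INR -mulnn mult_INR e => o1.
by field; lra.
Qed.

Lemma sum_pairs_inv :
  \big[Rplus/0]_(p : 'I_N * 'I_S | sqfree p.1 && odd p.1) / INR (idx p.1 p.2) =
  sqfree_harmonic N * odd_inv_sqr S.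
Proof.
rewrite /sqfree_harmonic Rmult_comm rsum_scal.
transitivity (\big[Rplus/0]_(d < N | sqfree d && odd d) \rsum_(i < S) (/ INR (idx d i))).
  by rewrite pair_big /=; apply: eq_bigl => p; rewrite andbT.
apply: eq_bigr => d /andP [_ od_d]; have d0 : (0 < d)%N by case: (nat_of_ord d) od_d.
by rewrite Rmult_comm /odd_inv_sqr rsum_scal; apply: eq_bigr => i _; rewrite inv_idx.
Qed.

(** Incidence between a pair [(d, s)] and the odd number [d s^2]. Summing it in both orders compares
    the product of the sums of [1 / d] and [1 / s^2] with an odd harmonic sum. *)
Let hit (p : 'I_N * 'I_S) (j : 'I_M) : R := if idx p.1 p.2 == (2 * j + 1)%N then / od j else 0.

Lemma hit_ge0 p j : 0 <= hit p j.
Proof.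
by rewrite /hit; case: eqP => _; [apply/Rlt_le/Rinv_0_lt_compat; have := od_ge1 j; lra | lra].
Qed.

Lemma hit1 (p : 'I_N * 'I_S) (j : 'I_M) : idx p.1 p.2 = (2 * j + 1)%N -> hit p j = / od j.
Proof. by rewrite /hit => ->; rewrite eqxx. Qed.

Lemma inv_od (j : nat) : / od j = / INR (2 * j + 1).
Proof. by rewrite plus_INR mult_INR. Qed.

(** The hypothesis keeps every [d s^2] below [2 M], so each pair hits some [j]; by uniqueness of the
    decomposition no [j] is hit twice. *)
Lemma sqfree_harmonic_upper : (N * (2 * S) ^ 2 <= 2 * M)%N ->
  sqfree_harmonic N * odd_inv_sqr S <= odd_harmonic M.
Proof.
move=> NM; rewrite -sum_pairs_inv.
apply: (@Rle_trans _ (\big[Rplus/0]_(p : 'I_N * 'I_S | sqfree p.1 && odd p.1) \rsum_(j < M) hit p j)).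
  apply: rsum_le => -[d i] /= /andP [sd od_d].
  have oi : odd (idx d i) by rewrite /idx oddM oddX od_d /=; lia.
  have lt : ((idx d i)./2 < M)%N.
    have d1 := ltn_ord d; have i1 := ltn_ord i.
    have : (idx d i < N * (2 * S) ^ 2)%N.
      apply: (@leq_ltn_trans (d * (2 * S) ^ 2)); last first.
        by rewrite ltn_pmul2r // expn_gt0; apply/orP; left; lia.
      by rewrite leq_mul2l leq_exp2r //; apply/orP; right; lia.
    by have := odd_double_half (idx d i); lia.
  have e : (2 * (idx d i)./2 + 1)%N = idx d i by have := odd_double_half (idx d i); rewrite oi; lia.
  rewrite (bigD1 (Ordinal lt)) //= hit1 /= ?e // inv_od e.
  rewrite -[X in X <= _]Rplus_0_r; apply: Rplus_le_compat_l.
  by apply: rsum_ge0 => j _; exact: hit_ge0.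
rewrite exchange_big /=; apply: rsum_le => j _.
have [p0 /andP [P0 /eqP H0]|no] := pickP (fun p : 'I_N * 'I_S => (sqfree p.1 && odd p.1) && (idx p.1 p.2 == (2 * j + 1)%N)).
  rewrite (bigD1 p0) //= big1 => [|p /andP [Pp ne]].
    by rewrite hit1 //; lra.
  rewrite /hit; case: eqP => // E; case/negP: ne; move: P0 Pp => /andP [s0 _] /andP [s1 _].
  have := @sqfree_uniq p.1 p0.1 (2 * p.2 + 1) (2 * p0.2 + 1) s1 s0 ltac:(lia).
  rewrite -/(idx p.1 p.2) -/(idx p0.1 p0.2) E H0 => /(_ erefl) [e1 e2].
  have e3 : (p.2 : nat) = p0.2 by lia.
  by rewrite [p]surjective_pairing [p0]surjective_pairing xpair_eqE -!val_eqE /= e1 eqxx e3 /=.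
rewrite big1 => [|p Pp].
  by apply/Rlt_le/Rinv_0_lt_compat; have := od_ge1 j; lra.
by have := no p; rewrite Pp /= /hit => ->.
Qed.

(** Every odd number below [2 M] has a decomposition, with [d] and [s] inside the two ranges. *)
Lemma sqfree_harmonic_lower : (2 * M <= N)%N -> (M <= S)%N ->
  odd_harmonic M <= sqfree_harmonic N * odd_inv_sqr S.
Proof.
move=> MN MS; rewrite -sum_pairs_inv.
apply: (@Rle_trans _ (\big[Rplus/0]_(p : 'I_N * 'I_S | sqfree p.1 && odd p.1) \rsum_(j < M) hit p j)).
  rewrite exchange_big /=; apply: rsum_le => j _.
  have j1 := ltn_ord j.
  have [d [s [sd s0 E]]] := @sqfree_decomp (2 * j + 1)%N ltac:(lia).
  have oE : odd (d * s ^ 2) by rewrite -E; lia.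
  move: oE; rewrite oddM oddX /= => /andP [od_d os].
  have d0 : (0 < d)%N by case: (d) od_d.
  have ds : (d <= d * s ^ 2)%N by rewrite leq_pmulr // expn_gt0 s0.
  have ss : (s <= d * s ^ 2)%N by rewrite -mulnn mulnA leq_pmull // muln_gt0 d0.
  have ld : (d < N)%N by lia.
  have li : (s./2 < S)%N by lia.
  have es : (2 * s./2 + 1)%N = s by have := odd_double_half s; rewrite os; lia.
  rewrite (bigD1 (Ordinal ld, Ordinal li)) /= ?sd //.
  rewrite hit1 /idx /= ?es -?E //.
  rewrite -[X in X <= _]Rplus_0_r; apply: Rplus_le_compat_l.
  by apply: rsum_ge0 => p _; exact: hit_ge0.
apply: rsum_le => -[d i] /= /andP [sd od_d]; have d0 : (0 < d)%N by case: (nat_of_ord d) od_d.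
have pos : 0 <= / INR (idx d i).
  by rewrite inv_idx //; apply/Rlt_le/Rmult_lt_0_compat; apply: Rinv_0_lt_compat; [apply: lt_0_INR; lia | apply: pow_lt; have := od_ge1 i; lra].
have [j0 /eqP H0|no] := pickP (fun j : 'I_M => idx d i == (2 * j + 1)%N).
  rewrite (bigD1 j0) //= big1 => [|j ne].
    by rewrite hit1 //= inv_od -H0; lra.
  rewrite /hit /=; case: eqP => // E; case/negP: ne; rewrite -val_eqE /=; apply/eqP.
  by move: E; rewrite H0; lia.
rewrite big1 => // j _; by rewrite /hit /= no.
Qed.
End Parametrized.

(** The odd harmonic sum grows like half the logarithm, and division by [PI ^ 2 / 8] gives
    [4 / PI ^ 2]. For the upper bound [S] is fixed with [odd_inv_sqr S] close to [PI ^ 2 / 8];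
    enlarging the range from [N] to [2 N S^2] costs only an additive constant. *)
Lemma sqfree_harmonic_asymp e : 0 < e -> exists N0, forall N, (N0 <= N)%N ->
  Rabs (sqfree_harmonic N - 4 / PI ^ 2 * ln (INR N)) <= e * ln (INR N).
Proof.
move=> e0; have pi0 := PI_RGT_0; have p2 : 0 < PI ^ 2 by apply: pow_lt.
pose q := 4 / PI ^ 2 + e / 2.
have q4 : 0 < 4 / PI ^ 2 by apply: Rdiv_lt_0_compat; lra.
have q0 : 0 < q by rewrite /q; lra.
have h0 : 0 < PI ^ 2 / 8 - / 2 / q.
  have -> : PI ^ 2 / 8 - / 2 / q = PI ^ 2 / 8 * (e / 2) / q.
    have pe := Rmult_lt_0_compat _ _ p2 e0; rewrite /q; field. split; [lra | apply: Rgt_not_eq; simpl in pe; lra].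
  by apply: Rdiv_lt_0_compat => //; nra.
have [S [S0 HS]] := odd_inv_sqr_lower h0.
have ZS : / 2 <= q * odd_inv_sqr S.
  have : / 2 / q <= odd_inv_sqr S by lra.
  move=> h; have := Rmult_le_compat_l q _ _ (Rlt_le _ _ q0) h.
  by have -> : q * (/ 2 / q) = / 2 by field; lra.
have Z0 : 0 < odd_inv_sqr S by nra.
have S1 : 1 <= INR S by apply: (le_INR 1); lia.
(* With [M = 2 N S^2] the argument [2 M + 1] of the logarithm is at most [5 N S^2]. *)
pose C := 1 + / 2 * ln (5 * INR S ^ 2).
have [N0 HN0] := INR_unbounded (exp (2 * Rabs C / (odd_inv_sqr S * e))).
exists N0.+1 => N le; have N1 : 1 <= INR N by apply: (le_INR 1); lia.
have NN0 : INR N0 <= INR N by apply: le_INR; lia.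
have lnN : 2 * Rabs C / (odd_inv_sqr S * e) <= ln (INR N).
  by rewrite -[X in X <= _]ln_exp; apply: Rcomplements.ln_le; [exact: exp_pos | lra].
have lnN0 : 0 <= ln (INR N) by rewrite -ln_1; apply: Rcomplements.ln_le; lra.
have lower : 4 / PI ^ 2 * ln (INR N) <= sqfree_harmonic N.
  have h1 := odd_harmonic_lower N./2.
  have h2 := @sqfree_harmonic_lower N N N./2 ltac:(lia) ltac:(lia).
  have h3 := odd_inv_sqr_upper N.
  have h4 : ln (INR N) <= ln (2 * INR N./2 + 1).
    apply: Rcomplements.ln_le; first lra.
    have : INR N <= INR (2 * N./2 + 1) by apply: le_INR; lia.
    by rewrite plus_INR mult_INR.
  have h5 : 0 <= sqfree_harmonic N.
    apply: rsum_ge0 => d /andP [_ od_d]; apply/Rlt_le/Rinv_0_lt_compat/lt_0_INR.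
    by case: (nat_of_ord d) od_d => // n _; lia.
  have h6 : / 2 * ln (INR N) <= sqfree_harmonic N * (PI ^ 2 / 8) by nra.
  have -> : 4 / PI ^ 2 * ln (INR N) = 8 / PI ^ 2 * (/ 2 * ln (INR N)) by field; lra.
  have -> : sqfree_harmonic N = 8 / PI ^ 2 * (sqfree_harmonic N * (PI ^ 2 / 8)) by field; lra.
  by apply: Rmult_le_compat_l => //; apply/Rlt_le/Rdiv_lt_0_compat; lra.
have upper : sqfree_harmonic N <= (4 / PI ^ 2 + e) * ln (INR N).
  pose M := (2 * N * S ^ 2)%N.
  have h1 := odd_harmonic_upper M.
  have h2 := @sqfree_harmonic_upper N S M.+1 ltac:(rewrite /M; nia).
  have MR : INR M = 2 * INR N * INR S ^ 2 by rewrite /M !mult_INR /=; ring.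
  have h3 : ln (2 * INR M + 1) <= ln (INR N) + ln (5 * INR S ^ 2).
    by rewrite -ln_mult; [apply: Rcomplements.ln_le; rewrite MR; nra | lra | nra].
  have h4 : sqfree_harmonic N * odd_inv_sqr S <= C + / 2 * ln (INR N) by rewrite /C; lra.
  have h5 : C <= e / 2 * odd_inv_sqr S * ln (INR N).
    apply: Rle_trans (Rle_abs C) _.
    have -> : Rabs C = e / 2 * odd_inv_sqr S * (2 * Rabs C / (odd_inv_sqr S * e)) by field; lra.
    by apply: Rmult_le_compat_l => //; apply: Rmult_le_pos; lra.
  apply: (Rmult_le_reg_r (odd_inv_sqr S)) => //.
  have h6 : / 2 * ln (INR N) <= q * odd_inv_sqr S * ln (INR N) by apply: Rmult_le_compat_r.
  by rewrite /q in h6; lra.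
by split_Rabs; lra.
Qed.

(** ** Gaussian weights *)

Definition bin_ratio (k n : nat) : R := INR 'C(2 * k, k + n) / INR 'C(2 * k, k).

Lemma central_bin_pos k : 0 < INR 'C(2 * k, k).
Proof. by apply: lt_0_INR; have : (0 < 'C(2 * k, k))%N by [rewrite bin_gt0; lia]; lia. Qed.

Lemma bin_ratio_ge0 k n : 0 <= bin_ratio k n.
Proof. by apply: Rdiv_le_0_compat; [exact: pos_INR | exact: central_bin_pos]. Qed.

Lemma bin_ratio0 k : bin_ratio k 0 = 1.
Proof. by rewrite /bin_ratio addn0; field; have := central_bin_pos k; lra. Qed.

Lemma bin_ratio_big k n : (k < n)%N -> bin_ratio k n = 0.
Proof. by move=> lt; rewrite /bin_ratio bin_small; [rewrite /= /Rdiv Rmult_0_l | lia]. Qed.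

Lemma bin_ratio_rec k n : (n <= k)%N -> bin_ratio k n.+1 * (INR k + INR n + 1) = bin_ratio k n * (INR k - INR n).
Proof.
move=> le; have := congr1 INR (mul_bin_left (2 * k) (k + n)).
have -> : (2 * k - (k + n))%N = (k - n)%N by lia.
rewrite !mult_INR S_INR plus_INR minus_INR; last by lia.
rewrite /bin_ratio addnS => E; have c0 := central_bin_pos k.
apply: (Rmult_eq_reg_r (INR 'C(2 * k, k))); last lra.
by field_simplify; try lra.
Qed.

(** Consecutive ratios are [1 - (2 n + 1) / (k + n + 1)], and the numbers [2 n + 1] below [n = a]
    add up to [a^2]. Freezing the denominator at [k + a] makes the exponents add exactly. *)
Lemma bin_ratio_upper k a : (a <= k)%N -> (0 < k)%N -> bin_ratio k a <= exp (- (INR a ^ 2 / (INR k + INR a))).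
Proof.
move=> ak k0; have k1 : 1 <= INR k by apply: (le_INR 1); lia.
have a0 := pos_INR a.
suff H n : (n <= a)%N -> bin_ratio k n <= exp (- (INR n ^ 2 / (INR k + INR a))) by apply: H.
elim: n => [|n IH] na.
  by rewrite bin_ratio0 /= Rmult_0_l /Rdiv Rmult_0_l Ropp_0 exp_0; lra.
have {}IH := IH (ltnW na); have n0 := pos_INR n.
have na' : INR n + 1 <= INR a by rewrite -S_INR; apply: le_INR; lia.
have ak' : INR a <= INR k by apply: le_INR; lia.
have E := @bin_ratio_rec k n ltac:(lia); have p := bin_ratio_ge0 k n.
have den : 0 < INR k + INR n + 1 by lra.
have -> : bin_ratio k n.+1 = bin_ratio k n * (1 + - ((2 * INR n + 1) / (INR k + INR n + 1))).
  by apply: (Rmult_eq_reg_r (INR k + INR n + 1)); [rewrite E; field; lra | lra].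
have q : (2 * INR n + 1) / (INR k + INR a) <= (2 * INR n + 1) / (INR k + INR n + 1).
  by apply: Rmult_le_compat_l; [lra | apply: Rinv_le_contravar; lra].
have r0 : 0 <= 1 + - ((2 * INR n + 1) / (INR k + INR n + 1)).
  have -> : 1 + - ((2 * INR n + 1) / (INR k + INR n + 1)) = (INR k - INR n) / (INR k + INR n + 1) by field; lra.
  by apply: Rdiv_le_0_compat; lra.
have -> : - (INR n.+1 ^ 2 / (INR k + INR a)) = - (INR n ^ 2 / (INR k + INR a)) + - ((2 * INR n + 1) / (INR k + INR a)).
  by rewrite S_INR; field; lra.
rewrite exp_plus; apply: Rmult_le_compat => //.
by apply: Rle_trans (exp_ineq1_le _) (exp_le _); lra.
Qed.

Lemma bin_ratio_gauss k a : (0 < k)%N -> bin_ratio k a <= exp (- (INR a ^ 2 / (2 * INR k))).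
Proof.
move=> k0; have k1 : 1 <= INR k by apply: (le_INR 1); lia.
have [le|gt] := leqP a k; last by rewrite bin_ratio_big //; apply/Rlt_le/exp_pos.
apply: Rle_trans (bin_ratio_upper le k0) _; apply: exp_le; apply: Ropp_le_contravar.
have a0 := pos_INR a; have ak : INR a <= INR k by apply: le_INR; lia.
by apply: Rmult_le_compat_l; [exact: pow2_ge_0 | apply: Rinv_le_contravar; lra].
Qed.

(** The same product, with each ratio written as the inverse of [1 + (2 n + 1) / (k - n)] and the
    denominator frozen at [k - a]. *)
Lemma bin_ratio_lower k a : (a < k)%N -> exp (- (INR a ^ 2 / (INR k - INR a))) <= bin_ratio k a.
Proof.
move=> ak; have ak' : INR a + 1 <= INR k by rewrite -S_INR; apply: le_INR; lia.
have a0 := pos_INR a.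
suff H n : (n <= a)%N -> exp (- (INR n ^ 2 / (INR k - INR a))) <= bin_ratio k n by apply: H.
elim: n => [|n IH] na.
  by rewrite bin_ratio0 /= Rmult_0_l /Rdiv Rmult_0_l Ropp_0 exp_0; lra.
have {}IH := IH (ltnW na); have n0 := pos_INR n.
have na' : INR n + 1 <= INR a by rewrite -S_INR; apply: le_INR; lia.
have E := @bin_ratio_rec k n ltac:(lia); have p := bin_ratio_ge0 k n.
have -> : bin_ratio k n.+1 = bin_ratio k n * ((INR k - INR n) / (INR k + INR n + 1)).
  by apply: (Rmult_eq_reg_r (INR k + INR n + 1)); [rewrite E; field; lra | lra].
have -> : - (INR n.+1 ^ 2 / (INR k - INR a)) = - (INR n ^ 2 / (INR k - INR a)) + - ((2 * INR n + 1) / (INR k - INR a)).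
  by rewrite S_INR; field; lra.
rewrite exp_plus; apply: Rmult_le_compat => //; try by apply/Rlt_le/exp_pos.
have -> : (INR k - INR n) / (INR k + INR n + 1) = / (1 + (2 * INR n + 1) / (INR k - INR n)) by field; lra.
rewrite exp_Ropp; have q0 : 0 <= (2 * INR n + 1) / (INR k - INR n) by apply: Rdiv_le_0_compat; lra.
apply: Rinv_le_contravar; first lra.
apply: Rle_trans (exp_ineq1_le _) (exp_le _).
by apply: Rmult_le_compat_l; [lra | apply: Rinv_le_contravar; lra].
Qed.

Lemma exp_opp_diff x y : 0 <= x -> x <= y -> 0 <= exp (- x) - exp (- y) <= y - x.
Proof.
move=> x0 xy; have h1 : exp (- y) <= exp (- x) by apply: exp_le; lra.
split; first lra.
have -> : - y = - x + - (y - x) by ring.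
rewrite exp_plus; have := exp_ineq1_le (- (y - x)); have := exp_pos (- x).
have : exp (- x) <= 1 by rewrite -exp_0; apply: exp_le; lra.
by nra.
Qed.

Lemma exp_opp_lip x y : 0 <= x -> 0 <= y -> Rabs (exp (- x) - exp (- y)) <= Rabs (x - y).
Proof.
move=> x0 y0; have [le|le] : x <= y \/ y <= x by lra.
  by have := exp_opp_diff x0 le; split_Rabs; lra.
by have := exp_opp_diff y0 le; split_Rabs; lra.
Qed.

Lemma bin_ratio_approx k a : (0 < k)%N -> 2 * INR a <= INR k ->
  Rabs (bin_ratio k a - exp (- (INR a ^ 2 / INR k))) <= 2 * INR a ^ 3 / INR k ^ 2.
Proof.
move=> k0 a2; have k1 : 1 <= INR k by apply: (le_INR 1); lia.
have a0 := pos_INR a.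
have ak : (a < k)%N by apply/ltP; apply: INR_lt; lra.
have up := bin_ratio_upper (ltnW ak) k0; have lo := bin_ratio_lower ak.
have a20 : 0 <= INR a ^ 2 by apply: pow2_ge_0.
have a3 : 0 <= INR a ^ 3 by apply: pow_le.
have x1 : 0 <= INR a ^ 2 / (INR k + INR a) by apply: Rdiv_le_0_compat; lra.
have x2 : 0 <= INR a ^ 2 / INR k by apply: Rdiv_le_0_compat; lra.
have l1 : INR a ^ 2 / (INR k + INR a) <= INR a ^ 2 / INR k.
  by apply: Rmult_le_compat_l => //; apply: Rinv_le_contravar; lra.
have l2 : INR a ^ 2 / INR k <= INR a ^ 2 / (INR k - INR a).
  by apply: Rmult_le_compat_l => //; apply: Rinv_le_contravar; lra.
have d1 := exp_opp_diff x1 l1; have d2 := exp_opp_diff x2 l2.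
have e1 : INR a ^ 2 / INR k - INR a ^ 2 / (INR k + INR a) <= 2 * INR a ^ 3 / INR k ^ 2.
  have -> : INR a ^ 2 / INR k - INR a ^ 2 / (INR k + INR a) = INR a ^ 3 * / (INR k * (INR k + INR a)) by field; lra.
  have -> : 2 * INR a ^ 3 / INR k ^ 2 = INR a ^ 3 * / (INR k ^ 2 / 2) by field; lra.
  by apply: Rmult_le_compat_l => //; apply: Rinv_le_contravar; nra.
have e2 : INR a ^ 2 / (INR k - INR a) - INR a ^ 2 / INR k <= 2 * INR a ^ 3 / INR k ^ 2.
  have -> : INR a ^ 2 / (INR k - INR a) - INR a ^ 2 / INR k = INR a ^ 3 * / (INR k * (INR k - INR a)) by field; lra.
  have -> : 2 * INR a ^ 3 / INR k ^ 2 = INR a ^ 3 * / (INR k ^ 2 / 2) by field; lra.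
  by apply: Rmult_le_compat_l => //; apply: Rinv_le_contravar; nra.
by split_Rabs; lra.
Qed.

(* The weights of the solutions [(d, u, v)] are nearly functions of [step k d * u] and
   [step k d * v] only. *)
Definition step (k d : nat) : R := sqrt (INR d / sqrt (INR k)).

Lemma step_pos k d : (0 < k)%N -> (0 < d)%N -> 0 < step k d.
Proof.
move=> k0 d0; apply: sqrt_lt_R0; apply: Rdiv_lt_0_compat; first by apply: lt_0_INR; lia.
by apply: sqrt_lt_R0; apply: lt_0_INR; lia.
Qed.

Lemma step_sqr k d : (0 < k)%N -> step k d ^ 2 = INR d / sqrt (INR k).
Proof.
move=> k0; rewrite /step -Rsqr_pow2 Rsqr_sqrt //.
by apply: Rdiv_le_0_compat; [exact: pos_INR | apply: sqrt_lt_R0; apply: lt_0_INR; lia].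
Qed.

Lemma step_pow4 k d : (0 < k)%N -> step k d ^ 4 = INR d ^ 2 / INR k.
Proof.
move=> k0; have k1 : 0 < INR k by apply: lt_0_INR; lia.
have s0 := sqrt_lt_R0 _ k1; have ss := sqrt_sqrt _ (Rlt_le _ _ k1).
have -> : step k d ^ 4 = (step k d ^ 2) ^ 2 by ring.
by rewrite step_sqr // -{2}ss; field; lra.
Qed.

(** The scaled value of [x^2 + y^2]. For [c = true] it is [d^2 (u^4 + v^4) / 2], which separates the
    variables and leads to [Gamma (1 / 4)]; for [c = false] it is the square of the hypotenuse
    [d (u^2 + v^2) / 2], radial in [(u, v)], and leads to powers of pi. *)
Definition energy (c : bool) (X Y : R) : R :=
  if c then (X ^ 4 + Y ^ 4) / 32 else (X ^ 2 + Y ^ 2) ^ 2 / 64.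

Lemma energy_lower c X Y : (X ^ 4 + Y ^ 4) / 64 <= energy c X Y.
Proof.
have p1 : 0 <= X ^ 2 by apply: pow2_ge_0.
have p2 : 0 <= Y ^ 2 by apply: pow2_ge_0.
have -> : X ^ 4 = X ^ 2 * X ^ 2 by ring.
have -> : Y ^ 4 = Y ^ 2 * Y ^ 2 by ring.
have pp := Rmult_le_pos _ _ p1 p1; have qq := Rmult_le_pos _ _ p2 p2.
case: c; last by rewrite /energy; nra.
have -> : energy true X Y = (X ^ 2 * X ^ 2 + Y ^ 2 * Y ^ 2) / 32 by rewrite /energy; field.
by lra.
Qed.

Lemma energy_upper c X Y M : 0 <= X <= M -> 0 <= Y <= M -> energy c X Y <= M ^ 4 / 16.
Proof.
move=> X0 Y0; have X2 : X ^ 2 <= M ^ 2 by apply: pow_incr.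
have Y2 : Y ^ 2 <= M ^ 2 by apply: pow_incr.
have p2 : 0 <= X ^ 2 by apply: pow2_ge_0.
have p3 : 0 <= Y ^ 2 by apply: pow2_ge_0.
case: c; rewrite /energy.
  have -> : X ^ 4 = X ^ 2 * X ^ 2 by ring.
  have -> : Y ^ 4 = Y ^ 2 * Y ^ 2 by ring.
  have -> : M ^ 4 = M ^ 2 * M ^ 2 by ring.
  by nra.
have -> : M ^ 4 = M ^ 2 * M ^ 2 by ring.
by nra.
Qed.

(* The exponent of the Gaussian weight of the solution [(d, u, v)], in scaled coordinates. *)
Lemma energy_leg c k (d i j : nat) : (0 < k)%N -> odd d ->
  INR (leg c d (2 * i + 1) (2 * j + 1)) ^ 2 + (4 * INR (offset d (2 * i + 1) (2 * j + 1))) ^ 2 =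
  16 * INR k * energy c (step k d * od i) (step k d * od j).
Proof.
move=> k0 od_d; have k1 : 0 < INR k by apply: lt_0_INR; lia.
set u := (2 * i + 1)%N; set v := (2 * j + 1)%N.
have ou : odd u by rewrite /u; lia.
have ov : odd v by rewrite /v; lia.
have uR : INR u = od i by rewrite /u plus_INR mult_INR.
have vR : INR v = od j by rewrite /v plus_INR mult_INR.
have offE : (8 * INR (offset d u v)) ^ 2 = (INR d * od i ^ 2 - INR d * od j ^ 2) ^ 2.
  have : (8 * offset d u v = d * u ^ 2 - d * v ^ 2 \/ 8 * offset d u v = d * v ^ 2 - d * u ^ 2)%N /\
     (8 * offset d u v + minn (d * u ^ 2) (d * v ^ 2) = maxn (d * u ^ 2) (d * v ^ 2))%N.
    by have [w [wE ->]] := offset_dvd d ou ov; split; lia.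
  move=> [_]; have [le|le] := leqP (d * u ^ 2) (d * v ^ 2) => /(congr1 INR);
    rewrite plus_INR !mult_INR uR vR => E.
    have -> : 8 * INR (offset d u v) = INR d * od j ^ 2 - INR d * od i ^ 2 by move: E; rewrite /=; lra.
    by ring.
  have -> : 8 * INR (offset d u v) = INR d * od i ^ 2 - INR d * od j ^ 2 by move: E; rewrite /=; lra.
  by ring.
have -> : (4 * INR (offset d u v)) ^ 2 = (8 * INR (offset d u v)) ^ 2 / 4 by field.
rewrite offE; have h4 := step_pow4 d k0; case: c; rewrite /energy.
  have : INR (leg true d u v) = INR d * (od i ^ 2 + od j ^ 2) / 2.
    by have := congr1 INR (odd_leg_true od_d ou ov); rewrite (mult_INR 2) (plus_INR (d * u ^ 2)) !mult_INR uR vR [INR 2]/=; lra.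
  move=> ->; have -> : (step k d * od i) ^ 4 + (step k d * od j) ^ 4 = step k d ^ 4 * (od i ^ 4 + od j ^ 4) by ring.
  by rewrite h4; field; lra.
have -> : INR (leg false d u v) = INR d * od i * od j by rewrite /leg !mult_INR uR vR.
have -> : ((step k d * od i) ^ 2 + (step k d * od j) ^ 2) ^ 2 = step k d ^ 4 * (od i ^ 2 + od j ^ 2) ^ 2 by ring.
by rewrite h4; field; lra.
Qed.

Section Weights.
Variables (c : bool) (wt : nat -> nat -> R) (idx : nat -> nat).
Hypothesis wt_bounds : forall k n, (0 < k)%N -> 0 <= wt k n <= bin_ratio k n.
Hypothesis wt_close : forall k n, (0 < k)%N -> Rabs (wt k n - bin_ratio k n) <= INR n / INR k.
Hypothesis idx_close : forall x, Rabs (4 * INR (idx x) - INR x) <= 3.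

(** Leaving [wt] and [idx] abstract treats both degrees at once: near the centre the weights may
    differ from [bin_ratio] by little, and [idx x] is [x / 4] up to a bounded rounding. *)
Definition weight (k d i j : nat) : R :=
  wt k (idx (leg c d (2 * i + 1) (2 * j + 1))) * bin_ratio k (offset d (2 * i + 1) (2 * j + 1)).

Lemma weight_ge0 k d i j : (0 < k)%N -> 0 <= weight k d i j.
Proof. by move=> k0; apply: Rmult_le_pos; [apply wt_bounds | exact: bin_ratio_ge0]. Qed.

Lemma weight_decay : exists C, 0 < C /\ forall k d i j, (0 < k)%N -> odd d ->
  weight k d i j <= C * (/ (1 + step k d * od i) ^ 4 * / (1 + step k d * od j) ^ 4).
Proof.
have c0 : 0 < / 256 by lra.
have [K [K0 HK]] := @quartic_scaled_decay (/ 256) 4 c0.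
exists (exp 1 * K * K); split; first by apply: Rmult_lt_0_compat => //; apply: Rmult_lt_0_compat => //; exact: exp_pos.
move=> k d i j k0 od_d; have k1 : 1 <= INR k by apply: (le_INR 1); lia.
have E := energy_leg c i j k0 od_d; rewrite /weight.
set x := leg _ _ _ _ in E *; set b := offset _ _ _ in E *.
have d0 : (0 < d)%N by case: (d) od_d.
have h0 := step_pos k0 d0; set X := step k d * od i in E *; set Y := step k d * od j in E *.
have X0 : 0 < X by apply: od_pos.
have Y0 : 0 < Y by apply: od_pos.
apply: (@Rle_trans _ (bin_ratio k (idx x) * bin_ratio k b)).
  by apply: Rmult_le_compat_r; [exact: bin_ratio_ge0 | apply wt_bounds].
apply: (@Rle_trans _ (exp (- (INR (idx x) ^ 2 / (2 * INR k))) * exp (- (INR b ^ 2 / (2 * INR k))))).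
  by apply: Rmult_le_compat; try exact: bin_ratio_ge0; apply: bin_ratio_gauss.
have ix := idx_close x; have x0 := pos_INR x; have n0 := pos_INR (idx x).
(* [idx x] is [x / 4] up to [3 / 4]; giving up half of [x^2 / 16] absorbs the linear term. *)
have n2 : INR x ^ 2 / 32 - 1 <= INR (idx x) ^ 2.
  have [lt|le] := Rle_lt_dec (INR x) 3; first by nra.
  have h : INR x - 3 <= 4 * INR (idx x) by move: ix; split_Rabs; lra.
  have : (INR x - 3) ^ 2 <= (4 * INR (idx x)) ^ 2 by apply: pow_incr; lra.
  by have := pow2_ge_0 (INR x - 6); nra.
have el := energy_lower c X Y.
(* The bounds on squares and the denominators [2 k] leave a quarter of the energy, and
   [energy_lower] contributes [/ 64]. *)
have key : - (INR (idx x) ^ 2 / (2 * INR k)) + - (INR b ^ 2 / (2 * INR k)) <= 1 + - (/ 256 * X ^ 4) + - (/ 256 * Y ^ 4).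
  have b2 := pow2_ge_0 (INR b).
  have S : 16 * INR k * energy c X Y / 32 - 1 <= INR (idx x) ^ 2 + INR b ^ 2 by nra.
  have -> : - (INR (idx x) ^ 2 / (2 * INR k)) + - (INR b ^ 2 / (2 * INR k)) =
    - ((INR (idx x) ^ 2 + INR b ^ 2) / (2 * INR k)) by field; lra.
  have i2 : 0 < / (2 * INR k) by apply: Rinv_0_lt_compat; lra.
  have := Rmult_le_compat_r (/ (2 * INR k)) _ _ (Rlt_le _ _ i2) S.
  have -> : (16 * INR k * energy c X Y / 32 - 1) * / (2 * INR k) = energy c X Y / 4 - / (2 * INR k) by field; lra.
  have : / (2 * INR k) <= / 2 by apply: Rinv_le_contravar; lra.
  by rewrite -/(Rdiv _ _); lra.
rewrite -exp_plus; apply: Rle_trans (exp_le key) _; rewrite !exp_plus.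
have inv_bd Z : 0 < Z -> exp (- (/ 256 * Z ^ 4)) <= K * / (1 + Z) ^ 4.
  move=> Z0; have p : 0 < (1 + Z) ^ 4 by apply: pow_lt; lra.
  apply: (Rmult_le_reg_r ((1 + Z) ^ 4)) => //.
  by rewrite Rmult_assoc Rinv_l; [have := HK Z (Rlt_le _ _ Z0); lra | lra].
have -> : exp 1 * K * K * (/ (1 + X) ^ 4 * / (1 + Y) ^ 4) = exp 1 * (K * / (1 + X) ^ 4) * (K * / (1 + Y) ^ 4) by ring.
have e1 := exp_pos 1.
apply: Rmult_le_compat; [| exact/Rlt_le/exp_pos | | exact: inv_bd].
  by apply: Rmult_le_pos; apply/Rlt_le/exp_pos.
by apply: Rmult_le_compat_l; [lra | exact: inv_bd].
Qed.

(** On the square of side [M] both arguments of the weights are [O(sqrt k)], where every error is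
    [O(1 / sqrt k)]. *)
Lemma weight_limit M e : 0 < M -> 0 < e -> exists k0, forall k d i j, (k0 <= k)%N -> odd d ->
  step k d * od i <= M -> step k d * od j <= M ->
  Rabs (weight k d i j - exp (- energy c (step k d * od i) (step k d * od j))) <= e.
Proof.
move=> M0 e0; pose B := M ^ 2 + 3.
have B3 : 3 <= B by rewrite /B; have := pow2_ge_0 M; lra.
(* [T / sqrt k] is the total of four errors: [B] from [wt_close], [2 B^3] from each of the two
   Gaussian approximations, and [2 B] from replacing [4 * idx x] by [x] in the exponent. *)
pose T := 3 * B + 4 * B ^ 3.
have T0 : 0 < T by rewrite /T; have := pow_lt B 3; lra.
have [k0 Hk0] := INR_unbounded (Rmax (4 * B ^ 2) ((T / e) ^ 2)).
exists k0.+1 => k d i j le od_d XM YM; have kp : (0 < k)%N by lia.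
have k1 : 1 <= INR k by apply: (le_INR 1); lia.
have kk0 : INR k0 <= INR k by apply: le_INR; lia.
have Bk : 4 * B ^ 2 <= INR k by have := Rmax_l (4 * B ^ 2) ((T / e) ^ 2); lra.
have Tk : (T / e) ^ 2 <= INR k by have := Rmax_r (4 * B ^ 2) ((T / e) ^ 2); lra.
set s := sqrt (INR k); have s1 : 1 <= s by rewrite /s -sqrt_1; apply: sqrt_le_1_alt.
have ss : s * s = INR k by apply: sqrt_sqrt; lra.
have sB : 2 * B <= s by nra.
have sT : T / e <= s.
  have te : 0 < T / e by apply: Rdiv_lt_0_compat.
  by nra.
have E := energy_leg c i j kp od_d; rewrite /weight.
set x := leg _ _ _ _ in E *; set b := offset _ _ _ in E *.
have d0 : (0 < d)%N by case: (d) od_d.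
have h0 := step_pos kp d0; set X := step k d * od i in XM E *; set Y := step k d * od j in YM E *.
have X0 : 0 < X by apply: od_pos.
have Y0 : 0 < Y by apply: od_pos.
have eu := @energy_upper c X Y M ltac:(lra) ltac:(lra).
have el := energy_lower c X Y.
have e00 : 0 <= energy c X Y.
  by apply: Rle_trans el; have := pow_lt X 4 X0; have := pow_lt Y 4 Y0; lra.
have x0 := pos_INR x; have b0 := pos_INR b; have ix := idx_close x; have n0 := pos_INR (idx x).
have sum2 : INR x ^ 2 + (4 * INR b) ^ 2 <= (s * M ^ 2) ^ 2.
  by rewrite E -ss; have -> : (s * M ^ 2) ^ 2 = 16 * (s * s) * (M ^ 4 / 16) by [field]; apply: Rmult_le_compat_l; nra.
have m2 := pow2_ge_0 M; have sm : 0 <= s * M ^ 2 by apply: Rmult_le_pos; lra.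
have xs : INR x <= s * M ^ 2 by have := pow2_ge_0 (4 * INR b); nra.
have bs : 4 * INR b <= s * M ^ 2 by have := pow2_ge_0 (INR x); nra.
set n := idx x in ix n0 *.
have nB : INR n <= B * s by move: ix; rewrite /B; split_Rabs; nra.
have bB : INR b <= B * s by rewrite /B; nra.
have n2k : 2 * INR n <= INR k by rewrite -ss; nra.
have b2k : 2 * INR b <= INR k by rewrite -ss; nra.
have p1 := bin_ratio_approx kp n2k; have p2 := bin_ratio_approx kp b2k.
have w1 := wt_close n kp; have w2 := wt_bounds n kp.
have cube z : 0 <= z -> z <= B * s -> 2 * z ^ 3 / INR k ^ 2 <= 2 * B ^ 3 / s.
  move=> z0 zB; have z3 : z ^ 3 <= (B * s) ^ 3 by apply: pow_incr.
  have -> : 2 * B ^ 3 / s = 2 * (B * s) ^ 3 / INR k ^ 2 by rewrite -ss; field; lra.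
  by apply: Rmult_le_compat_r; [apply/Rlt_le/Rinv_0_lt_compat/pow_lt; lra | lra].
have c1 := cube _ n0 nB; have c2 := cube _ b0 bB.
have w3 : INR n / INR k <= B / s.
  have -> : B / s = B * s / INR k by rewrite -ss; field; lra.
  by apply: Rmult_le_compat_r => //; apply/Rlt_le/Rinv_0_lt_compat; lra.
have x1 : 0 <= INR n ^ 2 / INR k by apply: Rdiv_le_0_compat; [exact: pow2_ge_0 | lra].
have x2 : 0 <= INR b ^ 2 / INR k by apply: Rdiv_le_0_compat; [exact: pow2_ge_0 | lra].
have lip := exp_opp_lip (Rplus_le_le_0_compat _ _ x1 x2) e00.
have diff : Rabs (INR n ^ 2 / INR k + INR b ^ 2 / INR k - energy c X Y) <= 2 * B / s.
  have -> : INR n ^ 2 / INR k + INR b ^ 2 / INR k - energy c X Y = (4 * INR n - INR x) * (4 * INR n + INR x) / 16 / INR k.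
    have -> : energy c X Y = (INR x ^ 2 + (4 * INR b) ^ 2) / (16 * INR k) by rewrite E; field; lra.
    by field; lra.
  have -> : 2 * B / s = 2 * (B * s) / INR k by rewrite -ss; field; lra.
  rewrite /Rdiv !Rabs_mult (Rabs_pos_eq (/ INR k)); last by apply/Rlt_le/Rinv_0_lt_compat; lra.
  rewrite (Rabs_pos_eq (/ 16)); last lra.
  rewrite (Rabs_pos_eq (4 * INR n + INR x)); last lra.
  apply: Rmult_le_compat_r; first by apply/Rlt_le/Rinv_0_lt_compat; lra.
  have h : 4 * INR n + INR x <= 8 * (B * s) by move: ix; rewrite /B; split_Rabs; nra.
  have a0 := Rabs_pos (4 * INR n - INR x).
  by have := Rmult_le_compat _ _ _ _ a0 (Rplus_le_le_0_compat _ _ (Rmult_le_pos 4 _ ltac:(lra) n0) x0) ix h; lra.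
rewrite Ropp_plus_distr exp_plus in lip.
set P := exp (- (INR n ^ 2 / INR k)) in p1 lip; set Q := exp (- (INR b ^ 2 / INR k)) in p2 lip.
have Q1 : 0 <= bin_ratio k b <= 1.
  split; first exact: bin_ratio_ge0.
  apply: Rle_trans (bin_ratio_gauss b kp) _; rewrite -exp_0; apply: exp_le.
  by have : 0 <= INR b ^ 2 / (2 * INR k) by [apply: Rdiv_le_0_compat; [exact: pow2_ge_0 | lra]]; lra.
have P1 : 0 <= P <= 1 by split; [exact/Rlt_le/exp_pos | rewrite /P -exp_0; apply: exp_le; lra].
have Te : T / s <= e.
  apply: (Rmult_le_reg_r s); first lra.
  have -> : T / s * s = T by field; lra.
  by have := Rmult_le_compat_r e _ _ (Rlt_le _ _ e0) sT; have -> : T / e * e = T by [field; lra]; lra.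
have TE : T / s = B / s + 2 * B ^ 3 / s + 2 * B ^ 3 / s + 2 * B / s by rewrite /T; field; lra.
have h1 : Rabs (wt k n - P) <= B / s + 2 * B ^ 3 / s by move: w1 p1; split_Rabs; lra.
have h2 : Rabs (bin_ratio k b - Q) <= 2 * B ^ 3 / s by lra.
have -> : wt k n * bin_ratio k b - exp (- energy c X Y) =
  (wt k n - P) * bin_ratio k b + (P * (bin_ratio k b - Q) + (P * Q - exp (- energy c X Y))) by ring.
apply: Rle_trans (Rabs_triang _ _) _; apply: Rle_trans (Rplus_le_compat_l _ _ _ (Rabs_triang _ _)) _.
rewrite (Rabs_mult (wt k n - P)) (Rabs_mult P) (Rabs_pos_eq (bin_ratio k b)); last lra.
rewrite (Rabs_pos_eq P); last lra.
have a1 := Rabs_pos (wt k n - P); have a2 := Rabs_pos (bin_ratio k b - Q).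
have m1 := Rmult_le_compat_l _ _ _ a1 (proj2 Q1); have m3 := Rmult_le_compat_r _ _ _ a2 (proj2 P1).
by lra.
Qed.
End Weights.

(** ** Summation over the squarefree part *)

Lemma sum_inv_sqr_tail (r m : nat) : (0 < r)%N ->
  \rsum_(i < m) (/ INR (r.+1 + i) ^ 2) <= / INR r.
Proof.
move=> r0; have r1 : 1 <= INR r by apply: (le_INR 1); lia.
pose F i := - / INR (r + i).
apply: (@Rle_trans _ (\rsum_(i < m) (F i.+1 - F i))).
  apply: rsum_le => i _; rewrite /F addSn addnS S_INR plus_INR; have i0 := pos_INR i.
  set x := INR r + INR i; have x1 : 1 <= x by rewrite /x; lra.
  have -> : - / (x + 1) - - / x = / (x * (x + 1)) by field; lra.
  by apply: Rinv_le_contravar; nra.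
rewrite rsum_telescope /F addn0.
have : 0 < / INR (r + m) by apply/Rinv_0_lt_compat; rewrite plus_INR; have := pos_INR m; lra.
by lra.
Qed.

Section Assembly.
Variables (g : nat -> nat -> nat -> nat -> R) (E : R -> R -> R) (c C : R).
Hypothesis C0 : 0 < C.
Hypothesis g_ge0 : forall k d i j, (0 < k)%N -> 0 <= g k d i j.
Hypothesis g_decay : forall k d i j, (0 < k)%N -> odd d ->
  g k d i j <= C * (/ (1 + step k d * od i) ^ 4 * / (1 + step k d * od j) ^ 4).
Hypothesis g_limit : forall M e, 0 < M -> 0 < e -> exists k0, forall k d i j, (k0 <= k)%N -> odd d ->
  step k d * od i <= M -> step k d * od j <= M ->
  Rabs (g k d i j - exp (- E (step k d * od i) (step k d * od j))) <= e.
Hypothesis E_decay : forall X Y, 0 < X -> 0 < Y -> exp (- E X Y) <= C * (/ (1 + X) ^ 4 * / (1 + Y) ^ 4).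
Hypothesis E_mean : lattice_mean (fun X Y => exp (- E X Y)) c.

Let L (k : nat) : nat := (20 * k + 20)%N.
Let G (k d : nat) : R := dsum (L k) (g k d).

Lemma inv4_dom X Y : 0 < X -> 0 < Y ->
  / (1 + X) ^ 4 * / (1 + Y) ^ 4 = dom X Y * dom X Y.
Proof. by move=> X0 Y0; rewrite /dom; field; lra. Qed.

Lemma dom_le X Y Z : 0 < Z -> 0 < X -> 0 < Y -> Z <= X \/ Z <= Y -> dom X Y <= / (1 + Z) ^ 2.
Proof.
move=> Z0 X0 Y0; have one W : 0 < W -> 0 < / (1 + W) ^ 2 <= 1.
  move=> W0; split; first by apply/Rinv_0_lt_compat/pow_lt; lra.
  by rewrite -Rinv_1; apply: Rinv_le_contravar; nra.
have mono W : Z <= W -> / (1 + W) ^ 2 <= / (1 + Z) ^ 2.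
  by move=> ZW; apply: Rinv_le_contravar; [apply: pow_lt; lra | apply: pow_incr; lra].
have ox := one _ X0; have oy := one _ Y0; rewrite /dom.
by case=> /mono h; [rewrite -(Rmult_1_r (/ (1 + Z) ^ 2)) | rewrite -(Rmult_1_l (/ (1 + Z) ^ 2))];
  apply: Rmult_le_compat; lra.
Qed.

Lemma slice_ge0 k d : (0 < k)%N -> 0 <= G k d.
Proof. by move=> k0; apply: dsum_ge0 => i j; apply: g_ge0. Qed.

Lemma odd_pos d : odd d -> (0 < d)%N. Proof. by case: d. Qed.

Lemma slice_le_dom k d B : (0 < k)%N -> odd d -> 0 <= B ->
  (forall i j, g k d i j <= B * dom (step k d * od i) (step k d * od j)) ->
  step k d ^ 2 * G k d <= B.
Proof.
move=> k0 od_d B0 H; have h0 := step_pos k0 (odd_pos od_d).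
have := @dsum_approx (step k d) (L k) B (g k d) (fun _ _ => 0) h0 B0.
have -> : dsum (L k) (fun _ _ => 0) = 0 by rewrite /dsum big1 // => i _; rewrite big1.
rewrite Rmult_0_r Rminus_0_r Rabs_pos_eq; last first.
  by apply: Rmult_le_pos; [exact: pow2_ge_0 | exact: slice_ge0].
by apply=> i j; rewrite Rminus_0_r Rabs_pos_eq //; apply: g_ge0.
Qed.

Lemma slice_le_inv k d : (0 < k)%N -> odd d -> step k d ^ 2 * G k d <= C.
Proof.
move=> k0 od_d; have h0 := step_pos k0 (odd_pos od_d).
apply: slice_le_dom => //; first lra.
move=> i j; apply: Rle_trans (g_decay i j k0 od_d) _; have X0 := od_pos i h0; have Y0 := od_pos j h0.
rewrite inv4_dom //; apply: Rmult_le_compat_l; first lra.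
have p := dom_pos (Rlt_le _ _ X0) (Rlt_le _ _ Y0).
have := @dom_le _ _ _ X0 X0 Y0 (or_introl (Rle_refl _)).
have : / (1 + step k d * od i) ^ 2 <= 1 by rewrite -Rinv_1; apply: Rinv_le_contravar; nra.
by nra.
Qed.

(** The lattice starts at distance [step k d] from the axes, so two of the four powers in [g_decay]
    give an extra [step^-2] and the other two ensure summability. As [step^4 = d^2 / k], this bounds
    a slice by [C k / d^2]. *)
Lemma slice_le_inv_sqr k d : (0 < k)%N -> odd d -> step k d ^ 4 * G k d <= C.
Proof.
move=> k0 od_d; have h0 := step_pos k0 (odd_pos od_d).
have h2 : 0 < step k d ^ 2 by apply: pow_lt.
have -> : step k d ^ 4 * G k d = step k d ^ 2 * (step k d ^ 2 * G k d) by ring.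
have : step k d ^ 2 * G k d <= C / step k d ^ 2.
  apply: slice_le_dom => //; first by apply: Rdiv_le_0_compat; lra.
  move=> i j; apply: Rle_trans (g_decay i j k0 od_d) _; have X0 := od_pos i h0; have Y0 := od_pos j h0.
  rewrite inv4_dom //; have p := dom_pos (Rlt_le _ _ X0) (Rlt_le _ _ Y0).
  rewrite /Rdiv Rmult_assoc; apply: Rmult_le_compat_l; first lra.
  apply: Rmult_le_compat_r; first lra.
  have hi : step k d <= step k d * od i by have := od_ge1 i; nra.
  apply: Rle_trans (@dom_le _ _ _ h0 X0 Y0 (or_introl hi)) _.
  by apply: Rinv_le_contravar => //; apply: pow_incr; lra.
move=> h; have := Rmult_le_compat_l _ _ _ (Rlt_le _ _ h2) h.
by have -> : step k d ^ 2 * (C / step k d ^ 2) = C by field; lra.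
Qed.

(** If a coordinate exceeds [M], both functions are at most [C dom^2], where one factor [dom] is
    already small; inside the square [g_limit] applies. The bound on [d] makes the mesh small. *)
Lemma slice_limit e : 0 < e -> exists dl k0, 0 < dl /\ forall k d, (k0 <= k)%N -> odd d ->
  INR d <= dl * sqrt (INR k) -> Rabs (step k d ^ 2 * G k d - c) <= e.
Proof.
move=> e0; have e2 : 0 < e / 2 by lra.
have [h1 [M0 [h10 HM]]] := E_mean e2.
pose M := 2 * C / e + 1.
have M1 : 0 < M by have : 0 < 2 * C / e by [apply: Rdiv_lt_0_compat; lra]; rewrite /M; lra.
have CM : C * / (1 + M) ^ 2 <= e / 2.
  have p : 0 < (1 + M) ^ 2 by apply: pow_lt; lra.
  apply: (Rmult_le_reg_r ((1 + M) ^ 2)) => //.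
  rewrite Rmult_assoc Rinv_l; last lra.
  have h : C = e / 2 * (M - 1) by rewrite /M; field; lra.
  rewrite Rmult_1_r {1}h; apply: Rmult_le_compat_l; first lra.
  by nra.
(* On the square of side [M] the weight [dom] is at least [/ (1 + M) ^ 4], so the uniform error [e']
   suffices there. *)
pose e' := e / 2 * / (1 + M) ^ 4.
have p4 : 0 < (1 + M) ^ 4 by apply: pow_lt; lra.
have e'0 : 0 < e' by apply: Rmult_lt_0_compat => //; apply: Rinv_0_lt_compat.
have [k1 Hk1] := g_limit M1 e'0.
have [k2 Hk2] := INR_unbounded (M0 ^ 2).
exists (h1 ^ 2 / 2), (maxn 1 (maxn k1 k2)); split.
  by have := pow_lt h1 2 h10; lra.
move=> k d; rewrite !geq_max => /and3P [kp kk1 kk2] od_d dk.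
have kR : 1 <= INR k by apply: (le_INR 1); lia.
set s := sqrt (INR k) in dk *; have s1 : 1 <= s by rewrite /s -sqrt_1; apply: sqrt_le_1_alt.
have ss : s * s = INR k by apply: sqrt_sqrt; lra.
have h0 := step_pos kp (odd_pos od_d); have h2 := step_sqr d kp.
rewrite -/s in h2; set h := step k d in h0 h2 *.
have dR : 1 <= INR d by apply: (le_INR 1); have := odd_pos od_d; lia.
have hlt : h < h1.
  have : h ^ 2 <= h1 ^ 2 / 2.
    rewrite h2; apply: (Rmult_le_reg_r s); first lra.
    by have -> : INR d / s * s = INR d by field; lra.
  by have := pow_lt h1 2 h10; nra.
(* [d >= 1] gives [h >= / s], so truncation at [L >= k = s^2] still reaches [s] in scaled
   coordinates. *)
have hL : M0 <= h * INR (L k).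
  have hs : / s <= h.
    have i0 : 0 < / s by apply: Rinv_0_lt_compat; lra.
    have i1 : / s <= 1 by rewrite -Rinv_1; apply: Rinv_le_contravar; lra.
    have : / s <= h ^ 2 by rewrite h2 /Rdiv; nra.
    by nra.
  have LR : INR k <= INR (L k) by apply: le_INR; rewrite /L; lia.
  have M0s : M0 <= s.
    have : INR k2 <= INR k by apply: le_INR; lia.
    by nra.
  apply: (Rle_trans _ s) => //; apply: (Rle_trans _ (/ s * INR k)).
    by rewrite -ss; apply: Req_le; field; lra.
  by apply: Rmult_le_compat; try lra; apply/Rlt_le/Rinv_0_lt_compat; lra.
have lim := HM h (L k) (conj h0 hlt) hL.
have := @dsum_approx h (L k) (e / 2) (g k d) (fun i j => exp (- E (h * od i) (h * od j))) h0 (Rlt_le _ _ e2).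
rewrite -/(G k d) => Happrox.
suff H : Rabs (h ^ 2 * G k d - h ^ 2 * dsum (L k) (fun i j => exp (- E (h * od i) (h * od j)))) <= e / 2.
  by move: lim H; split_Rabs; lra.
apply: Happrox => i j; have X0 := od_pos i h0; have Y0 := od_pos j h0.
have p := dom_pos (Rlt_le _ _ X0) (Rlt_le _ _ Y0).
have off : M <= h * od i \/ M <= h * od j ->
  Rabs (g k d i j - exp (- E (h * od i) (h * od j))) <= e / 2 * dom (h * od i) (h * od j).
  move=> Hor; have b1 := g_decay i j kp od_d; have b2 := E_decay X0 Y0.
  have b3 := g_ge0 d i j kp; have b4 := exp_pos (- E (h * od i) (h * od j)).
  rewrite -/h inv4_dom // in b1; rewrite inv4_dom // in b2.
  have dl := dom_le M1 X0 Y0 Hor.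
  have : C * (dom (h * od i) (h * od j) * dom (h * od i) (h * od j)) <= e / 2 * dom (h * od i) (h * od j).
    rewrite -Rmult_assoc; apply: Rmult_le_compat_r; first lra.
    by apply: Rle_trans CM; apply: Rmult_le_compat_l; lra.
  by move: b1 b2; split_Rabs; lra.
have [Xm|Xm] := Rlt_le_dec (h * od i) M; last by apply: off; left.
have [Ym|Ym] := Rlt_le_dec (h * od j) M; last by apply: off; right.
apply: Rle_trans (Hk1 k d i j kk1 od_d (Rlt_le _ _ Xm) (Rlt_le _ _ Ym)) _.
rewrite /e'; apply: Rmult_le_compat_l; first lra.
have iM Z : 0 < Z -> Z < M -> / (1 + M) ^ 2 <= / (1 + Z) ^ 2.
  by move=> Z0 ZM; apply: Rinv_le_contravar; [apply: pow_lt; lra | apply: pow_incr; lra].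
have -> : / (1 + M) ^ 4 = / (1 + M) ^ 2 * / (1 + M) ^ 2 by field; lra.
have q : 0 <= / (1 + M) ^ 2 by apply/Rlt_le/Rinv_0_lt_compat/pow_lt; lra.
by apply: Rmult_le_compat => //; apply: iM.
Qed.

Let A (k : nat) : R := \rsum_(d < L k | sqfree d && odd d) G k d.

(** Up to [dl * sqrt k] the slices follow their limit. From there to [N] each slice deviates by a
    bounded amount and there are [O(sqrt k)] of them; beyond [N] the tail of [k / d^2] is
    [O(sqrt k)]. The last two ranges form [K]. *)
Lemma slice_sum_near e : 0 < e -> exists K k0, forall k N, (k0 <= k)%N ->
  INR N <= sqrt (INR k) + 1 -> sqrt (INR k) < INR N ->
  Rabs (A k - c * sqrt (INR k) * sqfree_harmonic N) <=
  sqrt (INR k) * (e * sqfree_harmonic N + K).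
Proof.
move=> e0; have [dl [k1 [dl0 HG]]] := slice_limit e0.
pose C' := C + Rabs c; have ac := Rabs_pos c.
exists (2 * C' / dl + 2 * C), (maxn 4 k1) => k N; rewrite geq_max => /andP [k4 kk1] NU NL.
have kp : (0 < k)%N by lia.
have kR : 4 <= INR k by have := le_INR 4 k ltac:(lia); rewrite /=; lra.
set s := sqrt (INR k) in NU NL *.
have s2 : 2 <= s by rewrite /s -(sqrt_pow2 2); [apply: sqrt_le_1_alt; lra | lra].
have ss : s * s = INR k by apply: sqrt_sqrt; lra.
have N2 : (2 < N)%N by apply/ltP; apply: INR_lt; rewrite /=; lra.
have NL' : (N <= L k)%N.
  by apply/leP; apply: INR_le; rewrite /L plus_INR mult_INR /=; nra.
have -> : A k = (\rsum_(d < N | sqfree d && odd d) G k d) +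
   \rsum_(d < L k - N | sqfree (N + d) && odd (N + d)) G k (N + d).
  rewrite /A -(big_mkord (fun d => sqfree d && odd d) (G k)) (big_cat_nat (n := N)) //=.
  rewrite big_mkord -[X in \big[Rplus/0]_(X <= _ < _ | _) _]add0n big_addn big_mkord; congr (_ + _).
  by apply: eq_big => [d|d _]; rewrite addnC.
have dpos (d : nat) : sqfree d && odd d -> 1 <= INR d.
  by move=> /andP [_ /odd_pos d0]; apply: (le_INR 1); lia.
have tail : 0 <= \rsum_(d < L k - N | sqfree (N + d) && odd (N + d)) G k (N + d) <= 2 * C * s.
  split; first by apply: rsum_ge0 => d _; apply: slice_ge0.
  have N1 : N.-1.+1 = N by lia.
  apply: (@Rle_trans _ (C * INR k * (\rsum_(d < L k - N) (/ INR (N.-1.+1 + d) ^ 2)))).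
    rewrite rsum_scal; apply: Rle_trans (@rsum_filter_le (L k - N) (fun d => sqfree (N + d) && odd (N + d)) (fun d => C * INR k * / INR (N.-1.+1 + d) ^ 2) _).
      apply: rsum_le => d Pd; have d1 := dpos _ Pd; move: Pd => /andP [_ od_d].
      rewrite N1; have := slice_le_inv_sqr kp od_d; rewrite step_pow4 // => h.
      have q : 0 < INR (N + d) ^ 2 by apply: pow_lt; lra.
      apply: (Rmult_le_reg_l (INR (N + d) ^ 2 / INR k)); first by apply: Rdiv_lt_0_compat; lra.
      by apply: Rle_trans h _; apply: Req_le; field; lra.
    move=> d; apply: Rmult_le_pos; first by apply: Rmult_le_pos; lra.
    by apply/Rlt_le/Rinv_0_lt_compat/pow_lt/lt_0_INR; lia.
  have t := @sum_inv_sqr_tail N.-1 (L k - N) ltac:(lia).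
  have N1R : INR N = INR N.-1 + 1 by rewrite -S_INR N1.
  have it : / INR N.-1 <= 2 / s.
    have -> : 2 / s = / (s / 2) by field; lra.
    by apply: Rinv_le_contravar; lra.
  have -> : 2 * C * s = C * INR k * (2 / s) by rewrite -ss; field; lra.
  by apply: Rmult_le_compat_l; [apply: Rmult_le_pos; lra | lra].
have head : Rabs ((\rsum_(d < N | sqfree d && odd d) G k d) - c * s * sqfree_harmonic N) <=
   s * (e * sqfree_harmonic N) + INR N * (C' / dl).
  rewrite /sqfree_harmonic rsum_scal rsum_sub.
  apply: Rle_trans (rsum_abs _ _ _) _.
  have -> : s * (e * \rsum_(d < N | sqfree d && odd d) / INR d) = \rsum_(d < N | sqfree d && odd d) (s * e * / INR d).
    by rewrite -Rmult_assoc rsum_scal.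
  have cdl : 0 <= C' / dl by apply: Rdiv_le_0_compat; rewrite /C'; lra.
  apply: (@Rle_trans _ ((\rsum_(d < N | sqfree d && odd d) (s * e * / INR d)) + \rsum_(d < N | sqfree d && odd d) (C' / dl))); last first.
    apply: Rplus_le_compat_l; rewrite -rsum_const.
    exact: (@rsum_filter_le N (fun d => sqfree d && odd d) (fun=> C' / dl)).
  rewrite -big_split /=; apply: rsum_le => d Pd; have d1 := dpos _ Pd; move: Pd => /andP [_ od_d].
  have sd : 0 < s / INR d by apply: Rdiv_lt_0_compat; lra.
  have st := step_sqr d kp; rewrite -/s in st.
  have -> : G k d - c * s * / INR d = s / INR d * (step k d ^ 2 * G k d - c) by rewrite st; field; lra.
  rewrite Rabs_mult (Rabs_pos_eq (s / INR d)); last lra.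
  have i1 : 0 <= s * e * / INR d by apply: Rmult_le_pos; [apply: Rmult_le_pos; lra | apply/Rlt_le/Rinv_0_lt_compat; lra].
  have [le|lt] := Rle_lt_dec (INR d) (dl * s).
    have := HG k d kk1 od_d le => h.
    have := Rmult_le_compat_l _ _ _ (Rlt_le _ _ sd) h.
    by have -> : s / INR d * e = s * e * / INR d by [field; lra]; lra.
  have h1 : s / INR d <= / dl.
    apply: (Rmult_le_reg_r (INR d * dl)); first by apply: Rmult_lt_0_compat; lra.
    have -> : s / INR d * (INR d * dl) = dl * s by field; lra.
    by have -> : / dl * (INR d * dl) = INR d by [field; lra]; lra.
  have h2 : Rabs (step k d ^ 2 * G k d - c) <= C'.
    have u := slice_le_inv kp od_d; have l : 0 <= step k d ^ 2 * G k d.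
      by apply: Rmult_le_pos; [exact: pow2_ge_0 | exact: slice_ge0].
    by rewrite /C'; split_Rabs; lra.
  have h3 : s / INR d * Rabs (step k d ^ 2 * G k d - c) <= / dl * C'.
    by apply: Rmult_le_compat => //; [lra | exact: Rabs_pos].
  by rewrite Rmult_comm in h3; rewrite /Rdiv; rewrite /Rdiv in h3; lra.
have cdl : 0 <= C' / dl by apply: Rdiv_le_0_compat; rewrite /C'; lra.
have NC : INR N * (C' / dl) <= 2 * s * (C' / dl) by apply: Rmult_le_compat_r; lra.
have -> : s * (e * sqfree_harmonic N + (2 * C' / dl + 2 * C)) = s * (e * sqfree_harmonic N) + 2 * s * (C' / dl) + 2 * C * s by field; lra.
by move: head tail; split_Rabs; lra.
Qed.

(** The density [4 / PI ^ 2] is halved because the logarithm is that of [sqrt k]. *)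
Lemma slice_sum_limit : is_lim_seq (fun k => A k / (sqrt (INR k) * ln (INR k))) (2 * c / PI ^ 2).
Proof.
apply is_lim_seq_spec => eps; have e0 := cond_pos eps.
have pi0 := PI_RGT_0; have p2 : 0 < PI ^ 2 by apply: pow_lt.
have pi1 : 1 <= PI ^ 2 by have := PI2_1; nra.
have ac := Rabs_pos c.
(* In [6 + Rabs c], the bound [D <= 5 * l] below accounts for 5, the error in the harmonic sum for
   [Rabs c], and the rest is slack. *)
pose q := eps / (8 * (6 + Rabs c)).
have q0 : 0 < q by apply: Rdiv_lt_0_compat; lra.
have [K [k1 HA]] := slice_sum_near q0.
(* The minimum with [1] also yields the crude bound [D <= 5 * l], as [4 / PI ^ 2 <= 4]. *)
have [N0 HN] := sqfree_harmonic_asymp (Rmin_glb_lt _ _ _ q0 Rlt_0_1).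
pose K' := Rabs K + 4 * Rabs c + 1; have K0 := Rabs_pos K.
have K'0 : 0 < K' by rewrite /K'; lra.
have [k2 Hk2] := INR_unbounded (exp (4 * K' / eps)).
exists (maxn 9 (maxn k1 (maxn (N0 * N0) k2))) => k /leP; rewrite !geq_max => /and4P [k9 kk1 kN0 kk2].
have kR : 9 <= INR k by have := le_INR 9 k ltac:(lia); rewrite /=; lra.
set s := sqrt (INR k).
have s3 : 3 <= s by rewrite /s -(sqrt_pow2 3); [apply: sqrt_le_1_alt; lra | lra].
have ss : s * s = INR k by apply: sqrt_sqrt; lra.
pose N := (Nat.sqrt k).+1.
have [Nl Nu] : (Nat.sqrt k * Nat.sqrt k <= k /\ k < N * N)%coq_nat by have := Nat.sqrt_spec k ltac:(lia); rewrite /N.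
have NR1 : s < INR N.
  have : INR k < INR N * INR N by rewrite -mult_INR; apply: lt_INR.
  by have := pos_INR N; nra.
have NR2 : INR N <= s + 1.
  rewrite /N S_INR; apply: Rplus_le_compat_r.
  have : INR (Nat.sqrt k) * INR (Nat.sqrt k) <= INR k by rewrite -mult_INR; apply: le_INR.
  by have := pos_INR (Nat.sqrt k); nra.
have NN0 : (N0 <= N)%N by rewrite leqNgt; apply/negP => lt; nia.
have H1 := HA k N kk1 NR2 NR1; have H2 := HN N NN0; rewrite -/s in H1.
set D := sqfree_harmonic N in H1 H2.
set l := ln (INR k).
have lE : l = 2 * ln s by rewrite /l -ss ln_mult; lra.
have ls1 : 1 <= ln s.
  by rewrite -(ln_exp 1); apply: Rcomplements.ln_le; [exact: exp_pos | have := exp_le_3; lra].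
have lN1 : ln s <= ln (INR N) by apply: Rcomplements.ln_le; lra.
have lN2 : ln (INR N) <= ln s + 1.
  have -> : ln s + 1 = ln (s * exp 1) by rewrite ln_mult ?ln_exp //; [lra | exact: exp_pos].
  by apply: Rcomplements.ln_le; [lra | have := exp_ineq1 1 ltac:(lra); nra].
set lN := ln (INR N) in H2 lN1 lN2.
have i2 : 0 < 4 / PI ^ 2 <= 4.
  split; first by apply: Rdiv_lt_0_compat; lra.
  apply: (Rmult_le_reg_r (PI ^ 2)) => //.
  by have -> : 4 / PI ^ 2 * PI ^ 2 = 4 by [field; lra]; lra.
have qm1 := Rmin_l q 1; have qm2 := Rmin_r q 1.
have lNl : lN <= l by lra.
have H2a : Rabs (D - 4 / PI ^ 2 * lN) <= q * lN by apply: Rle_trans H2 _; apply: Rmult_le_compat_r; lra.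
have Db : D <= 5 * l.
  have : Rabs (D - 4 / PI ^ 2 * lN) <= lN by apply: Rle_trans H2 _; have := Rmult_le_compat_r lN _ _ ltac:(lra) qm2; lra.
  have : 4 / PI ^ 2 * lN <= 4 * l by apply: Rmult_le_compat; lra.
  by split_Rabs; lra.
have D0 : 0 <= D.
  apply: rsum_ge0 => d /andP [_ /odd_pos d0]; apply/Rlt_le/Rinv_0_lt_compat/lt_0_INR; lia.
have H3 : Rabs (A k - c * s * (2 / PI ^ 2 * l)) <= s * (q * (6 + Rabs c) * l + K').
  have e1 : A k - c * s * (2 / PI ^ 2 * l) = (A k - c * s * D) + c * s * ((D - 4 / PI ^ 2 * lN) + 4 / PI ^ 2 * (lN - ln s)).
    by rewrite lE; field; lra.
  rewrite e1; apply: Rle_trans (Rabs_triang _ _) _.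
  rewrite Rabs_mult (Rabs_mult c s) (Rabs_pos_eq s); last lra.
  have t1 : Rabs (D - 4 / PI ^ 2 * lN + 4 / PI ^ 2 * (lN - ln s)) <= q * l + 4.
    apply: Rle_trans (Rabs_triang _ _) _; apply: Rplus_le_compat.
      by apply: Rle_trans H2a _; apply: Rmult_le_compat_l; lra.
    rewrite Rabs_mult !Rabs_pos_eq; try lra.
    by rewrite -(Rmult_1_r 4) -/(Rdiv _ _); apply: Rmult_le_compat; lra.
  have t2 : Rabs c * s * Rabs (D - 4 / PI ^ 2 * lN + 4 / PI ^ 2 * (lN - ln s)) <= Rabs c * s * (q * l + 4).
    by apply: Rmult_le_compat_l => //; apply: Rmult_le_pos; lra.
  have t3 : s * (q * D + K) <= s * (q * (5 * l) + Rabs K).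
    apply: Rmult_le_compat_l; first lra.
    by apply: Rplus_le_compat; [apply: Rmult_le_compat_l; lra | exact: Rle_abs].
  have t4 : 0 <= s * (q * l + 1) by apply: Rmult_le_pos; [lra | have := Rmult_le_pos q l ltac:(lra) ltac:(lra); lra].
  by rewrite /K'; lra.
have sl : 0 < s * l by apply: Rmult_lt_0_compat; lra.
have -> : A k / (s * l) - 2 * c / PI ^ 2 = (A k - c * s * (2 / PI ^ 2 * l)) / (s * l) by field; lra.
rewrite /Rdiv Rabs_mult (Rabs_pos_eq (/ (s * l))); last by apply/Rlt_le/Rinv_0_lt_compat.
apply: (Rmult_lt_reg_r (s * l)) => //; rewrite Rmult_assoc Rinv_l; last lra.
rewrite Rmult_1_r; apply: Rle_lt_trans H3 _.
have qe : q * (6 + Rabs c) = eps / 8 by rewrite /q; field; lra.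
have Kl : K' <= eps / 4 * l.
  have : 4 * K' / eps <= l.
    rewrite -(ln_exp (4 * K' / eps)); apply: Rcomplements.ln_le; first exact: exp_pos.
    by have : INR k2 <= INR k by [apply: le_INR; lia]; lra.
  move=> h; have := Rmult_le_compat_l (eps / 4) _ _ ltac:(lra) h.
  by have -> : eps / 4 * (4 * K' / eps) = K' by field; lra.
rewrite qe; have : eps / 8 * l + K' < eps * l by have := Rmult_lt_0_compat eps l e0 ltac:(lra); lra.
by move=> h; have := Rmult_lt_compat_l s _ _ ltac:(lra) h; lra.
Qed.
End Assembly.

(** ** The limits *)

(* In degree 8k the first factor is 'C(2k, k + n) / 'C(2k, k); in degree 8k - 2 it is
   2 * 'C(2k - 1, k + n) / 'C(2k, k), with [n] the nearest integer to x / 4 in the first case and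
   its floor in the second. *)
Definition wt0 (k n : nat) : R := bin_ratio k n.
Definition wt2 (k n : nat) : R := bin_ratio k n * (1 - INR n / INR k).
Definition idx0 (x : nat) : nat := uphalf x./2.
Definition idx2 (x : nat) : nat := x./2./2.

Lemma idx0_close x : Rabs (4 * INR (idx0 x) - INR x) <= 3.
Proof.
have le1 : INR (4 * idx0 x) <= INR (x + 3) by apply: le_INR; rewrite /idx0; lia.
have le2 : INR x <= INR (4 * idx0 x + 3) by apply: le_INR; rewrite /idx0; lia.
rewrite (mult_INR 4) (plus_INR x 3) in le1; rewrite (plus_INR (4 * _) 3) (mult_INR 4) in le2.
by move: le1 le2; rewrite [INR 4]/= [INR 3]/=; split_Rabs; lra.
Qed.

Lemma idx2_close x : Rabs (4 * INR (idx2 x) - INR x) <= 3.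
Proof.
have le1 : INR (4 * idx2 x) <= INR (x + 3) by apply: le_INR; rewrite /idx2; lia.
have le2 : INR x <= INR (4 * idx2 x + 3) by apply: le_INR; rewrite /idx2; lia.
rewrite (mult_INR 4) (plus_INR x 3) in le1; rewrite (plus_INR (4 * _) 3) (mult_INR 4) in le2.
by move: le1 le2; rewrite [INR 4]/= [INR 3]/=; split_Rabs; lra.
Qed.

Lemma wt0_bounds k n : (0 < k)%N -> 0 <= wt0 k n <= bin_ratio k n.
Proof. by move=> _; have := bin_ratio_ge0 k n; rewrite /wt0; lra. Qed.

Lemma wt0_close k n : (0 < k)%N -> Rabs (wt0 k n - bin_ratio k n) <= INR n / INR k.
Proof.
move=> k0; rewrite /wt0 Rminus_eq_0 Rabs_R0.
by apply: Rdiv_le_0_compat; [exact: pos_INR | apply: lt_0_INR; lia].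
Qed.

Lemma wt2_factor k n : (0 < k)%N -> (n <= k)%N -> 0 <= INR n / INR k <= 1.
Proof.
move=> k0 nk; have k1 : 0 < INR k by apply: lt_0_INR; lia.
have n1 : INR n <= INR k by apply: le_INR; lia.
split; first by apply: Rdiv_le_0_compat => //; exact: pos_INR.
by apply: (Rmult_le_reg_r (INR k)) => //; have -> : INR n / INR k * INR k = INR n by [field; lra]; lra.
Qed.

Lemma wt2_bounds k n : (0 < k)%N -> 0 <= wt2 k n <= bin_ratio k n.
Proof.
move=> k0; rewrite /wt2; have [nk|kn] := leqP n k; last by rewrite bin_ratio_big //; lra.
by have := wt2_factor k0 nk; have := bin_ratio_ge0 k n; nra.
Qed.

Lemma wt2_close k n : (0 < k)%N -> Rabs (wt2 k n - bin_ratio k n) <= INR n / INR k.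
Proof.
move=> k0; rewrite /wt2; have [nk|kn] := leqP n k; last first.
  rewrite bin_ratio_big // Rmult_0_l Rminus_eq_0 Rabs_R0.
  by apply: Rdiv_le_0_compat; [exact: pos_INR | apply: lt_0_INR; lia].
have f := wt2_factor k0 nk; have p := bin_ratio_ge0 k n.
have p1 : bin_ratio k n <= 1.
  apply: Rle_trans (bin_ratio_gauss n k0) _; rewrite -exp_0; apply: exp_le.
  have : 0 <= INR n ^ 2 / (2 * INR k); last by lra.
  by apply: Rdiv_le_0_compat; [exact: pow2_ge_0 | have := lt_0_INR k ltac:(lia); lra].
have -> : bin_ratio k n * (1 - INR n / INR k) - bin_ratio k n = - (bin_ratio k n * (INR n / INR k)) by ring.
by rewrite Rabs_Ropp Rabs_pos_eq; nra.
Qed.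

Definition mean_const (c : bool) : R :=
  if c then Gamma (1 / 4) ^ 2 * sqrt 2 / 16 else PI * sqrt PI / 4.

Lemma energy_mean c : lattice_mean (fun X Y => exp (- energy c X Y)) (mean_const c).
Proof. by case: c; [exact: lattice_mean_R | exact: lattice_mean_S]. Qed.

Lemma energy_decay c : exists C, 0 < C /\ forall X Y, 0 < X -> 0 < Y ->
  exp (- energy c X Y) <= C * (/ (1 + X) ^ 4 * / (1 + Y) ^ 4).
Proof.
have c0 : 0 < / 64 by lra.
have [K [K0 HK]] := @quartic_scaled_decay (/ 64) 4 c0.
exists (K * K); split; first exact: Rmult_lt_0_compat.
move=> X Y X0 Y0; have el := energy_lower c X Y.
apply: (@Rle_trans _ (exp (- (/ 64 * X ^ 4)) * exp (- (/ 64 * Y ^ 4)))).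
  by rewrite -exp_plus; apply: exp_le; lra.
have inv_bd Z : 0 < Z -> exp (- (/ 64 * Z ^ 4)) <= K * / (1 + Z) ^ 4.
  move=> Z0; have p : 0 < (1 + Z) ^ 4 by apply: pow_lt; lra.
  apply: (Rmult_le_reg_r ((1 + Z) ^ 4)) => //.
  by rewrite Rmult_assoc Rinv_l; [have := HK Z (Rlt_le _ _ Z0); lra | lra].
have -> : K * K * (/ (1 + X) ^ 4 * / (1 + Y) ^ 4) = (K * / (1 + X) ^ 4) * (K * / (1 + Y) ^ 4) by ring.
by apply: Rmult_le_compat; [exact/Rlt_le/exp_pos | exact/Rlt_le/exp_pos | exact: inv_bd | exact: inv_bd].
Qed.

Definition total (c : bool) (wt : nat -> nat -> R) (idx : nat -> nat) (k : nat) : R :=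
  \rsum_(d < (20 * k + 20)%N | sqfree d && odd d) dsum (20 * k + 20)%N (weight c wt idx k d).

Lemma total_limit c wt idx :
  (forall k n, (0 < k)%N -> 0 <= wt k n <= bin_ratio k n) ->
  (forall k n, (0 < k)%N -> Rabs (wt k n - bin_ratio k n) <= INR n / INR k) ->
  (forall x, Rabs (4 * INR (idx x) - INR x) <= 3) ->
  is_lim_seq (fun k => total c wt idx k / (sqrt (INR k) * ln (INR k))) (2 * mean_const c / PI ^ 2).
Proof.
move=> wb wc ic.
have [C1 [C10 H1]] := weight_decay c wb wc ic.
have [C2 [C20 H2]] := energy_decay c.
have C0 : 0 < C1 + C2 by lra.
have ip X Y : 0 < X -> 0 < Y -> 0 <= / (1 + X) ^ 4 * / (1 + Y) ^ 4.
  by move=> X0 Y0; apply: Rmult_le_pos; apply/Rlt_le/Rinv_0_lt_compat/pow_lt; lra.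
apply: (slice_sum_limit C0 (g := weight c wt idx) (E := energy c)).
- by move=> k d i j k0; apply: weight_ge0.
- move=> k d i j k0 od_d; apply: Rle_trans (H1 k d i j k0 od_d) _.
  have h0 := step_pos k0 (odd_pos od_d).
  by apply: Rmult_le_compat_r; [apply: ip; exact: od_pos | lra].
- by move=> M e; apply: weight_limit.
- move=> X Y X0 Y0; apply: Rle_trans (H2 X Y X0 Y0) _.
  by apply: Rmult_le_compat_r; [exact: ip | lra].
exact: energy_mean.
Qed.

Lemma bin_ratioE k n : INR 'C(2 * k, k + n) = INR 'C(2 * k, k) * bin_ratio k n.
Proof. by rewrite /bin_ratio; field; have := central_bin_pos k; lra. Qed.

(** ['C(2k - 1, k + n)] is [(k - n) / (2 k)] times ['C(2k, k + n)]. The factor [/ 2] is the ratio in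
    (b), since [wt2] and [wt0] lead to the same limit of [total]. *)
Lemma wt2_bin k n : (0 < k)%N -> INR 'C((2 * k).-1, k + n) = / 2 * INR 'C(2 * k, k) * wt2 k n.
Proof.
move=> k0; have k1 : 0 < INR k by apply: lt_0_INR; lia.
have [nk|kn] := leqP n k; last first.
  by rewrite bin_small ?/wt2 ?bin_ratio_big //=; [ring | lia].
have := congr1 INR (mul_bin_down (2 * k) (k + n)).
have -> : (2 * k - (k + n))%N = (k - n)%N by lia.
rewrite !mult_INR minus_INR ?bin_ratioE; last by lia.
rewrite /wt2 [INR 2]/= => E.
apply: (Rmult_eq_reg_l ((1 + 1) * INR k)); last lra.
by rewrite E; field; lra.
Qed.

Lemma card_8k_total c k : (0 < k)%N ->
  INR #|twisted_set (sgnb c) (4 * k)| = INR 'C(2 * k, k) ^ 2 * total c wt0 idx0 k.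
Proof.
move=> k0; rewrite card_twisted_set_8k // rsum_INR /total rsum_scal; apply: eq_bigr => d _.
rewrite dsum_scal rsum_INR; apply: eq_bigr => i _; rewrite rsum_INR; apply: eq_bigr => j _.
by rewrite mult_INR !bin_ratioE /weight /wt0 /idx0 /=; ring.
Qed.

Lemma card_8k2_total c k : (0 < k)%N ->
  INR #|twisted_set (sgnb c) (4 * k).-1| = / 2 * INR 'C(2 * k, k) ^ 2 * total c wt2 idx2 k.
Proof.
move=> k0; rewrite card_twisted_set_8k2 // rsum_INR /total rsum_scal; apply: eq_bigr => d _.
rewrite dsum_scal rsum_INR; apply: eq_bigr => i _; rewrite rsum_INR; apply: eq_bigr => j _.
by rewrite mult_INR wt2_bin // bin_ratioE /weight /idx2 /=; ring.
Qed.

Lemma wallis_limit : is_lim_seq (fun k => INR k * INR 'C(2 * k, k) ^ 2 / 16 ^ k) (/ PI).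
Proof.
have pi0 := PI_RGT_0; have ip : 0 < / PI by apply: Rinv_0_lt_compat.
have ip1 : / PI <= 1 by rewrite -Rinv_1; apply: Rinv_le_contravar; have := PI2_1; lra.
apply is_lim_seq_spec => eps; have e0 := cond_pos eps.
have [k0 Hk0] := INR_unbounded (/ eps); exists k0.+1 => k /leP le.
have kp : (0 < k)%N by lia.
have [w1 w2] := wallis_bounds kp; have kk : INR k0 <= INR k by apply: le_INR; lia.
have h : / (2 * INR k + 1) < eps.
  rewrite -(Rinv_inv eps); apply: Rinv_lt_contravar; last by have := Rinv_0_lt_compat _ e0; lra.
  by apply: Rmult_lt_0_compat; [exact: Rinv_0_lt_compat | have := pos_INR k; lra].
have h0 : 0 < / (2 * INR k + 1) by apply: Rinv_0_lt_compat; have := pos_INR k; lra.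
by split_Rabs; nra.
Qed.

Lemma scale_pos n : (2 <= n)%N -> 0 < scale n.
Proof.
move=> n2; have nR : 2 <= INR n by have := le_INR 2 n ltac:(lia); rewrite /=; lra.
apply: Rdiv_lt_0_compat; last by apply: sqrt_lt_R0; lra.
apply: Rmult_lt_0_compat; first by apply: pow_lt; lra.
by rewrite -ln_1; apply: ln_increasing; lra.
Qed.

(** Wallis contributes [/ PI] and turns [sqrt k * ln k] into [16^k * ln k / sqrt k]. *)
Lemma scale_quotient c wt idx (f : nat -> R) a :
  (forall k n, (0 < k)%N -> 0 <= wt k n <= bin_ratio k n) ->
  (forall k n, (0 < k)%N -> Rabs (wt k n - bin_ratio k n) <= INR n / INR k) ->
  (forall x, Rabs (4 * INR (idx x) - INR x) <= 3) ->
  (forall k, (0 < k)%N -> f k = a * INR 'C(2 * k, k) ^ 2 * total c wt idx k) ->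
  is_lim_seq (fun k => f k / scale k) (a * (2 * mean_const c / PI ^ 3)).
Proof.
move=> wb wc ic fE; have pi0 := PI_RGT_0.
have -> : a * (2 * mean_const c / PI ^ 3) = a * (/ PI * (2 * mean_const c / PI ^ 2)) by field; lra.
have lim := is_lim_seq_mult' _ _ _ _ wallis_limit (@total_limit c wt idx wb wc ic).
apply: (is_lim_seq_ext_loc _ _ _ _ (is_lim_seq_scal_l _ a _ lim)).
exists 2%N => k /leP k2; have kp : (0 < k)%N by lia.
have kR : 2 <= INR k by have := le_INR 2 k ltac:(lia); rewrite /=; lra.
have s0 : 0 < sqrt (INR k) by apply: sqrt_lt_R0; lra.
have l0 : 0 < ln (INR k) by rewrite -ln_1; apply: ln_increasing; lra.
have p16 : 0 < 16 ^ k by apply: pow_lt; lra.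
rewrite fE // /scale; have ss : sqrt (INR k) * sqrt (INR k) = INR k by apply: sqrt_sqrt; lra.
by rewrite -{1}ss; field; lra.
Qed.

Lemma asymp_limit (f : nat -> R) l : 0 < l -> is_lim_seq (fun k => f k / scale k) l -> asymp f scale.
Proof.
move=> l0 /is_lim_seq_spec H; have l2 : 0 < l / 2 by lra.
have [N HN] := H (mkposreal _ l2).
exists (l / 2), (2 * l), (maxn 2 N); split=> //; split; first by lra.
move=> n; rewrite geq_max => /andP [n2 nN].
have s0 := scale_pos n2; have h : Rabs (f n / scale n - l) < l / 2 := HN n (elimT leP nN).
have fq : f n = f n / scale n * scale n by field; lra.
by rewrite fq; split; apply: Rmult_le_compat_r; move: h; split_Rabs; lra.
Qed.

Lemma Gamma_quarter_pos : 0 < Gamma (1 / 4).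
Proof.
have [K [K0 HK]] := @quartic_scaled_decay 1 2 Rlt_0_1.
have qpos x : 0 <= x -> 0 <= quartic x by move=> _; apply/Rlt_le/exp_pos.
have [|I [HI I0]] := int_conv_exists quartic_cont qpos (K := K).
  by move=> r r0; have := HK r r0; rewrite Rmult_1_l.
have q1 : 0 < quartic 1 by exact: exp_pos.
have [M HM] := HI (quartic 1 / 2) ltac:(lra).
have [b1 _] := @RInt_decr_bounds quartic quartic_cont quartic_decr 0 1 ltac:(lra).
have m1 := Rmax_r M 1.
have b2 : 0 <= RInt quartic 1 (Rmax M 1).
  by apply: RInt_ge_0 => //; [apply: ex_RInt_cont; exact: quartic_cont | move=> x _; exact/Rlt_le/exp_pos].
have := HM (Rmax M 1) (Rmax_l _ _); rewrite (RInt_split quartic_cont 0 1) (Gamma_quarter HI).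
by split_Rabs; lra.
Qed.

Lemma cardR_total k : (0 < k)%N ->
  INR (cardR (8 * k)) = 1 * INR 'C(2 * k, k) ^ 2 * total true wt0 idx0 k.
Proof.
move=> k0; have -> : (8 * k = 2 * (4 * k))%N by lia.
by rewrite cardR_twisted_set (card_8k_total true k0); ring.
Qed.

Lemma cardS_total k : (0 < k)%N ->
  INR (cardS (8 * k)) = 1 * INR 'C(2 * k, k) ^ 2 * total false wt0 idx0 k.
Proof.
move=> k0; have -> : (8 * k = 2 * (4 * k))%N by lia.
by rewrite cardS_twisted_set (card_8k_total false k0); ring.
Qed.

Lemma cardR2_total k : (0 < k)%N ->
  INR (cardR (8 * k - 2)) = / 2 * INR 'C(2 * k, k) ^ 2 * total true wt2 idx2 k.
Proof.
move=> k0; have -> : (8 * k - 2 = 2 * (4 * k).-1)%N by lia.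
by rewrite cardR_twisted_set (card_8k2_total true k0).
Qed.

Lemma cardS2_total k : (0 < k)%N ->
  INR (cardS (8 * k - 2)) = / 2 * INR 'C(2 * k, k) ^ 2 * total false wt2 idx2 k.
Proof.
move=> k0; have -> : (8 * k - 2 = 2 * (4 * k).-1)%N by lia.
by rewrite cardS_twisted_set (card_8k2_total false k0).
Qed.

Lemma cardR_limit : is_lim_seq (fun n => INR (cardR (8 * n)) / scale n)
  (Gamma (1 / 4) ^ 2 / (4 * sqrt 2 * PI ^ 3)).
Proof.
have pi0 := PI_RGT_0; have s0 : 0 < sqrt 2 by apply: sqrt_lt_R0; lra.
have ss : sqrt 2 * sqrt 2 = 2 by apply: sqrt_sqrt; lra.
have -> : Gamma (1 / 4) ^ 2 / (4 * sqrt 2 * PI ^ 3) = 1 * (2 * mean_const true / PI ^ 3).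
  transitivity (Gamma (1 / 4) ^ 2 * (sqrt 2 * sqrt 2) / (8 * sqrt 2 * PI ^ 3)).
    by rewrite ss; field; lra.
  by rewrite /mean_const; field; lra.
exact: scale_quotient wt0_bounds wt0_close idx0_close cardR_total.
Qed.

Lemma cardS_limit : is_lim_seq (fun n => INR (cardS (8 * n)) / scale n)
  (1 / (2 * (PI * sqrt PI))).
Proof.
have pi0 := PI_RGT_0; have s0 : 0 < sqrt PI by apply: sqrt_lt_R0; lra.
have ss : sqrt PI * sqrt PI = PI by apply: sqrt_sqrt; lra.
have -> : 1 / (2 * (PI * sqrt PI)) = 1 * (2 * mean_const false / PI ^ 3).
  transitivity (sqrt PI * sqrt PI / (2 * (PI ^ 2 * sqrt PI))).
    by rewrite ss; field; lra.
  by rewrite /mean_const; field; lra.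
exact: scale_quotient wt0_bounds wt0_close idx0_close cardS_total.
Qed.

Lemma half_limit (f f2 : nat -> R) l : l <> 0 -> is_lim_seq (fun n => f n / scale n) l ->
  is_lim_seq (fun n => f2 n / scale n) (/ 2 * l) -> is_lim_seq (fun n => f2 n / (1 / 2 * f n)) 1.
Proof.
move=> l0 H H2.
have := is_lim_seq_div' _ _ _ _ H2 (is_lim_seq_scal_l _ (/ 2) _ H).
have -> : / 2 * l / (/ 2 * l) = 1 by field.
move=> /(_ ltac:(lra)); apply: is_lim_seq_ext_loc; exists 2%N => n /leP n2.
have s0 := scale_pos n2.
(* As [/ 0 = 0], both quotients are [0] when [f n] vanishes. *)
have [->|fn] := Req_dec (f n) 0; first by rewrite /Rdiv !(Rmult_0_l, Rmult_0_r, Rinv_0).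
by field; lra.
Qed.

Lemma half_card_limit c f f2 (l : R) :
  (forall k, (0 < k)%N -> f k = 1 * INR 'C(2 * k, k) ^ 2 * total c wt0 idx0 k) ->
  (forall k, (0 < k)%N -> f2 k = / 2 * INR 'C(2 * k, k) ^ 2 * total c wt2 idx2 k) ->
  is_lim_seq (fun n => f n / scale n) l -> is_lim_seq (fun n => f2 n / scale n) (/ 2 * l).
Proof.
move=> Hf Hf2 lim.
have E := scale_quotient wt0_bounds wt0_close idx0_close Hf.
have : Rbar.Finite l = Rbar.Finite (1 * (2 * mean_const c / PI ^ 3)).
  by rewrite -(is_lim_seq_unique _ _ lim) -(is_lim_seq_unique _ _ E).
case=> ->; rewrite Rmult_1_l.
exact: scale_quotient wt2_bounds wt2_close idx2_close Hf2.
Qed.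

Lemma cardR_const_pos : 0 < Gamma (1 / 4) ^ 2 / (4 * sqrt 2 * PI ^ 3).
Proof.
have pi0 := PI_RGT_0; have g0 := Gamma_quarter_pos.
have s20 : 0 < sqrt 2 by apply: sqrt_lt_R0; lra.
apply: Rdiv_lt_0_compat; first exact: pow_lt.
by apply: Rmult_lt_0_compat; [lra | exact: pow_lt].
Qed.

Lemma cardS_const_pos : 0 < 1 / (2 * (PI * sqrt PI)).
Proof.
have pi0 := PI_RGT_0; have sp0 : 0 < sqrt PI by apply: sqrt_lt_R0; lra.
by apply: Rdiv_lt_0_compat; [lra | have := Rmult_lt_0_compat _ _ pi0 sp0; lra].
Qed.

Lemma asymp_cardR : asymp (fun n => INR (cardR (8 * n))) scale.
Proof. exact: asymp_limit cardR_const_pos cardR_limit. Qed.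

Lemma asymp_cardS : asymp (fun n => INR (cardS (8 * n))) scale.
Proof. exact: asymp_limit cardS_const_pos cardS_limit. Qed.

Lemma asymp_cardR2 : asymp (fun n => INR (cardR (8 * n - 2))) scale.
Proof.
apply: asymp_limit (half_card_limit cardR_total cardR2_total cardR_limit).
by have := cardR_const_pos; lra.
Qed.

Lemma asymp_cardS2 : asymp (fun n => INR (cardS (8 * n - 2))) scale.
Proof.
apply: asymp_limit (half_card_limit cardS_total cardS2_total cardS_limit).
by have := cardS_const_pos; lra.
Qed.

Lemma cardR2_half :
  is_lim_seq (fun n => INR (cardR (8 * n - 2)) / (1 / 2 * INR (cardR (8 * n)))) 1.
Proof.
apply: half_limit cardR_limit (half_card_limit cardR_total cardR2_total cardR_limit).
by have := cardR_const_pos; lra.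
Qed.

Lemma cardS2_half :
  is_lim_seq (fun n => INR (cardS (8 * n - 2)) / (1 / 2 * INR (cardS (8 * n)))) 1.
Proof.
apply: half_limit cardS_limit (half_card_limit cardS_total cardS2_total cardS_limit).
by have := cardS_const_pos; lra.
Qed.

End Asymptotics.

Open Scope R_scope.

Import Asymptotics.

Theorem theorem1p1 :
  (* each of |R_8n|, |S_8n|, |R_(8n-2)|, |S_(8n-2)| is ≍ 16^n log n / sqrt n *)
  (asymp (fun n => INR (cardR (8 * n))) scale /\
   asymp (fun n => INR (cardS (8 * n))) scale /\
   asymp (fun n => INR (cardR (8 * n - 2))) scale /\
   asymp (fun n => INR (cardS (8 * n - 2))) scale) /\
  (* (a) *)
  (is_lim_seq (fun n => INR (cardR (8 * n)) / scale n)
     (Gamma (1 / 4) ^ 2 / (4 * sqrt 2 * PI ^ 3)) /\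
   is_lim_seq (fun n => INR (cardS (8 * n)) / scale n)
     (1 / (2 * (PI * sqrt PI)))) /\
  (* (b) *)
  (is_lim_seq (fun n => INR (cardR (8 * n - 2)) / (1 / 2 * INR (cardR (8 * n)))) 1 /\
   is_lim_seq (fun n => INR (cardS (8 * n - 2)) / (1 / 2 * INR (cardS (8 * n)))) 1).
Proof.
exact (conj
  (conj asymp_cardR (conj asymp_cardS (conj asymp_cardR2 asymp_cardS2)))
  (conj (conj cardR_limit cardS_limit) (conj cardR2_half cardS2_half))).
Qed.
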